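(* Let $\Sigma$ be a real-analytic 3-manifold, $\mathcal{F}(\Sigma)$ its frame bundle with tautological 1-forms $\eta^1,\eta^2,\eta^3$, and let $\widetilde\Sigma=\mathcal{F}(\Sigma)\times\mathbb{R}^6$, with coordinates $(I,K,I_1,I_3,K_1,K_2)$ on $\mathbb{R}^6$. Let $\widetilde{\mathcal I}$ be the exterior differential system on $\widetilde\Sigma$ generated (as a differential ideal) by the forms $$\Theta^1=d\eta^1+I\eta^1\wedge\eta^3-\eta^2\wedge\eta^3,\quad \Theta^2=d\eta^2+\eta^1\wedge\eta^3,\quad \Theta^3=d\eta^3-K\eta^1\wedge\eta^2,$$ $$\theta^1=dI-I_1\eta^1-I_3\eta^3,\quad \theta^2=dK-K_1\eta^1-K_2\eta^2+KI\eta^3,$$ with independence condition $\Omega=\eta^1\wedge\eta^2\wedge\eta^3\ne0$. Then the linear Pfaffian prolongation $(\mathcal{V}(\widetilde{\mathcal I},\Omega),\widetilde{\widetilde{\mathcal I}})$ of $\widetilde{\mathcal I}$ is involutive. Moreover, the analytic integral manifolds of $\widetilde{\widetilde{\mathcal I}}$ depend (in the Cartan–Kähler sense) on 3 functions of 3 variables.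
   Context: Frame bundle. $\mathcal{F}(\Sigma)=\{(u,f_u): u\in\Sigma,\ f_u:T_u\Sigma\to\mathbb{R}^3 \text{ a linear isomorphism}\}$ with projection $\pi$ to $\Sigma$; the tautological $\mathbb{R}^3$-valued 1-form $\eta=(\eta^1,\eta^2,\eta^3)$ is $\eta_{(u,f_u)}(w)=f_u(\pi_*w)$. In local coordinates $x^i$ on $\Sigma$ and matrix coordinates $(f^i_j)\in GL(3,\mathbb{R})$ on the fibre, $\eta^i=f^i_j\,dx^j$. The same letters denote the pullbacks of these forms to $\widetilde\Sigma$. Prolongation. $\mathcal{V}(\widetilde{\mathcal I},\Omega)$ is the set of pairs $(p,E)$, with $p\in\widetilde\Sigma$ and $E\subset T_p\widetilde\Sigma$ a 3-plane, such that all forms of $\widetilde{\mathcal I}$ vanish on $E$ and $\Omega|_E\neq0$; it is a submanifold of the Grassmann bundle $G_3(T\widetilde\Sigma)$. The system $\widetilde{\widetilde{\mathcal I}}$ is the restriction to $\mathcal{V}(\widetilde{\mathcal I},\Omega)$ of the canonical Pfaffian system of $G_3(T\widetilde\Sigma)$: at $(p,E)$ it is generated by the pullbacks of the covectors in $T^*_p\widetilde\Sigma$ annihilating $E$. Its independence condition is the pullback of $\Omega$. Linear Pfaffian systems. Let $N$ be a manifold with pointwise linearly independent 1-forms $\theta^a$ ($1\le a\le s$) and $\omega^i$ ($1\le i\le n$). The pair $(\{\theta^a\},\{\theta^a,\omega^i\})$ is a linear Pfaffian system with independence condition $\omega^1\wedge\dots\wedge\omega^n\ne0$ if $d\theta^a\equiv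 0 \bmod \{\theta^b,\omega^i\}$ for all $a$. Completing to a local coframing by 1-forms $\pi^\epsilon$, one has $d\theta^a\equiv A^a_{\epsilon i}\,\pi^\epsilon\wedge\omega^i+T^a_{ij}\,\omega^i\wedge\omega^j \bmod \{\theta^b\}$. The apparent torsion is absorbable if the $\pi^\epsilon$ can be rechosen so that all $T^a_{ij}=0$. The tableau at $x\in N$ is the linear subspace $A\subset W\otimes V^*$ (with $\dim W=s$, $\dim V=n$) spanned by the matrices $(A^a_{\epsilon i}(x))_{a,i}$. For a basis of $V^*$ let $s_1+\dots+s_k$ be the number of independent entries in the first $k$ columns of $A$; the reduced characters $s_1,\dots,s_n$ are obtained by successively maximizing $s_1$, then $s_2$, and so on, over all bases (flags). The tableau is involutive if $\dim A^{(1)}=s_1+2s_2+\dots+ns_n$, where $A^{(1)}=(A\otimes V^* )\cap(W\otimes S^2V^* )$. The linear Pfaffian system is involutive if at every point the apparent torsion is absorbable and the tableau is involutive. An integral manifold is an $n$-dimensional submanifold on which all $\theta^a$ vanish and $\omega^1\wedge\dots\wedge\omega^n$ is nowhere zero. One says that the integral manifolds depend (in the Cartan–Kähler sense) on $p$ functions of $l$ variables if $s_l=p\neq0$ is the last nonzero reduced character. *)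

(* Defs.v *)
From HB Require Import structures.
From mathcomp Require Import all_boot all_order all_algebra.
From mathcomp Require Import all_classical all_reals all_analysis.

Set Implicit Arguments.
Unset Strict Implicit.
Unset Printing Implicit Defensive.

Import Order.TTheory GRing.Theory Num.Theory.
Import numFieldNormedType.Exports.

Local Open Scope classical_set_scope.
Local Open Scope ring_scope.

Section Analytic.
Variables (R : realType) (V W : normedModType R).
Implicit Types (f : V -> W) (U : set V).

(* [iterD f [:: v1; ...; vk]] is D_v1 (... (D_vk f)). *)
Fixpoint iterD f (vs : seq V) : V -> W :=
  if vs is v :: vs' then fun x => 'D_v (iterD f vs') x else f.

Definition smooth_on U f : Prop :=
  forall (vs : seq V) (x : V), U x -> differentiable (iterD f vs) x.

(* Smooth, and equal near each point to the sum of its Taylor series; the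
   degree-k part of the Taylor series at a is (1/k!) (D_(x-a))^k f (a). *)
Definition analytic_on U f : Prop :=
  smooth_on U f /\
  forall a, U a -> \forall x \near a,
    [series (k`!%:R)^-1 *: iterD f (nseq k (x - a)) a]_k @ \oo --> f x.

End Analytic.

Section LocalForms.
Variables (R : realType) (V : normedModType R).

(* The value at x of a k-form, on k vectors.  Genuine forms also satisfy
   [multilinear_alt]; all operations below preserve that property. *)
Definition lform (k : nat) := V -> ('I_k -> V) -> R.

Definition multilinear_alt k (w : ('I_k -> V) -> R) : Prop :=
  (forall (i : 'I_k) (a : R) (u u' : V) (v : 'I_k -> V),
     w (fun j => if j == i then a *: u + u' else v j) =
     a * w (fun j => if j == i then u else v j) +
     w (fun j => if j == i then u' else v j)) /\
  (forall (v : 'I_k -> V) (i j : 'I_k), i != j -> v i = v j -> w v = 0).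

Definition covec (a : lform 1) (x u : V) : R := a x (fun=> u).

Definition fscale k (f : V -> R) (w : lform k) : lform k :=
  fun x v => f x * w x v.

Definition wedge k (a : lform 1) (w : lform k) : lform k.+1 :=
  fun x v => \sum_(i < k.+1)
    (-1) ^+ i * covec a x (v i) * w x (fun j => v (lift i j)).

Definition dext k (w : lform k) : lform k.+1 :=
  fun x v => \sum_(i < k.+1)
    (-1) ^+ i * 'D_(v i) (fun y => w y (fun j => v (lift i j)) : R^o) x.

Definition dfun (f : V -> R) : lform 1 :=
  dext (fun x (_ : 'I_0 -> V) => f x).

End LocalForms.

Definition pullback (R : realType) (V W : normedModType R) (F : V -> W) k
    (w : lform W k) : lform V k :=
  fun x v => w (F x) (fun i => 'd F x (v i)).

Record charted (R : realType) (V : normedModType R) := Charted {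
  pt :> Type;
  chart : Type;
  dom : chart -> set pt;
  coord : chart -> pt -> V }.

Section Manifolds.
Variables (R : realType) (V : normedModType R) (M : charted V).
Implicit Types (c : chart M) (p : M).

Definition codom_chart c : set V := coord c @` dom c.

Definition overlap c c' : set V := coord c @` (dom c `&` dom c').

Definition transition c c' : V -> V := fun x =>
  xget 0 [set coord c' p | p in [set p | [/\ dom c p, dom c' p & coord c p = x]]].

(* The topology determined by the atlas. *)
Definition mopen (A : set M) : Prop :=
  forall c, open (coord c @` (dom c `&` A)).

Definition analytic_manifold : Prop :=
  [/\ (forall p, exists c, dom c p),
      (forall c p q, dom c p -> dom c q -> coord c p = coord c q -> p = q),
      (forall c c', open (overlap c c') /\
                    analytic_on (overlap c c') (transition c c')),
      (forall p q, p <> q -> exists A B : set M,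
         [/\ mopen A, mopen B, A p, B q & A `&` B = set0]) &
      (exists B : nat -> set M, (forall n, mopen (B n)) /\
         forall (A : set M) p, mopen A -> A p ->
           exists n, B n p /\ B n `<=` A)].

(* A tangent vector at p is the family of its coordinate expressions in the
   charts around p (and 0 in the other charts); these families form a linear
   subspace of [chart M -> V]. *)
Definition tvec := chart M -> V.

Definition tangent p : set tvec := [set v |
  (forall c, ~ dom c p -> v c = 0) /\
  (forall c c', dom c p -> dom c' p ->
     v c' = 'd (transition c c') (coord c p) (v c))].

(* A k-form is given by its local expressions; only the values of w c on
   [codom_chart c] matter. *)
Definition mform (k : nat) := chart M -> lform V k.

Definition smooth_form k (w : mform k) : Prop :=
  [/\ (forall c x, codom_chart c x -> multilinear_alt (w c x)),
      (forall c v, smooth_on (codom_chart c) (fun x => w c x v : R^o)) &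
      (forall c c' x v, overlap c c' x ->
         w c x v = pullback (transition c c') (w c') x v)].

(* The differential ideal generated by G.  As every form is a sum of products
   of functions and 1-forms, it is enough to close under multiplication by
   these. *)
Inductive diff_ideal (G : forall k, mform k -> Prop) :
    forall k, mform k -> Prop :=
| ideal_gen k (w : mform k) : G k w -> diff_ideal G w
| ideal_add k (w w' : mform k) :
    diff_ideal G w -> diff_ideal G w' -> diff_ideal G (w + w')
| ideal_scale k (f : mform 0) (w : mform k) :
    smooth_form f -> diff_ideal G w ->
    diff_ideal G (fun c => fscale (fun x => f c x (fun=> 0)) (w c))
| ideal_wedge k (a : mform 1) (w : mform k) :
    smooth_form a -> diff_ideal G w ->
    diff_ideal G (fun c => wedge (a c) (w c))
| ideal_d k (w : mform k) :
    diff_ideal G w -> diff_ideal G (fun c => dext (w c)).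

Definition is_plane n p (E : set tvec) : Prop :=
  E `<=` tangent p /\
  exists e : 'I_n -> tvec,
    E = [set \sum_(i < n) t i *: e i | t in [set: 'I_n -> R]] /\
    (forall t : 'I_n -> R, \sum_(i < n) t i *: e i = 0 -> forall i, t i = 0).

Definition vanishes_on k (w : mform k) p (E : set tvec) : Prop :=
  forall c, dom c p -> forall v : 'I_k -> tvec, (forall i, E (v i)) ->
    w c (coord c p) (fun i => v i c) = 0.

(* The charts (c, g) of G_n(TM), for dim M = n + q, are indexed by a chart c of
   M and a linear isomorphism g of the model space onto R^n x R^q; the plane E
   has as coordinate the matrix a such that g(E) is the graph of t |-> t a. *)

Record splitting n q := Splitting {
  split_fun :> V -> 'rV[R]_n * 'rV[R]_q;
  split_lin : forall (b : R) u w,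
    split_fun (b *: u + w) = b *: split_fun u + split_fun w;
  split_bij : bijective split_fun }.

Definition graph n q (g : splitting n q) (a : 'M[R]_(n, q)) : set V :=
  [set w | (g w).2 = (g w).1 *m a].

Definition plane_coord n q c (g : splitting n q) p (E : set tvec) :
    set 'M[R]_(n, q) :=
  [set a | forall v, tangent p v -> (E v <-> graph g a (v c))].

Definition grassmann n q : charted (V * 'M[R]_(n, q))%type :=
  @Charted R (V * 'M[R]_(n, q))%type
    {pE : M * set tvec | is_plane n pE.1 pE.2}
    (chart M * splitting n q)
    (fun cg => [set x | dom cg.1 (sval x).1 /\
       plane_coord cg.1 cg.2 (sval x).1 (sval x).2 !=set0])
    (fun cg x => (coord cg.1 (sval x).1,
       xget 0 (plane_coord cg.1 cg.2 (sval x).1 (sval x).2))).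

Definition integral_elements n q (I : forall k, mform k -> Prop)
    (Omega : mform n) : set (grassmann n q) :=
  [set x | (forall k (w : mform k), I k w ->
              vanishes_on w (sval x).1 (sval x).2) /\
           ~ vanishes_on Omega (sval x).1 (sval x).2].

(* psi is the expression in the chart c of an analytic parametrization, by the
   open subset O of R^m, of a relatively open subset of N: an immersion which
   is a homeomorphism onto its image. *)
Definition parametrization (N : set M) c m (O : set 'rV[R]_m)
    (psi : 'rV[R]_m -> V) : Prop :=
  [/\ open O, analytic_on O psi,
      (forall y u, O y -> 'd psi y u = 0 -> u = 0),
      (forall y y', O y -> O y' -> psi y = psi y' -> y = y') &
      (forall O', open O' -> O' `<=` O -> exists2 W : set V, open W &
         psi @` O' = coord c @` (dom c `&` N) `&` W)].

End Manifolds.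

Section Tableaux.
Variables (R : realType) (s n : nat).
Implicit Types (A : {vspace 'M[R]_(s, n)}) (B : 'M[R]_n).

(* Number of independent entries in the first k columns of A, written in the
   basis of V^* corresponding to the invertible matrix B. *)
Definition column_dim A B (k : nat) : nat :=
  \dim (linfun (fun P : 'M[R]_(s, n) =>
                  P *m (B *m (pid_mx k : 'M[R]_n))) @: A)%VS.

Definition character A B (k : nat) : nat :=
  (column_dim A B k - column_dim A B k.-1)%N.

(* ch 1, ..., ch n are the reduced characters. *)
Definition reduced_characters A (ch : nat -> nat) : Prop :=
  (exists2 B, B \in unitmx &
     forall k, (1 <= k <= n)%N -> character A B k = ch k) /\
  (forall B, B \in unitmx -> forall k, (1 <= k <= n)%N ->
     (forall j, (1 <= j < k)%N -> character A B j = ch j) ->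
     (character A B k <= ch k)%N).

(* An element of W (x) V^* (x) V^* is written as sum_i P_i (x) e^i. *)
Definition tableau_prolongation A : {vspace {ffun 'I_n -> 'M[R]_(s, n)}} :=
  ((\bigcap_(i < n)
      (linfun (fun P : {ffun 'I_n -> 'M[R]_(s, n)} => P i) @^-1: A)) :&:
   (\bigcap_(i < n) \bigcap_(j < n)
      lker (linfun (fun P : {ffun 'I_n -> 'M[R]_(s, n)} =>
                      col i (P j) - col j (P i)))))%VS.

Definition involutive_tableau A : Prop :=
  exists2 ch, reduced_characters A ch &
    \dim (tableau_prolongation A) = (\sum_(1 <= k < n.+1) k * ch k)%N.

(* ch l = p is the last nonzero reduced character. *)
Definition last_character A (p l : nat) : Prop :=
  exists2 ch, reduced_characters A ch &
    [/\ (1 <= l <= n)%N, ch l = p, p <> 0%N &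
        forall k, (l < k <= n)%N -> ch k = 0%N].

End Tableaux.

Section Pfaffian.
Variables (R : realType) (m s n : nat).
Local Notation T := ('rV[R]_m).
Implicit Types (O : set T) (theta : 'I_s -> lform T 1)
  (omega : 'I_n -> lform T 1) (y : T).

Definition wedge11 (a b : T -> R) (v : 'I_2 -> T) : R :=
  a (v ord0) * b (v ord_max) - a (v ord_max) * b (v ord0).

Definition linear_pfaffian O theta omega : Prop :=
  (forall y, O y -> forall (t : 'I_s -> R) (u : 'I_n -> R),
     (forall v, \sum_a t a * covec (theta a) y v
                + \sum_i u i * covec (omega i) y v = 0) ->
     (forall a, t a = 0) /\ (forall i, u i = 0)) /\
  (forall y, O y -> forall a,
     exists (beta : 'I_s -> {linear T -> R^o})
            (gamma : 'I_n -> {linear T -> R^o}),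
     forall v, dext (theta a) y v =
       \sum_b wedge11 (beta b) (covec (theta b) y) v +
       \sum_i wedge11 (gamma i) (covec (omega i) y) v).

(* The values at y of theta, omega and pi form a basis of the cotangent space.
   The structure equations at y involve pi only through its value at y. *)
Definition coframe theta omega y r (pi : 'I_r -> {linear T -> R^o}) : Prop :=
  bijective (fun v : T =>
    (\row_a covec (theta a) y v, \row_i covec (omega i) y v, \row_e pi e v)
    : 'rV[R]_s * 'rV[R]_n * 'rV[R]_r).

Definition structure_equations theta omega y r
    (pi : 'I_r -> {linear T -> R^o})
    (A : 'I_s -> 'I_r -> 'I_n -> R) (tau : 'I_s -> 'I_n -> 'I_n -> R) : Prop :=
  forall a, exists beta : 'I_s -> {linear T -> R^o}, forall v,
    dext (theta a) y v =
      \sum_e \sum_i A a e i * wedge11 (pi e) (covec (omega i) y) v +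
      \sum_i \sum_j tau a i j *
        wedge11 (covec (omega i) y) (covec (omega j) y) v +
      \sum_b wedge11 (beta b) (covec (theta b) y) v.

Definition absorbable_torsion theta omega y : Prop :=
  exists r (pi : 'I_r -> {linear T -> R^o}) A,
    coframe theta omega y pi /\
    structure_equations theta omega y pi A (fun _ _ _ => 0).

Definition is_tableau theta omega y (X : {vspace 'M[R]_(s, n)}) : Prop :=
  exists r (pi : 'I_r -> {linear T -> R^o}) A tau,
    [/\ coframe theta omega y pi,
        structure_equations theta omega y pi A tau &
        X = <<[seq \matrix_(a, i) A a e i | e : 'I_r]>>%VS].

Definition involutive_pfaffian O theta omega : Prop :=
  linear_pfaffian O theta omega /\
  forall y, O y ->
    absorbable_torsion theta omega y /\
    forall X, is_tableau theta omega y X -> involutive_tableau X.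

Definition depend_on_functions O theta omega (p l : nat) : Prop :=
  forall y, O y -> forall X, is_tableau theta omega y X -> last_character X p l.

End Pfaffian.

Section Prolongation.
Variables (R : realType) (V : normedModType R) (M : charted V) (n q : nat).

(* The analytic 1-forms theta^a on O generate the pullback by psi of the
   canonical system: at y they span the pullbacks of the covectors on the model
   space of M which annihilate the plane represented by psi y. *)
Definition generates_canonical (g : splitting V n q) m (O : set 'rV[R]_m)
    (psi : 'rV[R]_m -> V * 'M[R]_(n, q)) s
    (theta : 'I_s -> lform 'rV[R]_m 1) : Prop :=
  [/\ (forall a y, O y -> multilinear_alt (theta a y)),
      (forall a v, analytic_on O (fun y => theta a y v : R^o)) &
      (forall y, O y -> forall alpha : 'rV[R]_m -> R,
         (exists t : 'I_s -> R,
            forall u, alpha u = \sum_a t a * covec (theta a) y u) <->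
         (exists2 lam : {linear V -> R^o},
            (forall w, graph g (psi y).2 w -> lam w = 0) &
            forall u, alpha u = lam ('d (fst \o psi) y u)))].

(* N is an analytic submanifold and, near each of its points, there are local
   coordinates and local generators theta of the restriction to N of the
   canonical system such that P holds of theta and of the pullbacks to N of the
   forms omega. *)
Definition canonical_system_locally (N : set (grassmann M n q))
    (omega : 'I_n -> mform M 1)
    (P : forall m s, set 'rV[R]_m -> ('I_s -> lform 'rV[R]_m 1) ->
         ('I_n -> lform 'rV[R]_m 1) -> Prop) : Prop :=
  forall x, N x ->
    exists (cg : chart (grassmann M n q)) (m s : nat) (O : set 'rV[R]_m)
      (psi : 'rV[R]_m -> V * 'M[R]_(n, q))
      (theta : 'I_s -> lform 'rV[R]_m 1),
    [/\ parametrization N cg O psi,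
        dom cg x /\ (psi @` O) (coord cg x),
        generates_canonical cg.2 O psi theta &
        P m s O theta (fun i => pullback (fst \o psi) (omega i cg.1))].

End Prolongation.

Section System.
Variables (R : realType) (S : charted 'rV[R]_3).

(* Linear isomorphisms T_u S -> R^3, extended by 0 outside T_u S so that two
   isomorphisms which agree on T_u S are equal. *)
Definition is_frame (u : S) (f : tvec S -> 'rV[R]_3) : Prop :=
  [/\ (forall v, ~ tangent u v -> f v = 0),
      (forall (a : R) v w, tangent u v -> tangent u w ->
         f (a *: v + w) = a *: f v + f w) &
      set_bij (tangent u) setT f].

(* The matrix (f^i_j) of f in the chart c: f(v)^i = f^i_j v^j. *)
Definition frame_mx (c : chart S) (u : S) (f : tvec S -> 'rV[R]_3) : 'M[R]_3 :=
  xget 0 [set A : 'M[R]_3 | forall v, tangent u v -> f v = v c *m A^T].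

Definition frame_bundle : charted ('rV[R]_3 * 'M[R]_3)%type :=
  @Charted R ('rV[R]_3 * 'M[R]_3)%type
    {uf : S * (tvec S -> 'rV[R]_3) | is_frame uf.1 uf.2}
    (chart S)
    (fun c => [set x | dom c (sval x).1])
    (fun c x => (coord c (sval x).1, frame_mx c (sval x).1 (sval x).2)).

Definition tilde_model : normedModType R :=
  ('rV[R]_3 * 'M[R]_3 * 'rV[R]_6)%type.

Definition Sigma_tilde : charted tilde_model :=
  @Charted R tilde_model
    (frame_bundle * 'rV[R]_6)%type
    (chart frame_bundle)
    (fun c => [set p | dom c p.1])
    (fun c p => (coord c p.1, p.2)).

(* The tautological forms eta^(i+1) = f^(i+1)_j dx^j. *)
Definition eta (i : 'I_3) : lform tilde_model 1 :=
  fun z v => \sum_(j < 3) z.1.2 i j * (v ord0).1.1 0 j.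

Definition eta1 := eta (@Ordinal 3 0 isT).
Definition eta2 := eta (@Ordinal 3 1 isT).
Definition eta3 := eta (@Ordinal 3 2 isT).

(* The coordinates (I, K, I_1, I_3, K_1, K_2) of R^6. *)
Definition cI (z : tilde_model) : R := z.2 0 (@Ordinal 6 0 isT).
Definition cK (z : tilde_model) : R := z.2 0 (@Ordinal 6 1 isT).
Definition cI1 (z : tilde_model) : R := z.2 0 (@Ordinal 6 2 isT).
Definition cI3 (z : tilde_model) : R := z.2 0 (@Ordinal 6 3 isT).
Definition cK1 (z : tilde_model) : R := z.2 0 (@Ordinal 6 4 isT).
Definition cK2 (z : tilde_model) : R := z.2 0 (@Ordinal 6 5 isT).

Definition Theta1 : lform tilde_model 2 :=
  dext eta1 + fscale cI (wedge eta1 eta3) - wedge eta2 eta3.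
Definition Theta2 : lform tilde_model 2 :=
  dext eta2 + wedge eta1 eta3.
Definition Theta3 : lform tilde_model 2 :=
  dext eta3 - fscale cK (wedge eta1 eta2).
Definition theta1 : lform tilde_model 1 :=
  dfun cI - fscale cI1 eta1 - fscale cI3 eta3.
Definition theta2 : lform tilde_model 1 :=
  dfun cK - fscale cK1 eta1 - fscale cK2 eta2
  + fscale (fun z => cK z * cI z) eta3.

Inductive generators : forall k, mform Sigma_tilde k -> Prop :=
| gen_Theta1 : generators (fun=> Theta1)
| gen_Theta2 : generators (fun=> Theta2)
| gen_Theta3 : generators (fun=> Theta3)
| gen_theta1 : generators (fun=> theta1)
| gen_theta2 : generators (fun=> theta2).

Definition I_tilde : forall k, mform Sigma_tilde k -> Prop :=
  diff_ideal generators.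

Definition Omega : mform Sigma_tilde 3 :=
  fun=> wedge eta1 (wedge eta2 eta3).

(* dim Sigma_tilde = 18 = 3 + 15 *)
Definition prolongation_space : set (grassmann Sigma_tilde 3 15) :=
  integral_elements I_tilde Omega.

End System.

(* Main.v *)
(* A 3-plane with Omega <> 0 is the graph of a linear map r |-> jet z p r, and
   the vanishing of Theta^i, theta^a and d theta^a on it leaves 24 free
   parameters p: the symmetric parts of the connection coefficients of the df
   and six second derivatives of I and K.  The first derivatives of p along the
   plane can be chosen so that the field of vectors jet z p r has symmetric
   derivatives (second_jet; this is where the Bianchi-type identities enter).
   By Leibniz' rule, the exterior derivative of a form which vanishes on all the
   planes jet z p then vanishes on them too, so that they are integral elements
   of the whole differential ideal; and the same symmetry absorbs the torsion of
   the contact forms dw - jet z p (dx).  The tableau is the sum of three copies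
   of S^2 V* and of two copies of S^2 of a plane of V*.  Its reduced characters
   are 13, 8, 3, and its prolongation has dimension
   3 * 10 + 2 * 4 = 38 = 13 + 2 * 8 + 3 * 3. *)

(* Two obstacles shape the proof. The ideal is closed under repeated exterior differentiation, so a
   plane cannot be tested against finitely many forms. The induction therefore carries the claim
   that a form vanishes on all planes [jet z p] over a chart at once; this is stable under d because
   a plane can be moved, inside the family, along each of its own directions. Secondly, the frame
   coordinates change by a Jacobian whose derivative is not tensorial; but the equations of integral
   elements only involve eta, d eta and the scalars, and these are invariant. Analyticity comes from
   polynomials: in the coordinates (x, f, y, p), of dimension 3 + 15 + 24, the parametrization of
   the prolongation and the contact forms are polynomial. Origin of the numbers: 24 = 3 * 6 + 2 * 3
   counts the coefficients of three ternary and two binary quadratic forms. One column has at most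
   13 = 15 - 2 independent entries, since dI and dK contain no free parameter; two columns have at
   most 21 = 24 - 3, since three squares of a covector are killed by them. *)
From HB Require Import structures.
Require Import Defs.
From mathcomp Require Import all_boot all_order all_algebra.
From mathcomp Require Import all_classical all_reals all_analysis.
From mathcomp Require Import ring lra zify.
Import numFieldNormedType.Exports.

Set Implicit Arguments.
Unset Strict Implicit.
Unset Printing Implicit Defensive.

Import Order.TTheory GRing.Theory Num.Theory.

Local Open Scope classical_set_scope.
Local Open Scope ring_scope.
Local Notation iterD := Defs.iterD.
Local Notation coord := Defs.coord.

(** * Smooth and polynomial maps *)

Section Calculus.
Variables (R : realType) (V W : normedModType R).
Implicit Types (f g : V -> W) (k : V -> R^o) (U : set V).

(** Many identities between maps hold only on an open set, so differentiability is transported along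
    equality of germs: the expansion of [f] at [x] is also one of [g], and [diff_unique] identifies
    the differential. *)
Lemma differentiable_eq_near f g x :
  (\forall y \near x, f y = g y) -> differentiable f x -> differentiable g x.
Proof.
move=> fg df.
have fgx := nbhs_singleton fg.
have fg0 : \forall h \near (0 : V), (f \o shift x) h = (g \o shift x) h.
  have := fg; rewrite (near_shift (0 : V)) => h; near=> z => /=.
  rewrite -[x]subr0; near: z; exact: h.
have E : g \o shift x = cst (g x) + 'd f x +o_ (0 : V) id.
  apply/eqaddoP => e e0.
  have /eqaddoP/(_ e e0) := diff_locally df.
  apply: filter_app; near=> h => /=.
  suff -> : (g \o shift x - (cst (g x) + 'd f x)) h =
    (f \o shift x - (cst (f x) + 'd f x)) h by [].
  rewrite [LHS](_ : _ = (g \o shift x) h - (g x + 'd f x h)) //.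
  by rewrite -fgx -(near fg0 h).
have dc : continuous ('d f x) by exact: diff_continuous.
by apply/diff_locallyP; rewrite (diff_unique dc E).
Unshelve. all: by end_near. Qed.

Lemma open_near U x : open U -> U x -> \forall y \near x, U y.
Proof. by move=> oU Ux; apply: open_nbhs_nbhs. Qed.

Lemma scale_is_bilinear : bilinear_for
    (GRing.Scale.Law.clone _ _ *:%R _) (GRing.Scale.Law.clone _ _ *:%R _)
    (fun (a : R^o) (w : W) => a *: w).
Proof.
split=> [w|a] c x y /=.
- by rewrite scalerDl scalerA.
- by rewrite scalerDr !scalerA mulrC.
Qed.

(** Scaling is the bilinear map [b], composed here with the pair ([k], [f]). *)
Lemma is_diff_scaled k f x (dk : V -> R^o) (df : V -> W) :
  is_diff x k dk -> is_diff x f df ->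
  is_diff x (fun y => k y *: f y) (fun v => k x *: df v + dk v *: f x).
Proof.
move=> hk hf.
pose bM := bilinear_isBilinear.Build R R^o W W _ _ _ scale_is_bilinear.
pose b : {bilinear R^o -> W -> W} := HB.pack (fun (a : R^o) (w : W) => a *: w) bM.
have bc : continuous (fun p : R^o * W => b p.1 p.2).
  by move=> p; apply: scale_continuous.
have H : is_diff (k x, f x) (fun p : R^o * W => b p.1 p.2)
   (fun q => k x *: q.2 + q.1 *: f x).
  apply: DiffDef; first exact: differentiable_bilin.
  by rewrite diff_bilin.
have -> : (fun y => k y *: f y) =
  (fun p : R^o * W => b p.1 p.2) \o (fun y => (k y, f y)) by [].
exact: is_diff_eq.
Qed.

Lemma differentiable_scaled k f x : differentiable k x -> differentiable f x ->
  differentiable (fun y => k y *: f y) x.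
Proof.
by move=> /differentiableP ? /differentiableP ?; case: (@is_diff_scaled k f x _ _ _ _).
Qed.

Lemma derive_scaled k f x v : differentiable k x -> differentiable f x ->
  'D_v (fun y => k y *: f y) x = k x *: 'D_v f x + 'D_v k x *: f x.
Proof.
move=> dk df; rewrite !deriveE //; last exact: differentiable_scaled.
have hk := differentiableP dk; have hf := differentiableP df.
by rewrite (@diff_val _ _ _ _ _ _ _ (is_diff_scaled hk hf)).
Qed.

Lemma derive_eq_near f g x v :
  (\forall y \near x, f y = g y) -> 'D_v f x = 'D_v g x.
Proof. by move=> ?; apply: near_eq_derive. Qed.

End Calculus.

Section Smooth.
Variables (R : realType) (V : normedModType R) (U : set V).
Hypothesis oU : open U.

(** The last vector is differentiated first. Peeling the list from the right replaces [f] by one of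
    its derivatives, which is the step used in inductions on smoothness. *)
Lemma iterD_rcons (W : normedModType R) (f : V -> W) vs v :
  iterD f (rcons vs v) = iterD (fun x => 'D_v f x) vs.
Proof. by elim: vs => //= u vs ->. Qed.

Lemma iterD_eq (W : normedModType R) (f g : V -> W) :
  (forall x, U x -> f x = g x) ->
  forall vs x, U x -> iterD f vs x = iterD g vs x.
Proof.
move=> fg; elim=> [|v vs IH] x Ux /=; first exact: fg.
by apply: derive_eq_near; apply: filterS (open_near oU Ux) => y; apply: IH.
Qed.

Lemma smooth_on_differentiable (W : normedModType R) (f : V -> W) x :
  smooth_on U f -> U x -> differentiable f x.
Proof. by move=> sf; apply: (sf [::]). Qed.

Lemma smooth_on_derive (W : normedModType R) (f : V -> W) v :
  smooth_on U f -> smooth_on U (fun x => 'D_v f x).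
Proof. by move=> sf vs x; rewrite -iterD_rcons; apply: sf. Qed.

Lemma smooth_onP (W : normedModType R) (f : V -> W) :
  smooth_on U f <-> (forall x, U x -> differentiable f x) /\
                    (forall v, smooth_on U (fun x => 'D_v f x)).
Proof.
split=> [sf|[df sf]].
  by split=> [x|v]; [apply: smooth_on_differentiable|apply: smooth_on_derive].
by elim/last_ind=> [|vs v _] x; [exact: df|rewrite iterD_rcons; apply: sf].
Qed.

Lemma iterD_add (W : normedModType R) (f g : V -> W) :
  smooth_on U f -> smooth_on U g ->
  forall vs x, U x -> iterD (fun x => f x + g x) vs x = iterD f vs x + iterD g vs x.
Proof.
move=> sf sg; elim=> [|v vs IH] x Ux //=.
rewrite -deriveD; [|by apply/diff_derivable/sf|by apply/diff_derivable/sg].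
by apply: derive_eq_near; apply: filterS (open_near oU Ux) => y; apply: IH.
Qed.

Lemma smooth_on_add (W : normedModType R) (f g : V -> W) :
  smooth_on U f -> smooth_on U g -> smooth_on U (fun x => f x + g x).
Proof.
move=> sf sg vs x Ux.
apply: (@differentiable_eq_near _ _ _ (iterD f vs + iterD g vs)).
  by apply: filterS (open_near oU Ux) => y Uy; rewrite iterD_add.
by apply: differentiableD; [apply: sf|apply: sg].
Qed.

Lemma smooth_on_cst (W : normedModType R) (w : W) : smooth_on U (fun=> w).
Proof.
move=> vs x _; suff [w' ->] : exists w', iterD (fun _ : V => w) vs = fun=> w'.
  exact: differentiable_cst.
elim: vs => [|v vs [w' E]] /=; first by exists w.
by exists 0; rewrite E; apply: funext => y; exact: derive_cst.
Qed.

Lemma smooth_on_sum (W : normedModType R) (I : Type) (r : seq I) (P : pred I)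
    (f : I -> V -> W) : (forall i, P i -> smooth_on U (f i)) ->
  smooth_on U (fun x => \sum_(i <- r | P i) f i x).
Proof.
move=> sf; elim: r => [|i r IH].
  have -> : (fun x => \sum_(i <- [::] | P i) f i x) = fun=> 0.
    by apply: funext => x; rewrite big_nil.
  exact: smooth_on_cst.
have -> : (fun x => \sum_(i <- i :: r | P i) f i x) = fun x =>
    (if P i then f i x else 0) + \sum_(i <- r | P i) f i x.
  by apply: funext => x; rewrite big_cons; case: ifP => //; rewrite add0r.
apply: smooth_on_add => //; case Pi: (P i); [exact: sf|exact: smooth_on_cst].
Qed.

(** Induction on the number of derivatives: one derivative of the product is a sum of two products
    of smooth maps, on which one derivative fewer remains to be taken. *)
Lemma smooth_on_scaled (W : normedModType R) (k : V -> R^o) (f : V -> W) :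
  smooth_on U k -> smooth_on U f -> smooth_on U (fun x => k x *: f x).
Proof.
move=> sk sf vs; move: {-1}(size vs) (leqnn (size vs)) => n.
elim: n vs k f sk sf => [|n IH] vs k f sk sf le_n x Ux.
  move: le_n; rewrite leqn0 => /nilP ->.
  by apply: differentiable_scaled; [apply: (sk [::])|apply: (sf [::])].
case/lastP: vs le_n => [_|vs v].
  by apply: differentiable_scaled; [apply: (sk [::])|apply: (sf [::])].
rewrite size_rcons ltnS iterD_rcons => le_n.
have E y : U y -> k y *: 'D_v f y + 'D_v k y *: f y = 'D_v (fun y => k y *: f y) y.
  by move=> Uy; rewrite derive_scaled //; [apply: (sk [::])|apply: (sf [::])].
have s1 : smooth_on U (fun y => 'D_v f y) by exact: smooth_on_derive.
have s2 : smooth_on U (fun y => 'D_v k y : R^o) by exact: smooth_on_derive.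
have d1 z : U z -> differentiable (iterD (fun y => k y *: 'D_v f y) vs) z.
  by move=> Uz; apply: IH.
have d2 z : U z -> differentiable (iterD (fun y => ('D_v k y : R^o) *: f y) vs) z.
  by move=> Uz; apply: IH.
apply: (@differentiable_eq_near _ _ _
  (iterD (fun y => k y *: 'D_v f y) vs + iterD (fun y => 'D_v k y *: f y) vs));
  last by apply: differentiableD; [apply: d1|apply: d2].
apply: filterS (open_near oU Ux) => y Uy.
rewrite -(iterD_eq E vs Uy).
(* [iterD_add] asks for smoothness of both summands, which is what is being proved; up to order [n]
   the induction hypothesis is enough. *)
suff H ws z : (size ws <= n)%N -> U z ->
    iterD (fun y => k y *: 'D_v f y) ws z + iterD (fun y => 'D_v k y *: f y) ws z =
    iterD (fun y => k y *: 'D_v f y + 'D_v k y *: f y) ws z by exact: H.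
elim: ws z => [|u ws IHw] z //= lt_n Uz.
rewrite -deriveD; try by apply: diff_derivable; apply: IH => //; apply: ltnW.
apply: derive_eq_near; apply: filterS (open_near oU Uz) => z' Uz' /=.
by apply: IHw => //; apply: ltnW.
Qed.

Lemma smooth_on_linear (W : normedModType R) (f : {linear V -> W}) :
  continuous f -> smooth_on U f.
Proof.
move=> cf; apply/smooth_onP; split=> [x _|v]; first exact: linear_differentiable.
have -> : (fun x => 'D_v f x) = fun=> f v; last exact: smooth_on_cst.
by apply: funext => x; rewrite deriveE ?diff_lin //; exact: linear_differentiable.
Qed.

End Smooth.

(** * Polynomial maps are analytic *)

Section PolyMap.
Variables (R : realType) (V : normedModType R).

(** The Taylor terms in [analytic_on] are derivatives along the line from a to x, so being
    polynomial on every line is enough to sum them. A pair is (degree, coefficient); degrees may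
    repeat, which turns sums of maps into concatenations. *)
Definition polynomial_along (W : normedModType R) (f : V -> W) := forall a v,
  exists s : seq (nat * W), forall t : R,
    f (a + t *: v) = \sum_(c <- s) t ^+ c.1 *: c.2.

Definition poly_map (W : normedModType R) (f : V -> W) :=
  smooth_on setT f /\ polynomial_along f.

Lemma derive_along (W : normedModType R) (f : V -> W) a v t :
  'D_v f (a + t *: v) = 'D_1 (fun t : R^o => f (a + t *: v)) t.
Proof.
pose q (h : R) := h^-1 *: (f (a + (h *: (1 : R^o) + t) *: v) - f (a + t *: v)).
rewrite -[RHS]/(lim (q @ 0^')) /derive;
suff -> : q = fun h : R => h^-1 *: ((f \o shift (a + t *: v)) (h *: v) -
  f (a + t *: v)) by [].
by apply: funext => h; rewrite /q /= [h *: 1]mulr1 scalerDl addrCA.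
Qed.

(** The falling factorial vanishes as soon as k exceeds the degree, so the truncated subtraction in
    the exponent is harmless. *)
Lemma derive_monomials (W : normedModType R) (s : seq (nat * W)) (k : nat) (t : R) :
  'D_1 (fun t : R^o => \sum_(c <- s) ((c.1 ^_ k)%:R * t ^+ (c.1 - k)) *: c.2 : W) t =
  \sum_(c <- s) ((c.1 ^_ k.+1)%:R * t ^+ (c.1 - k.+1)) *: c.2.
Proof.
pose F (c : nat * W) (t : R^o) : W := ((c.1 ^_ k)%:R * t ^+ (c.1 - k)) *: c.2.
have dpow n (x : R^o) : differentiable (fun t : R^o => t ^+ n : R^o) x.
  exact/derivable1_diffP/exprn_derivable.
have E c (x : R^o) : differentiable (F c) x /\
    'D_1 (F c) x = ((c.1 ^_ k.+1)%:R * x ^+ (c.1 - k.+1)) *: c.2.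
  have -> : F c = fun t : R^o => (t ^+ (c.1 - k) : R^o) *: ((c.1 ^_ k)%:R *: c.2).
    by apply: funext => y; rewrite /F scalerA mulrC.
  split; first by apply: differentiable_scaled.
  rewrite derive_scaled // derive_cst scaler0 add0r exp_derive scalerA.
  congr (_ *: _); rewrite ffactnSr natrM /GRing.scale /= mulr1 subnS.
  by rewrite -mulr_natl mulrC mulrA.
suff [_ ->] : differentiable (fun t : R^o => \sum_(c <- s) F c t) t /\
  'D_1 (fun t : R^o => \sum_(c <- s) F c t) t =
  \sum_(c <- s) ((c.1 ^_ k.+1)%:R * t ^+ (c.1 - k.+1)) *: c.2 by [].
elim: s => [|c s [IH1 IH2]].
  have -> : (fun t : R^o => \sum_(c <- [::]) F c t) = fun=> 0.
    by apply: funext => x; rewrite big_nil.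
  by rewrite big_nil; split=> //; exact: derive_cst.
have -> : (fun t : R^o => \sum_(c <- c :: s) F c t) =
   F c + (fun t : R^o => \sum_(c <- s) F c t).
  by apply: funext => x; rewrite big_cons.
have [d1 e1] := E c t; split; first exact: differentiableD.
by rewrite deriveD ?e1 ?IH2 ?big_cons //; apply: diff_derivable.
Qed.

Lemma iterD_along (W : normedModType R) (f : V -> W) a v s :
  (forall t : R, f (a + t *: v) = \sum_(c <- s) t ^+ c.1 *: c.2) ->
  forall k t, iterD f (nseq k v) (a + t *: v) =
    \sum_(c <- s) ((c.1 ^_ k)%:R * t ^+ (c.1 - k)) *: c.2.
Proof.
move=> fs; elim=> [|k IH] t /=.
  by rewrite fs; apply: eq_bigr => c _; rewrite ffactn0 mul1r subn0.
rewrite derive_along -derive_monomials; congr derive.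
by apply: funext => x; rewrite IH.
Qed.

(** The Taylor term of degree k is the sum of the coefficients of degree k, so the partial sums
    become constant, equal to f x, past the largest degree. *)
Lemma poly_map_analytic (W : normedModType R) (f : V -> W) (U : set V) :
  poly_map f -> analytic_on U f.
Proof.
move=> [sf pf]; split=> [vs x _|a _]; first exact: sf.
apply: nearW => x.
have [s fs] := pf a (x - a).
have T k : (k`!%:R)^-1 *: iterD f (nseq k (x - a)) a =
    \sum_(c <- s | c.1 == k) c.2.
  rewrite -[X in iterD _ _ X]addr0 -(scale0r (x - a)) (iterD_along fs).
  rewrite scaler_sumr [RHS]big_mkcond; apply: eq_bigr => c _ /=.
  have [lt_ck|lt_kc|<-] := ltngtP c.1 k.
  - by rewrite ffact_small // mul0r scale0r scaler0.
  - by rewrite expr0n subn_eq0 leqNgt lt_kc mulr0 scale0r scaler0.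
  by rewrite subnn expr0 mulr1 ffactnn scalerA mulVf ?scale1r // pnatr_eq0 -lt0n fact_gt0.
have -> : f x = \sum_(c <- s) c.2.
  have := fs 1; rewrite scale1r [a + _]addrC subrK => ->.
  by apply: eq_bigr => c _; rewrite expr1n scale1r.
apply: cvg_near_cst; exists (\max_(c <- s) c.1).+1 => // n /= lt_n.
rewrite /series /= (eq_bigr _ (fun k _ => T k)).
rewrite (exchange_big_dep predT) //= big_seq [RHS]big_seq; apply: eq_bigr => c cs.
under eq_bigl do rewrite eq_sym.
rewrite big_mkord (big_ord1_eq _ (fun _ => c.2)) ifT //.
by apply: leq_trans lt_n; rewrite ltnS; apply: leq_bigmax_seq.
Qed.

Lemma poly_map_cst (W : normedModType R) (w : W) : poly_map (fun=> w).
Proof.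
split; first exact: smooth_on_cst.
move=> a v; exists [:: (0%N, w)] => t.
by rewrite big_seq1 expr0 scale1r.
Qed.

Lemma poly_map_add (W : normedModType R) (f g : V -> W) :
  poly_map f -> poly_map g -> poly_map (fun x => f x + g x).
Proof.
move=> [sf pf] [sg pg]; split; first exact: (smooth_on_add openT sf sg).
move=> a v; have [s fs] := pf a v; have [s' gs] := pg a v.
by exists (s ++ s') => t; rewrite big_cat fs gs.
Qed.

Lemma poly_map_scaled (W : normedModType R) (k : V -> R^o) (f : V -> W) :
  poly_map k -> poly_map f -> poly_map (fun x => k x *: f x).
Proof.
move=> [sk pk] [sf pf]; split; first exact: (smooth_on_scaled openT sk sf).
move=> a v; have [s ks] := pk a v; have [s' fs] := pf a v.
exists [seq (c.1 + d.1, c.2 *: d.2)%N | c <- s, d <- s'] => t.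
rewrite ks fs scaler_suml big_allpairs_dep /=.
apply: eq_bigr => c _; rewrite scaler_sumr; apply: eq_bigr => d _ /=.
by rewrite !scalerA exprD; congr (_ *: _); rewrite /GRing.scale /=; ring.
Qed.

Lemma poly_map_linear (W : normedModType R) (f : {linear V -> W}) :
  continuous f -> poly_map f.
Proof.
move=> cf; split; first exact: (smooth_on_linear cf).
move=> a v; exists [:: (0%N, f a); (1%N, f v)] => t.
by rewrite big_cons big_seq1 expr0 scale1r expr1 linearD linearZ.
Qed.

Lemma poly_map_opp (W : normedModType R) (f : V -> W) :
  poly_map f -> poly_map (fun x => - f x).
Proof.
move=> pf; have -> : (fun x => - f x) = fun x => (-1 : R^o) *: f x.
  by apply: funext => x; rewrite scaleN1r.
by apply: poly_map_scaled => //; apply: poly_map_cst.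
Qed.

Lemma poly_map_sum (W : normedModType R) (I : Type) (r : seq I) (P : pred I)
    (f : I -> V -> W) : (forall i, P i -> poly_map (f i)) ->
  poly_map (fun x => \sum_(i <- r | P i) f i x).
Proof.
move=> sf; elim: r => [|i r IH].
  have -> : (fun x => \sum_(i <- [::] | P i) f i x) = fun=> 0.
    by apply: funext => x; rewrite big_nil.
  exact: poly_map_cst.
have -> : (fun x => \sum_(i <- i :: r | P i) f i x) = fun x =>
    (if P i then f i x else 0) + \sum_(i <- r | P i) f i x.
  by apply: funext => x; rewrite big_cons; case: ifP => //; rewrite add0r.
apply: poly_map_add => //; case Pi: (P i); [exact: sf|exact: poly_map_cst].
Qed.

End PolyMap.

(** * Symmetry of second derivatives *)

Section SymmetricDerivatives.
Variables (R : realType) (V : normedModType R).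

Lemma is_derive_along (W : normedModType R) (f : V -> W) a v t :
  derivable f (a + t *: v) v ->
  is_derive (t : R^o) 1 (fun t : R^o => f (a + t *: v)) ('D_v f (a + t *: v)).
Proof.
move=> df; apply: DeriveDef; last by rewrite derive_along.
move: df; rewrite /derivable.
suff -> : (fun h => h^-1 *: (((fun t : R^o => f (a + t *: v)) \o shift t) (h *: (1 : R^o)) -
      f (a + t *: v))) =
    (fun h : R => h^-1 *: ((f \o shift (a + t *: v)) (h *: v) - f (a + t *: v))) by [].
by apply: funext => h; rewrite /= [h *: 1]mulr1 scalerDl addrCA.
Qed.

Lemma derive_translate (W : normedModType R) (f : V -> W) c x v :
  'D_v (f \o shift c) x = 'D_v f (x + c).
Proof.
pose q (h : R) := h^-1 *: (f (h *: v + x + c) - f (x + c)).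
pose q' (h : R) := h^-1 *: (f (h *: v + (x + c)) - f (x + c)).
rewrite -[LHS]/(lim (q @ 0^')) -[RHS]/(lim (q' @ 0^')).
by have -> : q = q' by apply: funext => h; rewrite /q /q' addrA.
Qed.

Lemma mean_value_along (f : V -> R^o) a v (h : R) : 0 <= h ->
  (forall t, 0 <= t <= h -> differentiable f (a + t *: v)) ->
  exists2 t, 0 <= t <= h & f (a + h *: v) - f a = 'D_v f (a + t *: v) * h.
Proof.
move=> h0 df.
pose F (t : R^o) : R^o := f (a + t *: v).
have dF t : 0 <= t <= h -> is_derive (t : R^o) 1 F ('D_v f (a + t *: v)).
  by move=> th; apply: is_derive_along; apply/diff_derivable/df.
have [t| |t th E] := @MVT_segment R F (fun t => 'D_v f (a + t *: v)) 0 h h0.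
- by rewrite in_itv /= => /andP[t0 th]; apply: dF; rewrite !ltW.
- apply: derivable_within_continuous => t; rewrite in_itv /= => th.
  by case: (dF t th).
exists t; first by move: th; rewrite in_itv.
by move: E; rewrite /F scale0r addr0 subr0.
Qed.

(** Mean value theorem twice: along [v] for the difference between [f] and its translate by h w,
    then along [w] for ['D_v f]. *)
Lemma second_difference (f : V -> R^o) U x v w (h : R) :
  open U -> smooth_on U f -> 0 <= h ->
  (forall s t, 0 <= s <= h -> 0 <= t <= h -> U (x + s *: v + t *: w)) ->
  exists s t, [/\ 0 <= s <= h, 0 <= t <= h &
    f (x + h *: v + h *: w) - f (x + h *: v) - (f (x + h *: w) - f x) =
    'D_w (fun y => 'D_v f y) (x + s *: v + t *: w) * h * h].
Proof.
move=> oU sf h0 hU.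
have h00 : (0 : R) <= 0 <= h by rewrite lexx.
have hh : (0 : R) <= h <= h by rewrite lexx h0.
have dfU y : U y -> differentiable f y by move=> Uy; exact: (sf [::]).
pose T : V -> V := shift (h *: w).
have dT y : differentiable T y.
  by apply: differentiableD => //; exact: differentiable_cst.
have dg s : 0 <= s <= h -> differentiable (f \o T) (x + s *: v).
  by move=> sh; apply: differentiable_comp => //; apply: dfU; apply: hU.
have df s : 0 <= s <= h -> differentiable f (x + s *: v).
  by move=> sh; apply: dfU; rewrite -[_ + _]addr0 -(scale0r w); apply: hU.
have [s sh] := @mean_value_along (f \o T - f) x v h h0
  (fun s sh => differentiableB (dg s sh) (df s sh)).
have -> : 'D_v (f \o T - f) (x + s *: v) =
    'D_v f (x + s *: v + h *: w) - 'D_v f (x + s *: v).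
  rewrite deriveB; [|exact/diff_derivable/dg|exact/diff_derivable/df].
  by rewrite derive_translate.
have [t th E2 E1] := @mean_value_along (fun y => 'D_v f y) (x + s *: v) w h h0
  (fun t th => smooth_on_derive v sf [::] (hU s t sh th)).
by exists s, t; split=> //; move: E1; rewrite E2.
Qed.

(** Two different points y and z are allowed because the two orders of differentiation produce
    different intermediate points in the same small square. *)
Lemma eq_of_nbhs (F G : V -> R^o) (x : V) :
  {for x, continuous F} -> {for x, continuous G} ->
  (forall A, nbhs x A -> exists y z, [/\ A y, A z & F y = G z]) -> F x = G x.
Proof.
move=> /cvgrPdist_le cF /cvgrPdist_le cG H.
apply/eqP; rewrite -subr_eq0 -normr_le0; apply/ler_addgt0Pr => e e0; rewrite add0r.
have e2 : 0 < e / 2 by rewrite divr_gt0.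
have [y [z [[H1 _] [_ H2] E]]] := H _ (filterI (cF _ e2) (cG _ e2)).
rewrite (splitr e); apply: le_trans (lerD H1 H2).
by rewrite E -[X in _ <= _ + X]normrN opprB; apply: le_trans (ler_normD _ _); rewrite addrA subrK.
Qed.

Lemma nbhs_square (x v w : V) A : nbhs x A -> exists2 h : R, 0 < h &
  forall s t, 0 <= s <= h -> 0 <= t <= h -> A (x + s *: v + t *: w).
Proof.
move=> /nbhs_ballP[d d0 Hd].
pose N := `|v| + `|w| + 1.
have N0 : 0 < N by rewrite ltr_pwDr // addr_ge0.
exists (d / 2 / N); first by rewrite !divr_gt0.
move=> s t /andP[s0 sh] /andP[t0 th]; apply: Hd.
have h0 : 0 < d / 2 / N by rewrite !divr_gt0.
rewrite -ball_normE /= -addrA opprD addrA subrr sub0r normrN.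
apply: (@le_lt_trans _ _ (d / 2 / N * N)); last first.
  by rewrite divfK ?gt_eqF // ltr_pdivrMr // ltr_pMr // ltr1n.
apply: le_trans (ler_normD _ _) _; rewrite !normrZ !ger0_norm // /N.
apply: (@le_trans _ _ (d / 2 / N * `|v| + d / 2 / N * `|w|)).
  by apply: lerD; apply: ler_wpM2r.
by rewrite -mulrDr ler_pM2l // lerDl.
Qed.

(** The second difference over a square of side h is symmetric in [v] and [w], and equals h^2 times
    either mixed derivative at some point of the square; [eq_of_nbhs] lets the square shrink. *)
Lemma derive_sym_scalar (f : V -> R^o) U x v w : open U -> smooth_on U f -> U x ->
  'D_w (fun y => 'D_v f y) x = 'D_v (fun y => 'D_w f y) x.
Proof.
move=> oU sf Ux.
have dF : differentiable (fun y => 'D_w (fun y => 'D_v f y) y : R^o) x := sf [:: w; v] x Ux.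
have dG : differentiable (fun y => 'D_v (fun y => 'D_w f y) y : R^o) x := sf [:: v; w] x Ux.
have cF := differentiable_continuous dF.
have cG := differentiable_continuous dG.
apply: (eq_of_nbhs cF cG) => A nA.
have [h h0 hA] := nbhs_square v w (filterI (open_near oU Ux) nA).
have U1 s t : 0 <= s <= h -> 0 <= t <= h -> U (x + s *: v + t *: w).
  by move=> sh th; case: (hA s t sh th).
have U2 s t : 0 <= s <= h -> 0 <= t <= h -> U (x + s *: w + t *: v).
  by move=> sh th; rewrite addrAC; apply: U1.
have [s [t [sh th E1]]] := @second_difference f U x v w h oU sf (ltW h0) U1.
have [t' [s' [th' sh' E2]]] := @second_difference f U x w v h oU sf (ltW h0) U2.
exists (x + s *: v + t *: w), (x + s' *: v + t' *: w).
split; [by case: (hA s t sh th)|by case: (hA s' t' sh' th')|].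
apply: (mulIf (lt0r_neq0 h0)); apply: (mulIf (lt0r_neq0 h0)).
rewrite [x + s' *: v + _]addrAC; apply: etrans (etrans (esym E1) _) E2.
by rewrite [x + h *: w + _]addrAC !opprB !addrA; ring.
Qed.

Lemma derive_coord m n (f : V -> 'M[R]_(m, n)) x v i j :
  derivable f x v -> ('D_v f x) i j = 'D_v (fun y => f y i j) x.
Proof. by move=> df; rewrite derive_mx // mxE. Qed.

Lemma smooth_on_coord m n U (f : V -> 'M[R]_(m, n)) i j : open U ->
  smooth_on U f -> smooth_on U (fun y => f y i j : R^o).
Proof.
move=> oU sf.
suff E vs x : U x -> iterD (fun y => f y i j : R^o) vs x = iterD f vs x i j.
  move=> vs x Ux; apply: (@differentiable_eq_near _ _ _ (fun y => iterD f vs y i j)).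
    by apply: filterS (open_near oU Ux) => y Uy; rewrite E.
  exact: (differentiable_comp (sf vs x Ux) (differentiable_coord _ i j)).
elim: vs x => [|u vs IH] x Ux //=.
rewrite derive_coord; last exact/diff_derivable/sf.
by apply: derive_eq_near; apply: filterS (open_near oU Ux) => y; apply: IH.
Qed.

Lemma derive_sym m n (f : V -> 'M[R]_(m, n)) U x v w : open U -> smooth_on U f ->
  U x -> 'D_w (fun y => 'D_v f y) x = 'D_v (fun y => 'D_w f y) x.
Proof.
move=> oU sf Ux; apply/matrixP => i j.
have E u u' : ('D_u (fun y => 'D_u' f y) x) i j =
    'D_u (fun y => 'D_u' (fun z => f z i j : R^o) y) x.
  rewrite derive_coord; last exact/diff_derivable/(sf [:: u']).
  apply: derive_eq_near; apply: filterS (open_near oU Ux) => y Uy.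
  by rewrite derive_coord //; apply/diff_derivable/(sf [::]).
have S := @derive_sym_scalar (fun z => f z i j : R^o) U x v w oU
  (smooth_on_coord i j oU sf) Ux.
exact: etrans (E w v) (etrans S (esym (E v w))).
Qed.

End SymmetricDerivatives.

(** * Tangent vectors *)

Section Charted.
Variables (R : realType) (V : normedModType R) (M : charted V).
Implicit Types (c : chart M) (p : M).

(** The part of [analytic_manifold] on which tangent vectors depend. [Sigma_tilde] satisfies it by
    [differentiable_tilde_atlas], so this section serves both the base and the total space. *)
Definition differentiable_atlas : Prop :=
  [/\ (forall c p q, dom c p -> dom c q -> coord c p = coord c q -> p = q),
      (forall c c', open (overlap c c')) &
      (forall c c' x, overlap c c' x -> differentiable (transition c c') x)].

Hypothesis atlasM : differentiable_atlas.

Lemma overlap_coord c c' p : dom c p -> dom c' p -> overlap c c' (coord c p).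
Proof. by move=> cp c'p; exists p. Qed.

Lemma transitionE c c' p : dom c p -> dom c' p ->
  transition c c' (coord c p) = coord c' p.
Proof.
move=> cp c'p; case: atlasM => inj _ _; rewrite /transition.
case: (@xgetP _ 0 [set coord c' q | q in
    [set q | [/\ dom c q, dom c' q & coord c q = coord c p]]]) => [x -> [q [cq c'q]] e <-|H].
  by rewrite (inj c q p).
by case: (H (coord c' p)); exists p.
Qed.

Lemma differentiable_transition c c' p : dom c p -> dom c' p ->
  differentiable (transition c c') (coord c p).
Proof. by case: atlasM => _ _ d cp c'p; apply/d/overlap_coord. Qed.

(** Chain rule. The composite of two transitions is known to be the direct one only on the overlaps,
    hence the detour through derivatives of maps which agree near the point. *)
Lemma transition_comp c c' c'' p u : dom c p -> dom c' p -> dom c'' p ->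
  'd (transition c' c'') (coord c' p) ('d (transition c c') (coord c p) u) =
  'd (transition c c'') (coord c p) u.
Proof.
move=> cp c'p c''p; case: (atlasM) => inj op df.
have := @diff_comp _ _ _ _ (transition c c') (transition c' c'') (coord c p).
rewrite !transitionE // => /(_ (differentiable_transition cp c'p)
  (differentiable_transition c'p c''p)) /(congr1 (@^~ u)) /= <-.
rewrite -!deriveE; last 2 first.
- exact: differentiable_transition.
- apply: differentiable_comp; first exact: differentiable_transition.
  by rewrite transitionE //; exact: differentiable_transition.
apply: derive_eq_near.
have n1 := open_near (op c c') (overlap_coord cp c'p).
have n2 := open_near (op c c'') (overlap_coord cp c''p).
apply: filterS2 n1 n2 => _ [q [cq c'q] <-] [r [cr c''r] rq] /=.
by move: cr c''r rq => /[swap] c''r /inj => /(_ _ cq) I /I {I} E; subst r; rewrite !transitionE.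
Qed.

Lemma transition_id c p u : dom c p -> 'd (transition c c) (coord c p) u = u.
Proof.
move=> cp; case: (atlasM) => inj op df.
rewrite -deriveE; last exact: differentiable_transition.
rewrite -[RHS](@derive_id _ _ (coord c p) u); apply: derive_eq_near.
by apply: filterS (open_near (op c c) (overlap_coord cp cp)) => _ [q [cq _] <-]; rewrite transitionE.
Qed.

(** The family is pushed forward from [c] by the differentials of the transitions; [transition_comp]
    is its compatibility and [transition_id] gives its value in [c]. *)
Lemma tangent_lift c p u : dom c p -> exists2 v, tangent p v & v c = u.
Proof.
move=> cp; exists (fun c' => if pselect (dom c' p) is left _
    then 'd (transition c c') (coord c p) u else 0).
  split=> [c'|c' c'' c'p c''p]; first by case: pselect.
  by case: pselect => // _; case: pselect => // _; rewrite transition_comp.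
by case: pselect => // _; rewrite transition_id.
Qed.

Lemma tangent_inj c p v w : dom c p -> tangent p v -> tangent p w ->
  v c = w c -> v = w.
Proof.
move=> cp [v0 vt] [w0 wt] e; apply: funext => c'.
have [c'p|c'p] := pselect (dom c' p); last by rewrite v0 ?w0.
by rewrite (vt c c') // (wt c c') // e.
Qed.

Lemma tangent_sum n p (t : 'I_n -> R) (e : 'I_n -> tvec M) :
  (forall i, tangent p (e i)) -> tangent p (\sum_i t i *: e i).
Proof.
have sumE c : (\sum_i t i *: e i) c = \sum_i t i *: e i c by rewrite fct_sumE.
move=> te; split=> [c ncp|c c' cp c'p]; rewrite !sumE.
  by apply: big1 => i _; case: (te i) => /(_ c ncp) ->; rewrite scaler0.
by rewrite linear_sum; apply: eq_bigr => i _; rewrite linearZ; by case: (te i) => _ /(_ c c' cp c'p) ->.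
Qed.

Lemma tangentD p a v w : tangent p v -> tangent p w -> tangent p (a *: v + w).
Proof.
move=> [v0 vt] [w0 wt]; split=> [c ncp|c c' cp c'p].
  by rewrite /= !fctE v0 // w0 // scaler0 addr0.
rewrite -[LHS]/(a *: v c' + w c') -[X in 'd _ _ X]/(a *: v c + w c) linearP.
by rewrite -vt // -wt.
Qed.

End Charted.

Lemma analytic_differentiable_atlas (R : realType) (V : normedModType R)
  (M : charted V) : analytic_manifold M -> differentiable_atlas M.
Proof.
case=> _ inj tr _ _; split=> // [c c'|c c' x]; first by case: (tr c c').
by case: (tr c c') => _ [sm _] /(sm [::]).
Qed.

(** * Alternating forms *)

Section Alternating.
Variables (R : realType) (V : normedModType R).

Definition upd (I : eqType) (v : I -> V) (i : I) (u : V) : I -> V :=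
  fun j => if j == i then u else v j.

Lemma upd_same (I : eqType) (v : I -> V) i u : upd v i u i = u.
Proof. by rewrite /upd eqxx. Qed.

Lemma upd_id (I : eqType) (v : I -> V) i : upd v i (v i) = v.
Proof. by apply: funext => j; rewrite /upd; case: eqP => // ->. Qed.

Lemma updC (I : eqType) (v : I -> V) i j u u' : i != j ->
  upd (upd v i u) j u' = upd (upd v j u') i u.
Proof.
move=> ij; apply: funext => l; rewrite /upd.
by case: (eqVneq l j) => [->|//]; rewrite eq_sym (negPf ij).
Qed.

Definition multilinear k (w : ('I_k -> V) -> R) := forall i (a : R) u u' v,
  w (upd v i (a *: u + u')) = a * w (upd v i u) + w (upd v i u').

Lemma multilinear_altP k (w : ('I_k -> V) -> R) : multilinear_alt w <->
  multilinear w /\ forall v i j, i != j -> v i = v j -> w v = 0.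
Proof. by split=> -[H1 H2]; split=> //; exact: H1. Qed.

Section Multilinear.
Variables (k : nat) (w : ('I_k -> V) -> R).
Hypothesis mw : multilinear w.

Lemma multilinear0 i v : w (upd v i 0) = 0.
Proof.
by have := mw i 1 0 0 v; rewrite scale1r addr0 mul1r => /eqP; rewrite addrC -subr_eq subrr => /eqP.
Qed.

Lemma multilinearD i v u u' : w (upd v i (u + u')) = w (upd v i u) + w (upd v i u').
Proof. by rewrite -[in LHS](scale1r u) mw mul1r. Qed.

Lemma multilinearZ i v a u : w (upd v i (a *: u)) = a * w (upd v i u).
Proof. by rewrite -[in LHS](addr0 (a *: u)) mw multilinear0 addr0. Qed.

Lemma multilinear_sum i v N (y : 'I_N -> R) (E : 'I_N -> V) :
  w (upd v i (\sum_a y a *: E a)) = \sum_a y a * w (upd v i (E a)).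
Proof.
rewrite (big_morph (fun u => w (upd v i u)) (multilinearD i v) (multilinear0 i v)).
by apply: eq_bigr => a _; rewrite multilinearZ.
Qed.

(** Polarization of w(a + b, a + b) = 0. Alternation is assumed for the slots i and j only, so that
    the lemma applies when it is known just for neighbours. *)
Lemma multilinear_swap i j v : i != j ->
  (forall v, v i = v j -> w v = 0) ->
  w (upd (upd v i (v j)) j (v i)) = - w v.
Proof.
move=> ij alt; pose W a b := w (upd (upd v i a) j b).
have W0 a : W a a = 0 by apply: alt; rewrite /upd eqxx (negPf ij) eqxx.
have WD a b c d : W (a + b) (c + d) = W a c + W a d + (W b c + W b d).
  by rewrite /W multilinearD !(updC _ _ _ ij) !multilinearD; ring.
have := WD (v i) (v j) (v i) (v j); rewrite !W0 addr0 add0r.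
have -> : W (v i) (v j) = w v by rewrite /W upd_id upd_id.
by move/eqP; rewrite eq_sym addrC addr_eq0 => /eqP.
Qed.

(* Equality of adjacent arguments is enough: transpositions of neighbours
   bring two equal arguments together. *)
Lemma alternating_of_adjacent :
  (forall v (i j : 'I_k), j = i.+1 :> nat -> v i = v j -> w v = 0) ->
  forall v (i j : 'I_k), i != j -> v i = v j -> w v = 0.
Proof.
move=> adj.
suff H d v (i j : 'I_k) : j = (i + d.+1)%N :> nat -> v i = v j -> w v = 0.
  move=> v i j; have [lt_ij|lt_ji|/val_inj ->] := ltngtP i j; last by rewrite eqxx.
    by move=> _; apply: (H (j - i).-1); lia.
  by move=> _ /esym; apply: (H (i - j).-1); lia.
elim: d v i j => [|d IH] v i j e eqv; first by apply: (adj v i j) => //; lia.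
have ltj : (i + d.+1 < k)%N by have := ltn_ord j; lia.
pose l := Ordinal ltj.
have lj : l != j by rewrite -val_eqE /= e; lia.
have := @multilinear_swap l j v lj (fun v => @adj v l j _).
rewrite (IH _ i l) //=; last first.
  have il : i != l by rewrite -val_eqE /=; lia.
  have ij : i != j by rewrite -val_eqE /= e; lia.
  by rewrite /upd (negPf il) (negPf ij) (negPf lj) eqxx.
by move=> /(_ ltac:(rewrite /= e; lia)) /esym/eqP; rewrite oppr_eq0 => /eqP.
Qed.

End Multilinear.

(** Argument lists are indexed by all of nat, so that a vector moves from slot to slot without
    changing the type of the remaining list [r]. *)
Definition insert_at (j : nat) (b : V) (r : nat -> V) : nat -> V :=
  fun l => if l == j then b else r (unbump j l).

Lemma alternating_insert k (w : ('I_k -> V) -> R) j b r : multilinear_alt w ->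
  (j < k)%N -> w (insert_at j b r) = (-1) ^+ j * w (insert_at 0 b r).
Proof.
move=> /multilinear_altP[mw alt]; elim: j => [|j IH] ltj; first by rewrite mul1r.
have ltj' : (j < k)%N by lia.
rewrite exprS -mulrA -IH // mulN1r.
pose i1 := Ordinal ltj'; pose i2 := Ordinal ltj.
have i12 : i1 != i2 by rewrite -val_eqE /=; lia.
rewrite -(@multilinear_swap _ _ mw i1 i2 _ i12) => [|v]; last exact: alt.
congr w; apply: funext => l; rewrite /upd /insert_at -!val_eqE /= eqxx.
have -> : (j.+1 == j) = false by lia.
case: (eqVneq (l : nat) j.+1) => [//|lj1].
case: (eqVneq (l : nat) j) => [->|lj]; congr r; rewrite /unbump;
  do 2![case: ltnP => ? /=]; lia.
Qed.

(** Common shape of [dext] and [wedge]. With equal neighbouring arguments, every term keeping both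
    of them vanishes, and the two terms which remove one of them have opposite signs. *)
Lemma cobord_multilinear_alt k (G : V -> ('I_k -> V) -> R) :
  (forall a u u' v, G (a *: u + u') v = a * G u v + G u' v) ->
  (forall u, multilinear_alt (G u)) ->
  multilinear_alt (fun v : 'I_k.+1 -> V =>
    \sum_(i < k.+1) (-1) ^+ i * G (v i) (fun j => v (lift i j))).
Proof.
move=> linG altG; apply/multilinear_altP.
have updlift (v : 'I_k.+1 -> V) (i i0 : 'I_k.+1) u : i != i0 -> exists2 j : 'I_k, lift i j = i0 &
    (fun j : 'I_k => upd v i0 u (lift i j)) = upd (fun j => v (lift i j)) j u.
  move=> /unlift_some[j e _]; exists j => //; apply: funext => l.
  by rewrite /upd e (inj_eq (@lift_inj _ i)).
have updlift0 (v : 'I_k.+1 -> V) (i : 'I_k.+1) u :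
    (fun j : 'I_k => upd v i u (lift i j)) = (fun j => v (lift i j)).
  by apply: funext => l; rewrite /upd eq_sym (negPf (neq_lift i l)).
have ml : multilinear (fun v : 'I_k.+1 -> V =>
    \sum_(i < k.+1) (-1) ^+ i * G (v i) (fun j => v (lift i j))).
  move=> i0 a u u' v; rewrite mulr_sumr -big_split; apply: eq_bigr => i _ /=.
  have [->|ii0] := eqVneq i i0.
    by rewrite !updlift0 !upd_same linG; ring.
  have updi u0 : upd v i0 u0 i = v i by rewrite /upd (negPf ii0).
  rewrite !updi; have [j0 e0 ->] := updlift v i i0 (a *: u + u') ii0.
  have [j1 e1 ->] := updlift v i i0 u ii0; have [j2 e2 ->] := updlift v i i0 u' ii0.
  have -> : j2 = j1 by apply: (@lift_inj _ i); rewrite e1.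
  have -> : j0 = j1 by apply: (@lift_inj _ i); rewrite e1.
  by case/multilinear_altP: (altG (v i)) => -> _; ring.
split=> //; apply: (alternating_of_adjacent ml) => v i1 i2 e12 ev.
have i12 : i1 != i2 by rewrite -val_eqE /= e12; lia.
rewrite (bigD1 i1) // (bigD1 i2) /= 1?eq_sym // big1 => [|i /andP[ii1 ii2]].
  rewrite addr0 e12 exprS mulN1r mulNr ev.
  suff -> : (fun j : 'I_k => v (lift i1 j)) = (fun j => v (lift i2 j)) by rewrite subrr.
  apply: funext => j; have [e|ne] := eqVneq (j : nat) i1.
    have -> : lift i1 j = i2 by apply: val_inj; rewrite /= /bump e leqnn e12.
    by have -> : lift i2 j = i1 by apply: val_inj; rewrite /= /bump e e12 ltnn.
  congr v; apply: val_inj; rewrite /= /bump e12; lia.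
have [j1 e1] : exists j : 'I_k, lift i j = i1 by case/unlift_some: ii1 => j -> _; exists j.
have [j2 e2] : exists j : 'I_k, lift i j = i2 by case/unlift_some: ii2 => j -> _; exists j.
case/multilinear_altP: (altG (v i)) => _ alt.
rewrite (alt _ j1 j2) ?mulr0 // ?e1 ?e2 //.
by apply: contraNneq i12 => e; rewrite -e1 -e2 e.
Qed.

(** The term of (i, j) removes argument i and puts a value of [B] at argument [lift i j]. Exchanging
    the two roles gives the same value by symmetry; moving it to the front shows that the two terms
    have opposite signs. *)
Lemma replace_cancel k (w : ('I_k -> V) -> R) (v : 'I_k.+1 -> V)
    (B : 'I_k.+1 -> 'I_k.+1 -> V) : multilinear_alt w ->
  (forall i j, B i j = B j i) ->
  \sum_(i < k.+1) (-1) ^+ i * \sum_(j < k)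
    w (upd (fun l => v (lift i l)) j (B i (lift i j))) = 0.
Proof.
move=> altw symB.
pose T (p : 'I_k.+1 * 'I_k) := (-1) ^+ p.1 *
  w (upd (fun l => v (lift p.1 l)) p.2 (B p.1 (lift p.1 p.2))).
have -> : \sum_(i < k.+1) (-1) ^+ i * \sum_(j < k)
    w (upd (fun l => v (lift i l)) j (B i (lift i j))) = \sum_p T p.
  by rewrite -(pair_bigA _ (fun i j => T (i, j))); apply: eq_bigr => i _; rewrite mulr_sumr.
case: k w v B altw symB @T => [|k] w v B altw symB T.
  by rewrite big1 // => -[i []].
rewrite (bigID (fun p : 'I_k.+2 * 'I_k.+1 => p.1 <= p.2)%N) /=.
(* Role exchange: if j < i then [lift i j] is j, and i has index i - 1 once j is removed; if i <= j
   then i keeps its index, whence [h']. *)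
pose h (p : 'I_k.+2 * 'I_k.+1) : 'I_k.+2 * 'I_k.+1 := (lift p.1 p.2, inord (p.1 : nat).-1).
pose h' (p : 'I_k.+2 * 'I_k.+1) : 'I_k.+2 * 'I_k.+1 := (lift p.1 p.2, inord (p.1 : nat)).
rewrite (reindex_onto h h') /= => [|[i j] /= le_ij]; last first.
  rewrite /h /h' /=; congr pair; apply: val_inj; rewrite /= inordK /bump; have := ltn_ord j; lia.
rewrite [X in X + _](eq_bigl (fun p : 'I_k.+2 * 'I_k.+1 => ~~ (p.1 <= p.2)%N)) => [|[i j]] /=; last first.
  have := ltn_ord i; have := ltn_ord j => ltj lti; rewrite /h /h' /=; apply/andP/idP.
    by case; rewrite inordK ?/bump; lia.
  move=> lt_ji; split; first by rewrite inordK ?/bump; lia.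
  rewrite xpair_eqE; apply/andP; split; apply/eqP/val_inj; rewrite /= ?inordK /bump ?inordK /bump; lia.
rewrite -big_split big1 //= => -[i j] /=; rewrite -ltnNge => lt_ji.
rewrite /T /h /=.
have lti := ltn_ord i; have ltj := ltn_ord j.
have -> : lift (lift i j) (inord i.-1) = i.
  by apply: val_inj; rewrite /= inordK /bump; lia.
rewrite symB; set b := B i _.
(* [r] lists the arguments other than the two exchanged ones; both terms are [w] with [b] inserted
   into [r], at slots j and i - 1. *)
pose vn n : V := if insub n is Some l then v l else 0.
pose r n := vn (bump j (bump i.-1 n)).
have E1 : w (upd (fun l => v (lift i l)) j b) = (-1) ^+ j * w (insert_at 0 b r).
  rewrite -alternating_insert //; congr w.
  apply: funext => l; rewrite /upd /insert_at -val_eqE /=; case: eqP => // /eqP ne.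
  have -> : v (lift i l) = vn (lift i l) by rewrite /vn valK.
  have ltl := ltn_ord l.
  by congr vn; rewrite /= /bump /unbump; case: ltnP => ? /=; lia.
have E2 : w (upd (fun l => v (lift (lift i j) l)) (inord i.-1) b) =
    (-1) ^+ i.-1 * w (insert_at 0 b r).
  rewrite -alternating_insert //; last lia.
  congr w.
  apply: funext => l; rewrite /upd /insert_at -val_eqE /= inordK; last lia.
  case: eqP => // /eqP ne.
  rewrite -[v _](_ : vn (lift (lift i j) l) = _); last by rewrite /vn valK.
  have ltl := ltn_ord l.
  by congr vn; rewrite unbumpK ?inE //= /bump; lia.
rewrite E1 E2.
have -> : bump i j = j by rewrite /bump; lia.
have {2}-> : (i : nat) = i.-1.+1 by lia.
by rewrite exprS mulN1r; ring.
Qed.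

End Alternating.

Section SmoothForms.
Variables (R : realType) (V : normedModType R) (U : set V).
Hypothesis oU : open U.

(** The invariant kept along the differential ideal: smooth coefficients allow [dext], and
    alternation makes the terms of [replace_cancel] cancel. *)
Definition smooth_alt k (w : lform V k) :=
  (forall x, U x -> multilinear_alt (w x)) /\
  forall v, smooth_on U (fun x => w x v : R^o).

Lemma derive_multilinear_alt k (w : lform V k) x u : smooth_alt w -> U x ->
  multilinear_alt (fun v => 'D_u (fun y => w y v : R^o) x).
Proof.
move=> [altw sw] Ux; apply/multilinear_altP; split=> [i a v1 v2 v|v i j ij vij].
  have d v0 : differentiable (fun y => w y v0 : R^o) x by exact: (sw v0 [::]).
  rewrite -[_ * _](@deriveZ _ _ R^o); last exact/diff_derivable/d.
  rewrite -deriveD; [|apply: derivableZ|]; try exact/diff_derivable/d.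
  apply: derive_eq_near; apply: filterS (open_near oU Ux) => y Uy.
  by case/multilinear_altP: (altw y Uy) => ->.
rewrite -(@derive_cst _ V R^o 0 x u).
apply: derive_eq_near; apply: filterS (open_near oU Ux) => y Uy.
by case/multilinear_altP: (altw y Uy) => _ /(_ v i j ij vij) ->.
Qed.

Lemma dext_multilinear_alt k (w : lform V k) x : smooth_alt w -> U x ->
  multilinear_alt (dext w x).
Proof.
move=> sw Ux; apply: (@cobord_multilinear_alt _ _ _
  (fun u v => 'D_u (fun y => w y v : R^o) x)) => [a u u' v|u].
  have d : differentiable (fun y => w y v : R^o) x by exact: (sw.2 v [::]).
  by rewrite !deriveE // linearP.
exact: derive_multilinear_alt.
Qed.

Lemma smooth_alt_dext k (w : lform V k) : smooth_alt w -> smooth_alt (dext w).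
Proof.
move=> sw; split=> [x|v]; first exact: dext_multilinear_alt.
apply: smooth_on_sum => // i _; apply: (smooth_on_scaled oU (k := fun=> _)).
  exact: smooth_on_cst.
exact/smooth_on_derive/sw.2.
Qed.

Lemma covec_linear (a : ('I_1 -> V) -> R) : multilinear_alt a ->
  forall c u u', a (fun=> c *: u + u') = c * a (fun=> u) + a (fun=> u').
Proof.
move=> /multilinear_altP[ma _] c u u'.
have E u0 : upd (fun=> 0) ord0 u0 = (fun _ : 'I_1 => u0).
  by apply: funext => j; rewrite /upd ord1 eqxx.
by have := ma ord0 c u u' (fun=> 0); rewrite !E.
Qed.

Lemma smooth_alt_wedge k (a : lform V 1) (w : lform V k) :
  smooth_alt a -> smooth_alt w -> smooth_alt (wedge a w).
Proof.
move=> [alta sa] [altw sw]; split=> [x Ux|v]; last first.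
  apply: smooth_on_sum => // i _; apply: (smooth_on_scaled oU); last exact: sw.
  apply: (smooth_on_scaled oU (k := fun=> _)); first exact: smooth_on_cst.
  exact: sa.
have -> : wedge a w x = fun v : 'I_k.+1 -> V => \sum_(i < k.+1) (-1) ^+ i *
    (covec a x (v i) * w x (fun j => v (lift i j))).
  by apply: funext => v; apply: eq_bigr => i _; rewrite mulrA.
apply: (@cobord_multilinear_alt _ _ _ (fun u v => covec a x u * w x v)) => [c u u' v|u].
  by rewrite /covec covec_linear ?mulrDl ?mulrA //; exact: alta.
case/multilinear_altP: (altw x Ux) => mw alt.
apply/multilinear_altP; split=> [i c v1 v2 v|v i j ij vij].
  by rewrite mw; ring.
by rewrite (alt v i j) // mulr0.
Qed.

Lemma smooth_alt_fscale k (f : V -> R) (w : lform V k) :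
  smooth_on U (f : V -> R^o) -> smooth_alt w -> smooth_alt (fscale f w).
Proof.
move=> sf [altw sw]; split=> [x Ux|v]; last by apply: (smooth_on_scaled oU); [exact: sf|exact: sw].
case/multilinear_altP: (altw x Ux) => mw alt.
apply/multilinear_altP; rewrite /fscale; split=> [i c v1 v2 v|v i j ij vij].
  by rewrite mw; ring.
by rewrite (alt v i j) // mulr0.
Qed.

Lemma smooth_alt_add k (w w' : lform V k) :
  smooth_alt w -> smooth_alt w' -> smooth_alt (w + w').
Proof.
move=> [altw sw] [altw' sw']; split=> [x Ux|v]; last by apply: (smooth_on_add oU (sw v) (sw' v)).
case/multilinear_altP: (altw x Ux) => mw alt.
case/multilinear_altP: (altw' x Ux) => mw' alt'.
apply/multilinear_altP; split=> [i c v1 v2 v|v i j ij vij].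
  rewrite -![(w + w') x _]/(w x _ + w' x _).
  by rewrite mw mw'; ring.
by rewrite -[LHS]/(w x v + w' x v) (alt v i j) // (alt' v i j) // addr0.
Qed.

Lemma smooth_alt_sub k (w w' : lform V k) :
  smooth_alt w -> smooth_alt w' -> smooth_alt (w - w').
Proof.
move=> sw sw'; apply: smooth_alt_add => //.
have -> : - w' = fscale (fun=> -1) w'.
  by apply: funext => x; apply: funext => v; rewrite /fscale mulN1r.
by apply: smooth_alt_fscale => //; apply: smooth_on_cst.
Qed.

End SmoothForms.

(** * Leibniz' rule for forms with moving arguments *)

Section ProductRule.
Variables (R : realType) (V : normedModType R) (k : nat).
Variables (w : R^o -> ('I_k -> V) -> R^o) (dw : ('I_k -> V) -> R).
Hypothesis mw : \forall t \near (0 : R^o), multilinear (w t).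
Hypothesis dwP : forall v, is_derive (0 : R^o) 1 (fun t => w t v) (dw v).
Hypothesis mdw : multilinear dw.
Variables (N : nat) (c : 'I_k -> V) (y : 'I_k -> 'I_N -> R^o -> R^o) (E : 'I_N -> V).
Variable y' : 'I_k -> 'I_N -> R.
Hypothesis dy : forall j a, is_derive (0 : R^o) 1 (y j a) (y' j a).

Let Y j t := c j + \sum_a y j a t *: E a.
Let Y' j := \sum_a y' j a *: E a.

(** Differentiability of [w] in t is given for fixed arguments only, so each argument is expanded in
    fixed vectors with scalar coefficients; multilinearity then leaves products of real
    functions. *)
Lemma is_derive_multilinear : is_derive (0 : R^o) 1 (fun t => w t (Y ^~ t) : R^o)
  (dw (Y ^~ 0) + \sum_j w 0 (upd (Y ^~ 0) j (Y' j))).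
Proof.
(* The first n arguments move, the others are frozen at an arbitrary [v], so that the induction
   hypothesis can be used with the next argument replaced by its constant part or by any [E a]. *)
pose Yn n (v : 'I_k -> V) t (j : 'I_k) := if (j < n)%N then Y j t else v j.
suff H n v : is_derive (0 : R^o) 1 (fun t => w t (Yn n v t) : R^o)
    (dw (Yn n v 0) + \sum_(j < k | (j < n)%N) w 0 (upd (Yn n v 0) j (Y' j))).
  have := H k (fun=> 0).
  have -> : Yn k (fun=> 0) = fun t j => Y j t.
    by apply: funext => t; apply: funext => j; rewrite /Yn ltn_ord.
  by rewrite (eq_bigl predT) // => j; rewrite ltn_ord.
have m0 : multilinear (w 0) by exact: nbhs_singleton mw.
elim: n v => [|n IH] v.
  have -> : Yn 0%N v = fun=> v by apply: funext => t; apply: funext => j.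
  by rewrite big_pred0 // addr0.
have [le_kn|lt_nk] := leqP k n.
  have e : Yn n.+1 v = Yn n v.
    by apply: funext => t; apply: funext => j; rewrite /Yn !ifT //; have := ltn_ord j; lia.
  rewrite e; have := IH v.
  by rewrite (eq_bigl (fun j : 'I_k => j < n.+1)%N) // => j; have := ltn_ord j; lia.
pose j0 := Ordinal lt_nk.
have YE t : Yn n.+1 v t = upd (Yn n v t) j0 (Y j0 t).
  apply: funext => j; rewrite /Yn /upd -val_eqE /= ltnS leq_eqVlt.
  by case: eqVneq => //= e; congr Y; apply: val_inj.
have Yupd t u : upd (Yn n v t) j0 u = Yn n (upd v j0 u) t.
  apply: funext => j; rewrite /Yn /upd -val_eqE /=.
  by case: eqVneq => // ->; rewrite ltnn.
have expand (f : ('I_k -> V) -> R) t : multilinear f ->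
    f (Yn n.+1 v t) = f (Yn n (upd v j0 (c j0)) t) +
      \sum_a y j0 a t * f (Yn n (upd v j0 (E a)) t).
  move=> mf; rewrite YE (multilinearD mf) Yupd (multilinear_sum mf).
  by under eq_bigr do rewrite Yupd.
have near_eq : \forall t \near (0 : R^o), w t (Yn n (upd v j0 (c j0)) t) +
      \sum_a y j0 a t * w t (Yn n (upd v j0 (E a)) t) = w t (Yn n.+1 v t).
  by apply: filterS mw => t mt; rewrite expand.
apply: near_eq_is_derive near_eq _.
pose F u : R^o -> R^o := fun t => w t (Yn n (upd v j0 u) t).
have -> : (fun t => w t (Yn n (upd v j0 (c j0)) t) +
    \sum_a y j0 a t * w t (Yn n (upd v j0 (E a)) t)) =
    F (c j0) + \sum_a (y j0 a * F (E a)).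
  by apply: funext => t; rewrite -[RHS]/(F (c j0) t + (\sum_a (y j0 a * F (E a))) t) fct_sumE.
have D1 : is_derive (0 : R^o) 1 (F (c j0)) _ := IH (upd v j0 (c j0)).
have D2 a : is_derive (0 : R^o) 1 (y j0 a * F (E a)) _ := is_deriveM (dy j0 a) (IH (upd v j0 (E a))).
have D := is_deriveD D1 (is_derive_sum D2).
apply: is_derive_eq D _; rewrite /F.
rewrite (expand _ _ mdw) -!addrA; congr (_ + _).
rewrite [in RHS](bigD1 j0) ?ltnS ?leqnn //=.
have -> : upd (Yn n.+1 v 0) j0 (Y' j0) = upd (Yn n v 0) j0 (Y' j0).
  by rewrite YE; apply: funext => j; rewrite /upd; case: eqP.
rewrite (multilinear_sum m0).
have -> : \sum_(i < k | (i < n.+1)%N && (i != j0)) w 0 (upd (Yn n.+1 v 0) i (Y' i)) =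
   \sum_(i < k | (i < n)%N) (w 0 (upd (Yn n (upd v j0 (c j0)) 0) i (Y' i)) +
      \sum_a y j0 a 0 * w 0 (upd (Yn n (upd v j0 (E a)) 0) i (Y' i))).
  apply: eq_big => [j|j /andP[_ jj0]]; first by rewrite -val_eqE /=; lia.
  rewrite YE updC 1?eq_sym // (multilinearD m0) (multilinear_sum m0).
  rewrite updC // Yupd; congr (_ + _); apply: eq_bigr => a _.
  by rewrite updC // Yupd.
rewrite [X in _ = _ + (_ + X)]big_split /=.
rewrite [X in _ = _ + (_ + (_ + X))]exchange_big /=.
rewrite [X in _ + X](eq_bigr (fun a => y j0 a 0 * dw (Yn n (upd v j0 (E a)) 0) +
    \sum_(i < k | (i < n)%N) y j0 a 0 * w 0 (upd (Yn n (upd v j0 (E a)) 0) i (Y' i)) +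
    y' j0 a * w 0 (upd (Yn n v 0) j0 (E a)))) => [|a _].
  by rewrite !big_split /=; ring.
by rewrite -mulr_sumr Yupd /GRing.scale /=; ring.
Qed.

End ProductRule.

Section Vanishing.
Variables (R : realType) (V : normedModType R) (U : set V).
Hypothesis oU : open U.

(* A form which vanishes along the planes spanned by the vectors Y (here along
   the line through x in direction v i) has a vanishing exterior derivative as
   soon as the first derivatives B of the spanning vectors are symmetric:
   the terms of Leibniz' rule containing B cancel in pairs. *)
Lemma dext_eq0 k (w : lform V k) x (v : 'I_k.+1 -> V) N (E : 'I_N -> V)
    (y : 'I_k.+1 -> 'I_k.+1 -> 'I_N -> R^o -> R^o)
    (y' : 'I_k.+1 -> 'I_k.+1 -> 'I_N -> R) (c : 'I_k.+1 -> 'I_k.+1 -> V) :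
  smooth_alt U w -> U x ->
  (forall i j a, is_derive (0 : R^o) 1 (y i j a) (y' i j a)) ->
  (forall i j, c i j + \sum_a y i j a 0 *: E a = v j) ->
  (forall i j a, y' i j a = y' j i a) ->
  (forall i, \forall t \near (0 : R^o),
     w (x + t *: v i)
       (fun j => c i (lift i j) + \sum_a y i (lift i j) a t *: E a) = 0) ->
  dext w x v = 0.
Proof.
move=> sw Ux dy c0 sym w0.
pose B i j := \sum_a y' i j a *: E a.
suff D (i : 'I_k.+1) : 'D_(v i) (fun z => w z (fun j => v (lift i j)) : R^o) x =
    - \sum_j w x (upd (fun l : 'I_k => v (lift i l)) j (B i (lift i j))).
  rewrite /dext (eq_bigr (fun i : 'I_k.+1 => - ((-1) ^+ i *
    \sum_j w x (upd (fun l : 'I_k => v (lift i l)) j (B i (lift i j)))))).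
    rewrite sumrN (replace_cancel (w := w x)) ?oppr0 //; first exact: sw.1.
    by move=> i j; apply: eq_bigr => a _; rewrite sym.
  by move=> i _; rewrite D mulrN.
have dline : differentiable (fun t : R^o => x + t *: v i) 0.
  by apply: differentiableD => //; exact: differentiableZl.
have near_U : \forall t \near (0 : R^o), U (x + t *: v i).
  apply: (differentiable_continuous dline); apply: open_near => //.
  by rewrite scale0r addr0.
have altw : multilinear (w x) by case/multilinear_altP: (sw.1 x Ux).
pose f t := w (x + t *: v i).
have dwP u : is_derive (0 : R^o) 1 (fun t => f t u : R^o)
    ('D_(v i) (fun z => w z u : R^o) x).
  have := @is_derive_along R V R^o (fun z => w z u) x (v i) 0.
  rewrite scale0r addr0; apply; exact/diff_derivable/(sw.2 u [::]).
have [mdw _] : multilinear (fun u => 'D_(v i) (fun z => w z u : R^o) x) /\ True.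
  by case/multilinear_altP: (derive_multilinear_alt oU (v i) sw Ux).
have mf : \forall t \near (0 : R^o), multilinear (f t).
  by apply: filterS near_U => t Ut; case/multilinear_altP: (sw.1 _ Ut).
have := @is_derive_multilinear R V k f _ mf dwP mdw N (fun j : 'I_k => c i (lift i j))
  (fun j : 'I_k => y i (lift i j)) E (fun j : 'I_k => y' i (lift i j)) (fun j : 'I_k => dy i (lift i j)).
have -> : (fun j : 'I_k => c i (lift i j) + \sum_a y i (lift i j) a 0 *: E a) =
    (fun j : 'I_k => v (lift i j)) by apply: funext => j; rewrite c0.
have -> : f 0 = w x by rewrite /f scale0r addr0.
move=> D; have := near_eq_is_derive (w0 i) D.
by move=> [_]; rewrite derive_cst => /esym/eqP; rewrite addr_eq0 => /eqP.
Qed.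

End Vanishing.

(** * Integral elements *)

Section Jets.
Variable R : realType.
Local Notation TM := (tilde_model R).

Definition i30 : 'I_3 := @Ordinal 3 0 isT.
Definition i31 : 'I_3 := @Ordinal 3 1 isT.
Definition i32 : 'I_3 := @Ordinal 3 2 isT.

Lemma ord3_ind (P : 'I_3 -> Prop) : P i30 -> P i31 -> P i32 -> forall i, P i.
Proof.
move=> P0 P1 P2 [[|[|[|//]]] lti].
- by rewrite (_ : Ordinal _ = i30) //; apply: val_inj.
- by rewrite (_ : Ordinal _ = i31) //; apply: val_inj.
- by rewrite (_ : Ordinal _ = i32) //; apply: val_inj.
Qed.

Lemma sum3 (W : zmodType) (F : 'I_3 -> W) : \sum_i F i = F i30 + F i31 + F i32.
Proof.
rewrite !big_ord_recr big_ord0 /= add0r.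
by congr (F _ + F _ + F _); apply: val_inj.
Qed.

Definition i6 (n : nat) (h : (n < 6)%N) : 'I_6 := @Ordinal 6 n h.

Lemma ord6_ind (P : 'I_6 -> Prop) : P (@i6 0 isT) -> P (@i6 1 isT) -> P (@i6 2 isT) ->
  P (@i6 3 isT) -> P (@i6 4 isT) -> P (@i6 5 isT) -> forall i, P i.
Proof.
have E n (h : (n < 6)%N) : P (@i6 n h) -> forall h', P (@Ordinal 6 n h').
  by move=> Pn h'; rewrite (bool_irrelevance h' h).
by move=> P0 P1 P2 P3 P4 P5 [[|[|[|[|[|[|//]]]]]] lti];
  [exact: (@E 0%N isT)|exact: (@E 1%N isT)|exact: (@E 2%N isT)|exact: (@E 3%N isT)|exact: (@E 4%N isT)|exact: (@E 5%N isT)].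
Qed.

(* [coframe_at] gives the values of the eta^i, and [dcoframe] those of the
   d eta^i, as eta^i = f^i_j dx^j. *)
Definition coframe_at (z u : TM) : 'rV[R]_3 := u.1.1 *m z.1.2^T.
Definition dcoframe (u v : TM) : 'rV[R]_3 := v.1.1 *m u.1.2^T - u.1.1 *m v.1.2^T.

Definition pr (p : 'rV[R]_24) (n : nat) : R := p 0 (inord n).

Lemma pr_row (F : nat -> R) n : (n < 24)%N -> pr (\row_(k < 24) F k) n = F n.
Proof. by move=> ltn; rewrite /pr mxE inordK. Qed.

(* The coordinates with numbers 0..17 on the fibre are the symmetric parts
   P^i_(km) of the connection coefficients. *)
Definition sym_index (i k m : 'I_3) : nat := nth 0%N (nth [::] (nth [::] [::
  [:: [:: 0; 1; 2]; [:: 1; 3; 4]; [:: 2; 4; 5]];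
  [:: [:: 6; 7; 8]; [:: 7; 9; 10]; [:: 8; 10; 11]];
  [:: [:: 12; 13; 14]; [:: 13; 15; 16]; [:: 14; 16; 17]]]%N i) k) m.

Definition sym_part (p : 'rV[R]_24) (e : 'rV[R]_3) : 'M[R]_3 :=
  \matrix_(i, k) \sum_m pr p (sym_index i k m) * e 0 m.

Definition y0 (y : 'rV[R]_6) : R := y 0 (@i6 0 isT).
Definition y1 (y : 'rV[R]_6) : R := y 0 (@i6 1 isT).
Definition y2 (y : 'rV[R]_6) : R := y 0 (@i6 2 isT).
Definition y3 (y : 'rV[R]_6) : R := y 0 (@i6 3 isT).
Definition y4 (y : 'rV[R]_6) : R := y 0 (@i6 4 isT).
Definition y5 (y : 'rV[R]_6) : R := y 0 (@i6 5 isT).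

Definition mx3 (L : seq (seq R)) : 'M[R]_3 := \matrix_(i, k) nth 0 (nth [::] L i) k.
Definition rv6 (L : seq R) : 'rV[R]_6 := \row_k nth 0 L k.

(** A particular solution: the wedge of row i with eta is the value of d eta^(i+1) imposed by the
    corresponding Theta. What may be added is symmetric in its lower indices and drops out of that
    wedge. *)
Definition torsion_part (y : 'rV[R]_6) (e : 'rV[R]_3) : 'M[R]_3 := mx3
  [:: [:: 0; 0; e 0 i31 - y0 y * e 0 i30];
      [:: 0; 0; - e 0 i30];
      [:: 0; y1 y * e 0 i30; 0]].

(** The value of df f^-1 on the vector of an integral element whose eta-components are e. *)
Definition connection (y : 'rV[R]_6) (p : 'rV[R]_24) (e : 'rV[R]_3) : 'M[R]_3 :=
  sym_part p e + torsion_part y e.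

(* The differentials of (I, K, I_1, I_3, K_1, K_2) on an integral element, in
   the basis eta; the free second derivatives are the coordinates 18..23. *)
Definition scalar_part (y : 'rV[R]_6) (p : 'rV[R]_24) (e : 'rV[R]_3) : 'rV[R]_6 :=
  rv6 [:: y2 y * e 0 i30 + y3 y * e 0 i32;
          y4 y * e 0 i30 + y5 y * e 0 i31 - y1 y * y0 y * e 0 i32;
          pr p 18 * e 0 i30 + y3 y * y1 y * e 0 i31 + pr p 19 * e 0 i32;
          (pr p 19 + y0 y * y2 y) * e 0 i30 - y2 y * e 0 i31 + pr p 20 * e 0 i32;
          pr p 21 * e 0 i30 + pr p 22 * e 0 i31 +
            (- (2 * y0 y * y4 y) - y5 y - y1 y * y2 y) * e 0 i32;
          (pr p 22 + y1 y * y1 y * y0 y) * e 0 i30 + pr p 23 * e 0 i31 +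
            (y4 y - y0 y * y5 y) * e 0 i32].

(* The integral elements at z are the graphs of the maps [jet z p], where
   r stands for (dx^1, dx^2, dx^3). *)
Definition jet (z : TM) (p : 'rV[R]_24) (r : 'rV[R]_3) : TM :=
  (r, connection z.2 p (r *m z.1.2^T) *m z.1.2, scalar_part z.2 p (r *m z.1.2^T)).

(* theta^1, theta^2 vanish on u, and the Theta^i, d theta^1, d theta^2 on
   (u, v). *)
Definition integral_pair (z u v : TM) : Prop :=
  let e := coframe_at z u in let e' := coframe_at z v in
  let d := dcoframe u v in
  let w i j := e 0 i * e' 0 j - e 0 j * e' 0 i in
  let I := y0 z.2 in let K := y1 z.2 in
  [/\ [/\ d 0 i30 + I * w i30 i32 - w i31 i32 = 0, d 0 i31 + w i30 i32 = 0 &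
      d 0 i32 - K * w i30 i31 = 0],
   y0 u.2 = y2 z.2 * e 0 i30 + y3 z.2 * e 0 i32,
   y1 u.2 = y4 z.2 * e 0 i30 + y5 z.2 * e 0 i31 - K * I * e 0 i32,
   y2 u.2 * e' 0 i30 - y2 v.2 * e 0 i30 + y2 z.2 * d 0 i30 +
     (y3 u.2 * e' 0 i32 - y3 v.2 * e 0 i32) + y3 z.2 * d 0 i32 = 0 &
   y4 u.2 * e' 0 i30 - y4 v.2 * e 0 i30 + y4 z.2 * d 0 i30 +
     (y5 u.2 * e' 0 i31 - y5 v.2 * e 0 i31) + y5 z.2 * d 0 i31 -
     ((y1 u.2 * I + K * y0 u.2) * e' 0 i32 - (y1 v.2 * I + K * y0 v.2) * e 0 i32)
     - K * I * d 0 i32 = 0].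

Lemma coframe_jet z p r : coframe_at z (jet z p r) = r *m z.1.2^T.
Proof. by []. Qed.

Lemma dcoframe_jet z p r r' : dcoframe (jet z p r) (jet z p r') =
  r' *m z.1.2^T *m (connection z.2 p (r *m z.1.2^T))^T -
  r *m z.1.2^T *m (connection z.2 p (r' *m z.1.2^T))^T.
Proof. by rewrite /dcoframe /= !trmx_mul !mulmxA. Qed.

Lemma jet_integral z p r r' : integral_pair z (jet z p r) (jet z p r').
Proof.
rewrite /integral_pair !coframe_jet dcoframe_jet /jet /=.
move: (r *m _) (r' *m _) => e e' /=.
rewrite /y0 /y1 /y2 /y3 /y4 /y5 /scalar_part /rv6 !mxE /=.
rewrite !sum3 !mxE !sum3 /= /y0 /y1 /y2 /y3 /y4 /y5.
rewrite /sym_index /=; split; [split|..]; ring.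
Qed.

Lemma mulmx_injl (f A B : 'M[R]_3) : f \in unitmx -> A *m f = B *m f -> A = B.
Proof. by move=> uf /(congr1 (mulmx^~ (invmx f))); rewrite !mulmxK. Qed.

(** Reads the parameters off the values on the basis dual to eta, [C m] being df f^-1 on the m-th
    vector. The coordinate P^i_(km) is taken at a direction m >= k, where [torsion_part] contributes
    nothing, and the second derivatives at places where [scalar_part] is a single coordinate. *)
Definition jet_param (C : 'I_3 -> 'M[R]_3) (b : 'I_3 -> TM) : 'rV[R]_24 :=
  \row_(n < 24) nth 0 [:: C i30 i30 i30; C i31 i30 i30; C i32 i30 i30;
    C i31 i30 i31; C i32 i30 i31; C i32 i30 i32;
    C i30 i31 i30; C i31 i31 i30; C i32 i31 i30;
    C i31 i31 i31; C i32 i31 i31; C i32 i31 i32;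
    C i30 i32 i30; C i31 i32 i30; C i32 i32 i30;
    C i31 i32 i31; C i32 i32 i31; C i32 i32 i32;
    y2 (b i30).2; y2 (b i32).2; y3 (b i32).2;
    y4 (b i30).2; y4 (b i31).2; y5 (b i31).2] n.

(** Converse of [jet_integral]. On the dual basis the equations are linear in the entries of [C m]
    and in the scalar components; they express the entries not read by [jet_param] through those
    which are. *)
Lemma integral_jet z (b : 'I_3 -> TM) : z.1.2 \in unitmx ->
  (forall m, coframe_at z (b m) = delta_mx 0 m) ->
  (forall m n, integral_pair z (b m) (b n)) ->
  exists p, forall m, b m = jet z p (b m).1.1.
Proof.
move=> uf bE bI.
have [C CE] : exists C : 'I_3 -> 'M[R]_3, C = fun m => (b m).1.2 *m invmx z.1.2 by eexists.
have bC m : (b m).1.2 = C m *m z.1.2 by rewrite CE mulmxKV.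
have dE m n i : dcoframe (b m) (b n) 0 i = C m i n - C n i m.
  rewrite /dcoframe !bC !trmx_mul !mulmxA.
  rewrite -[(b n).1.1 *m _]/(coframe_at z (b n)) -[(b m).1.1 *m _]/(coframe_at z (b m)).
  by rewrite !bE -!rowE !mxE.
have F m n := bI m n.
rewrite /integral_pair in F.
have {F}F01 := F i30 i31; have F02 := bI i30 i32; have F12 := bI i31 i32.
rewrite /integral_pair !bE !dE !mxE /= in F01.
rewrite /integral_pair !bE !dE !mxE /= in F02.
rewrite /integral_pair !bE !dE !mxE /= in F12.
(* [integral_pair] tests the theta on its first vector only, so the pair is reversed to get them on
   [b i32]. *)
have F20 := bI i32 i30.
rewrite /integral_pair !bE !dE !mxE /= in F20.
case: F01 => -[f1 f2 f3] f4 f5 f6 f7.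
case: F02 => -[g1 g2 g3] _ _ g6 g7.
case: F12 => -[h1 h2 h3] h4 h5 h6 h7.
case: F20 => _ k4 k5 _ _.
have {}f1 : C i30 i30 i31 = C i31 i30 i30 by clear -f1; lra.
have {}f2 : C i30 i31 i31 = C i31 i31 i30 by clear -f2; lra.
have {}f3 : C i30 i32 i31 = C i31 i32 i30 + y1 z.2 by clear -f3; lra.
have {}g1 : C i30 i30 i32 = C i32 i30 i30 - y0 z.2 by clear -g1; lra.
have {}g2 : C i30 i31 i32 = C i32 i31 i30 - 1 by clear -g2; lra.
have {}g3 : C i30 i32 i32 = C i32 i32 i30 by clear -g3; lra.
have {}h1 : C i31 i30 i32 = C i32 i30 i31 + 1 by clear -h1; lra.
have {}h2 : C i31 i31 i32 = C i32 i31 i31 by clear -h2; lra.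
have {}h3 : C i31 i32 i32 = C i32 i32 i31 by clear -h3; lra.
rewrite f1 f2 f3 f4 in f6 f7; rewrite f5 in f7.
rewrite g1 g2 g3 f4 k4 in g6 g7; rewrite f5 k5 in g7.
rewrite h1 h2 h3 h4 k4 in h6 h7; rewrite h5 k5 in h7.
have bE3 m : b m = ((b m).1.1, C m *m z.1.2, (b m).2).
  by rewrite -bC; case: (b m) => [[]].
have xE m : (b m).1.1 *m z.1.2^T = delta_mx 0 m by rewrite -bE.
rewrite /y0 /y1 /y2 /y3 /y4 /y5 in f1 f2 f3 f4 f5 f6 f7 g1 g2 g3 g6 g7 h1 h2 h3 h4 h5 h6 h7 k4 k5.
exists (jet_param C b) => m; rewrite {1}bE3 /jet xE; congr (_, _, _).
  congr (_ *m _); clear f4 f5 f6 f7 g6 g7 h4 h5 h6 h7 k4 k5.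
  apply/matrixP => i k; move: m i k.
  do 3![apply: ord3_ind]; rewrite !mxE sum3 !mxE /= /sym_index /= !pr_row //=;
    rewrite /y0 /y1 ?(f1, f2, f3, g1, g2, g3, h1, h2, h3); ring.
clear f1 f2 f3 g1 g2 g3 h1 h2 h3.
apply/rowP => j; move: m j; apply: ord3_ind; apply: ord6_ind;
  rewrite /scalar_part !mxE /= ?pr_row //= /y0 /y1 /y2 /y3 /y4 /y5 ?(f4, f5, h4, h5, k4, k5).
all: first [ring | clear -f6; lra | clear -f7; lra | clear -g6; lra | clear -g7; lra
  | clear -h6; lra | clear -h7; lra].
Qed.

End Jets.

(** * Derivatives of integral elements and their symmetry *)

Section JetDerivative.
Variable R : realType.
Local Notation TM := (tilde_model R).

Definition dtorsion (y dy : 'rV[R]_6) (e : 'rV[R]_3) : 'M[R]_3 := mx3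
  [:: [:: 0; 0; - (y0 dy * e 0 i30)]; [:: 0; 0; 0]; [:: 0; y1 dy * e 0 i30; 0]].

(** Derivative of [scalar_part] with e fixed; at dy = 0 it is the symbol of the second derivatives
    of I and K. *)
Definition dscalar (y dy : 'rV[R]_6) (q : 'rV[R]_24) (e : 'rV[R]_3) : 'rV[R]_6 :=
  rv6 [:: y2 dy * e 0 i30 + y3 dy * e 0 i32;
    y4 dy * e 0 i30 + y5 dy * e 0 i31 - (y1 dy * y0 y + y1 y * y0 dy) * e 0 i32;
    pr q 18 * e 0 i30 + (y3 dy * y1 y + y3 y * y1 dy) * e 0 i31 + pr q 19 * e 0 i32;
    (pr q 19 + y0 dy * y2 y + y0 y * y2 dy) * e 0 i30 - y2 dy * e 0 i31 +
      pr q 20 * e 0 i32;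
    pr q 21 * e 0 i30 + pr q 22 * e 0 i31 +
      (- (2 * (y0 dy * y4 y + y0 y * y4 dy)) - y5 dy - (y1 dy * y2 y + y1 y * y2 dy))
        * e 0 i32;
    (pr q 22 + 2 * y1 y * y1 dy * y0 y + y1 y * y1 y * y0 dy) * e 0 i30 +
      pr q 23 * e 0 i31 + (y4 dy - (y0 dy * y5 y + y0 y * y5 dy)) * e 0 i32].

(* The derivative of [jet z p r] when (z, p) moves in the direction (u, q). *)
Definition djet (z : TM) (p : 'rV[R]_24) (u : TM) (q : 'rV[R]_24) (r : 'rV[R]_3) : TM :=
  let e := r *m z.1.2^T in let de := r *m u.1.2^T in
  (0, (sym_part q e + dtorsion z.2 u.2 e + connection z.2 p de) *m z.1.2 +
      connection z.2 p e *m u.1.2,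
   dscalar z.2 u.2 q e + scalar_part z.2 p de).

Lemma drv_cst (c : R) : is_derive (0 : R^o) 1 (fun _ : R^o => c : R^o) 0.
Proof. exact: is_derive_cst. Qed.

Lemma drv_add (f g : R^o -> R^o) (a b : R) : is_derive (0 : R^o) 1 f a ->
  is_derive (0 : R^o) 1 g b -> is_derive (0 : R^o) 1 (fun t => f t + g t : R^o) (a + b).
Proof. by move=> *; apply: is_deriveD. Qed.

Lemma drv_opp (f : R^o -> R^o) (a : R) : is_derive (0 : R^o) 1 f a ->
  is_derive (0 : R^o) 1 (fun t => - f t : R^o) (- a).
Proof. by move=> *; apply: is_deriveN. Qed.

Lemma drv_mul (f g : R^o -> R^o) (a b : R) : is_derive (0 : R^o) 1 f a ->
  is_derive (0 : R^o) 1 g b ->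
  is_derive (0 : R^o) 1 (fun t => f t * g t : R^o) (f 0 * b + g 0 * a).
Proof. by move=> *; apply: is_deriveM. Qed.

Lemma drv_id : is_derive (0 : R^o) 1 (fun t => t : R^o) 1.
Proof. exact: is_derive_id. Qed.

Ltac derive_rec := lazymatch goal with
  | |- is_derive _ _ (fun _ => ?c) _ => exact (drv_cst c)
  | |- is_derive _ _ (fun t => t) _ => exact drv_id
  | |- is_derive _ _ (fun t => (@?f t + @?g t)%R) _ =>
      notypeclasses refine (@drv_add f g _ _ _ _); derive_rec
  | |- is_derive _ _ (fun t => (@?f t * @?g t)%R) _ =>
      notypeclasses refine (@drv_mul f g _ _ _ _); derive_rec
  | |- is_derive _ _ (fun t => (- @?f t)%R) _ => notypeclasses refine (@drv_opp f _ _); derive_rec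
  end.

Ltac derive_poly := notypeclasses refine (is_derive_eq _ _); [derive_rec|].

Lemma is_derive_connection y y' (p q : 'rV[R]_24) e e' i k :
  is_derive (0 : R^o) 1
    (fun t => connection (y + t *: y') (p + t *: q) (e + t *: e') i k : R^o)
    ((sym_part q e + dtorsion y y' e + connection y p e') i k).
Proof.
pose F (t : R) (i k : 'I_3) := nth 0 (nth [::]
  [:: [:: 0; 0; (e 0 i31 + t * e' 0 i31) - (y0 y + t * y0 y') * (e 0 i30 + t * e' 0 i30)];
      [:: 0; 0; - (e 0 i30 + t * e' 0 i30)];
      [:: 0; (y1 y + t * y1 y') * (e 0 i30 + t * e' 0 i30); 0]] i) k.
have -> : (fun t => connection (y + t *: y') (p + t *: q) (e + t *: e') i k : R^o) =
  fun t => (pr p (sym_index i k i30) + t * pr q (sym_index i k i30)) *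
     (e 0 i30 + t * e' 0 i30) +
   (pr p (sym_index i k i31) + t * pr q (sym_index i k i31)) *
     (e 0 i31 + t * e' 0 i31) +
   (pr p (sym_index i k i32) + t * pr q (sym_index i k i32)) *
     (e 0 i32 + t * e' 0 i32) + F t i k.
  by apply: funext => t; rewrite !mxE sum3 !mxE /pr !mxE /y0 /y1 !mxE.
rewrite /F {F} !mxE !sum3.
by move: i k; do 2!apply: ord3_ind; rewrite /=; derive_poly; rewrite /sym_index /=; ring.
Qed.

Lemma is_derive_scalar y y' (p q : 'rV[R]_24) e e' k :
  is_derive (0 : R^o) 1
    (fun t => scalar_part (y + t *: y') (p + t *: q) (e + t *: e') 0 k : R^o)
    ((dscalar y y' q e + scalar_part y p e') 0 k).
Proof.
pose l (a b : R) t := a + t * b.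
have yE (t : R) : [/\ y0 (y + t *: y') = l (y0 y) (y0 y') t,
    y1 (y + t *: y') = l (y1 y) (y1 y') t, y2 (y + t *: y') = l (y2 y) (y2 y') t,
    y3 (y + t *: y') = l (y3 y) (y3 y') t & y4 (y + t *: y') = l (y4 y) (y4 y') t /\
    y5 (y + t *: y') = l (y5 y) (y5 y') t].
  by rewrite /y0 /y1 /y2 /y3 /y4 /y5 !mxE.
have pE n t : pr (p + t *: q) n = l (pr p n) (pr q n) t by rewrite /pr !mxE.
have eE' i t : (e + t *: e') 0 i = l (e 0 i) (e' 0 i) t by rewrite !mxE.
have SE : (fun t => scalar_part (y + t *: y') (p + t *: q) (e + t *: e') 0 k : R^o) =
   fun t => nth 0 [:: l (y2 y) (y2 y') t * l (e 0 i30) (e' 0 i30) t +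
       l (y3 y) (y3 y') t * l (e 0 i32) (e' 0 i32) t;
     l (y4 y) (y4 y') t * l (e 0 i30) (e' 0 i30) t +
       l (y5 y) (y5 y') t * l (e 0 i31) (e' 0 i31) t -
       l (y1 y) (y1 y') t * l (y0 y) (y0 y') t * l (e 0 i32) (e' 0 i32) t;
     l (pr p 18) (pr q 18) t * l (e 0 i30) (e' 0 i30) t +
       l (y3 y) (y3 y') t * l (y1 y) (y1 y') t * l (e 0 i31) (e' 0 i31) t +
       l (pr p 19) (pr q 19) t * l (e 0 i32) (e' 0 i32) t;
     (l (pr p 19) (pr q 19) t + l (y0 y) (y0 y') t * l (y2 y) (y2 y') t) *
         l (e 0 i30) (e' 0 i30) t -
       l (y2 y) (y2 y') t * l (e 0 i31) (e' 0 i31) t +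
       l (pr p 20) (pr q 20) t * l (e 0 i32) (e' 0 i32) t;
     l (pr p 21) (pr q 21) t * l (e 0 i30) (e' 0 i30) t +
       l (pr p 22) (pr q 22) t * l (e 0 i31) (e' 0 i31) t +
       (- (2 * l (y0 y) (y0 y') t * l (y4 y) (y4 y') t) - l (y5 y) (y5 y') t -
         l (y1 y) (y1 y') t * l (y2 y) (y2 y') t) * l (e 0 i32) (e' 0 i32) t;
     (l (pr p 22) (pr q 22) t + l (y1 y) (y1 y') t * l (y1 y) (y1 y') t *
          l (y0 y) (y0 y') t) * l (e 0 i30) (e' 0 i30) t +
       l (pr p 23) (pr q 23) t * l (e 0 i31) (e' 0 i31) t +
       (l (y4 y) (y4 y') t - l (y0 y) (y0 y') t * l (y5 y) (y5 y') t) *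
         l (e 0 i32) (e' 0 i32) t] k.
  apply: funext => t; rewrite mxE.
  by have [-> -> -> -> [-> ->]] := yE t; rewrite !pE !eE'.
rewrite SE {SE yE pE eE'} /l {l}; move: k.
by apply: ord6_ind; rewrite !mxE /=; derive_poly; rewrite /=; ring.
Qed.

Lemma jet_coframe (z u : TM) t (r : 'rV[R]_3) :
  r *m ((z + t *: u).1.2)^T = r *m z.1.2^T + t *: (r *m u.1.2^T).
Proof.
rewrite -[(z + _).1.2]/(z.1.2 + t *: u.1.2) linearD linearZ /= mulmxDr.
by rewrite -scalemxAr.
Qed.

Lemma is_derive_jet_frame z p u q r i j :
  is_derive (0 : R^o) 1 (fun t => (jet (z + t *: u) (p + t *: q) r).1.2 i j : R^o)
    ((djet z p u q r).1.2 i j).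
Proof.
pose e := r *m z.1.2^T; pose e' := r *m u.1.2^T.
pose C t := connection (z.2 + t *: u.2) (p + t *: q) (e + t *: e').
have -> : (fun t => (jet (z + t *: u) (p + t *: q) r).1.2 i j : R^o) = fun t =>
    C t i i30 * (z.1.2 i30 j + t * u.1.2 i30 j) +
    C t i i31 * (z.1.2 i31 j + t * u.1.2 i31 j) +
    C t i i32 * (z.1.2 i32 j + t * u.1.2 i32 j).
  by apply: funext => t; rewrite /jet /= jet_coframe mxE sum3 !mxE.
have dC k := is_derive_connection z.2 u.2 p q e e' i k.
have df k : is_derive (0 : R^o) 1 (fun t : R^o => z.1.2 k j + t * u.1.2 k j : R^o)
    (u.1.2 k j).
  by derive_poly; rewrite /= mulr0 mulr1 !add0r.
apply: is_derive_eq (drv_add (drv_add (drv_mul (dC i30) (df i30))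
  (drv_mul (dC i31) (df i31))) (drv_mul (dC i32) (df i32))) _.
rewrite /djet /= -/e -/e' !scale0r !mul0r !addr0.
move: (_ + connection _ _ e') (connection _ _ _) => D X.
by rewrite [RHS]mxE !mxE !sum3; ring.
Qed.

Lemma is_derive_jet_scalar z p u q r k :
  is_derive (0 : R^o) 1 (fun t => (jet (z + t *: u) (p + t *: q) r).2 0 k : R^o)
    ((djet z p u q r).2 0 k).
Proof.
have -> : (fun t => (jet (z + t *: u) (p + t *: q) r).2 0 k : R^o) =
   fun t => scalar_part (z.2 + t *: u.2) (p + t *: q)
     (r *m z.1.2^T + t *: (r *m u.1.2^T)) 0 k.
  by apply: funext => t; rewrite /jet /= jet_coframe.
exact: is_derive_scalar.
Qed.

Lemma connectionP y (p : 'rV[R]_24) a e e' :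
  connection y p (a *: e + e') = a *: connection y p e + connection y p e'.
Proof.
apply/matrixP => i k; rewrite !mxE !sum3 !mxE.
elim/ord3_ind: i; elim/ord3_ind: k; rewrite /=; ring.
Qed.

Lemma scalar_partP y (p : 'rV[R]_24) a e e' :
  scalar_part y p (a *: e + e') = a *: scalar_part y p e + scalar_part y p e'.
Proof. by apply/rowP => k; rewrite !mxE; elim/ord6_ind: k; rewrite /=; ring. Qed.

Lemma dtorsionP y dy a e e' :
  dtorsion y dy (a *: e + e') = a *: dtorsion y dy e + dtorsion y dy e'.
Proof.
apply/matrixP => i k; rewrite !mxE.
elim/ord3_ind: i; elim/ord3_ind: k; rewrite /=; ring.
Qed.

Lemma dtorsionPl y a dy dy' e :
  dtorsion y (a *: dy + dy') e = a *: dtorsion y dy e + dtorsion y dy' e.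
Proof.
apply/matrixP => i k; rewrite !mxE /y0 /y1 !mxE.
elim/ord3_ind: i; elim/ord3_ind: k; rewrite /=; ring.
Qed.

Lemma linear_row3 (f : 'rV[R]_3 -> R) e :
  (forall a e e', f (a *: e + e') = a * f e + f e') ->
  f e = \sum_n e 0 n * f (delta_mx 0 n).
Proof.
move=> fP; have f0 : f 0 = 0.
  by have := fP (-1) 0 0; rewrite scaler0 addr0 mulN1r addNr.
rewrite {1}[e]row_sum_delta !sum3 -addrA.
by rewrite fP -[_ *: delta_mx 0 i32]addr0 !fP f0 addr0 addrA.
Qed.

Section Torsion.
Variables (y : 'rV[R]_6) (p : 'rV[R]_24).

(* What has to be symmetric in e and e' on a lift of an integral element, up to
   the contribution of the second derivatives. *)
Let quad (e e' : 'rV[R]_3) : 'M[R]_3 :=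
  dtorsion y (scalar_part y p e) e' + connection y p (e' *m (connection y p e)^T) +
  connection y p e' *m connection y p e.

Let G i l n m := quad (delta_mx 0 n) (delta_mx 0 m) i l.

Lemma quadE e e' i l : quad e e' i l = \sum_n \sum_m e 0 n * e' 0 m * G i l n m.
Proof.
rewrite /G /quad; move: (@connectionP y p) (@scalar_partP y p) (@dtorsionP y) (@dtorsionPl y).
move: (connection y p) (scalar_part y p) (dtorsion y) => c s d cP sP dP dPl.
pose q e e' := d (s e) e' + c (e' *m (c e)^T) + c e' *m c e.
rewrite -/(q e e') (@linear_row3 (fun e => q e e' i l)).
  apply: eq_bigr => n _; rewrite (@linear_row3 (fun e' => q _ e' i l)).
    by rewrite mulr_sumr; apply: eq_bigr => m _; rewrite mulrA.
  move=> a e1 e2; rewrite /q dP mulmxDl -scalemxAl !cP mulmxDl -scalemxAl.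
  move: (_ *m _) (_ *m _) (_ *m _) (_ *m _) => A B C D.
  by rewrite !mxE; ring.
move=> a e1 e2; rewrite /q sP dPl !cP linearP /= mulmxDr -scalemxAr cP mulmxDr -scalemxAr.
move: (_ *m _) (_ *m _) (_ *m _) (_ *m _) => A B C D.
by rewrite !mxE; ring.
Qed.

(** Compatibility condition for [second_jet]: the correction it provides is symmetric in the lower
    indices, so the total antisymmetrization of [quad] must vanish. It expresses d(d eta^(i+1)) = 0,
    which holds thanks to the shape of theta^1, without eta^2, and of theta^2, with the term K I
    eta^3. *)
Lemma quad_cyclic i : G i i30 i32 i31 - G i i30 i31 i32 + (G i i31 i30 i32 -
  G i i31 i32 i30) + (G i i32 i31 i30 - G i i32 i30 i31) = 0.
Proof.
have dE (a b : 'I_3) : (delta_mx 0 a : 'rV[R]_3) 0 b = (b == a)%:R by rewrite mxE eqxx.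
have CE i0 k n : connection y p (delta_mx 0 n) i0 k = pr p (sym_index i0 k n) +
    nth 0 (nth [::] [:: [:: 0; 0; (n == i31)%:R - y0 y * (n == i30)%:R];
      [:: 0; 0; - (n == i30)%:R]; [:: 0; y1 y * (n == i30)%:R; 0]] i0) k.
  rewrite !mxE sum3 !dE; congr (_ + _); last by rewrite ![i30 == n]eq_sym ![i31 == n]eq_sym.
  by elim/ord3_ind: n; rewrite /= ?(mulr0, mulr1, addr0, add0r).
have rE (A : 'M[R]_3) n k : ((delta_mx 0 n : 'rV[R]_3) *m A^T) 0 k = A k n.
  by rewrite -rowE !mxE.
have GE l n m : G i l n m = nth 0 (nth [::] [:: [:: 0; 0;
    - (y0 (scalar_part y p (delta_mx 0 n)) * (m == i30)%:R)]; [:: 0; 0; 0];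
    [:: 0; y1 (scalar_part y p (delta_mx 0 n)) * (m == i30)%:R; 0]] i) l +
  (\sum_k pr p (sym_index i l k) * connection y p (delta_mx 0 n) k m +
    nth 0 (nth [::] [:: [:: 0; 0; connection y p (delta_mx 0 n) i31 m -
      y0 y * connection y p (delta_mx 0 n) i30 m];
      [:: 0; 0; - connection y p (delta_mx 0 n) i30 m];
      [:: 0; y1 y * connection y p (delta_mx 0 n) i30 m; 0]] i) l) +
  \sum_k connection y p (delta_mx 0 m) i k * connection y p (delta_mx 0 n) k l.
  rewrite /G /quad [LHS]mxE [X in X + _]mxE [X in _ + X]mxE; congr (_ + _ + _).
    by rewrite mxE dE [i30 == m]eq_sym.
  rewrite mxE mxE; congr (_ + _); first by apply: eq_bigr => k _; rewrite rE.
  by rewrite mxE !rE.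
rewrite !GE !sum3 !CE {GE CE}.
by elim/ord3_ind: i; rewrite /= /y0 /y1 /y2 /y3 /y4 /y5 /scalar_part /rv6 ?mxE /=
  /sym_index /= /y0 /y1 /y2 /y3 /y4 /y5; ring.
Qed.

(* Second derivatives which absorb the torsion: the solution of the linear
   system expressing the symmetry below with the free unknowns set to 0. *)
Definition second_jet (e : 'rV[R]_3) : 'rV[R]_24 :=
  let D i l n m := G i l m n - G i l n m in
  let P i := [:: e 0 i31 * D i i30 i31 i30 + e 0 i32 * D i i30 i32 i30;
    e 0 i32 * D i i31 i32 i30; e 0 i31 * D i i32 i31 i30;
    e 0 i30 * D i i31 i30 i31 + e 0 i32 * D i i31 i32 i31; 0;
    e 0 i30 * D i i32 i30 i32 + e 0 i31 * D i i32 i31 i32] in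
  let I := y0 y in let K := y1 y in let I1 := y2 y in let I3 := y3 y in
  let K1 := y4 y in let K2 := y5 y in
  let a1 := pr p 18 in let a3 := pr p 19 in let b3 := pr p 20 in
  let c1 := pr p 21 in let c2 := pr p 22 in let d2 := pr p 23 in
  let a2 := I3 * K in let b1 := a3 + I * I1 in
  let c3 := - (2 * I * K1) - K2 - K * I1 in let d1 := c2 + K * K * I in
  let d3 := K1 - I * K2 in
  \row_(k < 24) nth 0 (P i30 ++ P i31 ++ P i32 ++ [::
    (b1 * K + I3 * K1 + a3 * K) * e 0 i31 + (- a1 * I - a2) * e 0 i32;
    (b3 * K - I3 * K * I - a1) * e 0 i31 +
      (- b1 * I + I1 - I3 * I1 - I * a3) * e 0 i32;
    (- a3 - b1) * e 0 i31;
    c3 * K * e 0 i31 + (- (2 * (I1 * K1 + I * c1)) - d1 - (K1 * I1 + K * a1)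
      - c1 * I - c2) * e 0 i32;
    (- (2 * I * c2) - d2 - K2 * I1 - K * a2 + c1) * e 0 i32;
    (2 * K * K2 * I - d3 * K) * e 0 i30 + (c2 - I * d2 + d1) * e 0 i32]) k.

(** Once [G] is generalized to arbitrary coefficients, [quad_cyclic] eliminates one of them and the
    rest is a polynomial identity. *)
Lemma second_jet_sym e e' :
  sym_part (second_jet e) e' + quad e e' = sym_part (second_jet e') e + quad e' e.
Proof.
apply/matrixP => i l; rewrite [LHS]mxE [RHS]mxE !quadE ![sym_part _ _ _ _]mxE !sum3.
rewrite /second_jet; have := quad_cyclic i; move: G => g.
set s := g i i31 i30 i32 - _; set s' := g i i32 i31 i30 - _ => c.
have {}c : g i i30 i32 i31 = g i i30 i31 i32 - s - s' by rewrite -[RHS]addr0 -c; ring.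
rewrite {}/s {}/s' in c; move: c.
by elim/ord3_ind: i; elim/ord3_ind: l; rewrite /sym_index /= !pr_row //= => c;
  rewrite ?c; ring.
Qed.

(** Components 0 and 1 hold because the coefficients of [scalar_part] were solved from d theta^1 = 0
    and d theta^2 = 0; components 2 to 5 are the equations solved by the last six entries of
    [second_jet]. *)
Lemma second_jet_scalar_sym e e' :
  dscalar y (scalar_part y p e) (second_jet e) e' +
    scalar_part y p (e' *m (connection y p e)^T) =
  dscalar y (scalar_part y p e') (second_jet e') e +
    scalar_part y p (e *m (connection y p e')^T).
Proof.
have E a b i : (a *m (connection y p b)^T) 0 i = \sum_k a 0 k * connection y p b i k.
  by rewrite mxE; apply: eq_bigr => k _; rewrite mxE.
have CE b i k : connection y p b i k = pr p (sym_index i k i30) * b 0 i30 +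
    pr p (sym_index i k i31) * b 0 i31 + pr p (sym_index i k i32) * b 0 i32 +
    nth 0 (nth [::] [:: [:: 0; 0; b 0 i31 - y0 y * b 0 i30]; [:: 0; 0; - b 0 i30];
      [:: 0; y1 y * b 0 i30; 0]] i) k.
  by rewrite !mxE sum3.
apply/rowP => k; rewrite [LHS]mxE [RHS]mxE.
rewrite /dscalar /scalar_part ![rv6 _ _ _]mxE.
elim/ord6_ind: k; rewrite /= !E !sum3 !CE /sym_index /= /y0 /y1 /y2 /y3 /y4 /y5
  /rv6 ?mxE /= ?pr_row //= /y0 /y1 /y2 /y3 /y4 /y5.
all: ring.
Qed.

End Torsion.

Lemma djet_sym (z : TM) p r r' :
  djet z p (jet z p r) (second_jet z.2 p (r *m z.1.2^T)) r' =
  djet z p (jet z p r') (second_jet z.2 p (r' *m z.1.2^T)) r.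
Proof.
rewrite /djet /= !trmx_mul !mulmxA; congr (_, _, _); last exact: second_jet_scalar_sym.
rewrite -!mulmxDl; congr (_ *m _).
by have := second_jet_sym z.2 p (r *m z.1.2^T) (r' *m z.1.2^T); rewrite /= !addrA.
Qed.

End JetDerivative.

(** * The tableau *)

Section Dimensions.
Variables (K : fieldType) (vT : vectType K).

Definition lin_of (U W : lmodType K) (f : U -> W) (fP : linear f) : {linear U -> W} :=
  HB.pack f (GRing.isLinear.Build K U W _ f fP).

Lemma dim_rV k : dim 'rV[K]_k = k.
Proof. exact: mul1n. Qed.

Lemma dimv_le k (U : {vspace vT}) (phi : {linear vT -> 'rV[K]_k}) :
  (forall u, u \in U -> phi u = 0 -> u = 0) -> (\dim U <= k)%N.
Proof.
move=> inj; have ker0 : (U :&: lker (linfun phi) = 0)%VS.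
  apply/eqP; rewrite -subv0; apply/subvP => u.
  by rewrite memv_cap memv_ker lfunE memv0 => /andP[uU /eqP /(inj u uU) ->].
rewrite -(limg_dim_eq ker0); apply: leq_trans (dimvS (subvf _)) _.
by rewrite dimvf dim_rV.
Qed.

Lemma dimv_ge k (U : {vspace vT}) (psi : {linear 'rV[K]_k -> vT}) :
  (forall x, psi x = 0 -> x = 0) -> (forall x, psi x \in U) -> (k <= \dim U)%N.
Proof.
move=> inj psiU; have ker0 : (fullv :&: lker (linfun psi) = 0)%VS.
  apply/eqP; rewrite -subv0; apply/subvP => u.
  by rewrite memv_cap memv_ker lfunE memv0 => /andP[_ /eqP /inj ->].
have := limg_dim_eq ker0; rewrite dimvf dim_rV => <-.
by apply: dimvS; apply/subvP => _ /memv_imgP[x _ ->]; rewrite lfunE.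
Qed.

Lemma dimv_limg (wT : vectType K) (f : {linear vT -> wT}) k (U : {vspace wT}) :
  dim vT = k -> (forall u, f u = 0 -> u = 0) ->
  (forall w, w \in U <-> exists u, w = f u) -> \dim U = k.
Proof.
move=> dk inj UP; have -> : U = limg (linfun f).
  apply/vspaceP => w; apply/idP/memv_imgP => [/UP[u ->]|[u _ ->]].
    by exists u; rewrite ?memvf // lfunE.
  by apply/UP; exists u; rewrite lfunE.
rewrite limg_dim_eq ?dimvf //; apply/eqP; rewrite -subv0; apply/subvP => u.
by rewrite memv_cap memv_ker lfunE memv0 => /andP[_ /eqP /inj ->].
Qed.

End Dimensions.

Section Select.
Variables (R : realType).

(** Total on natural indices, so that tables of natural numbers can be used; an index out of range
    means a zero coordinate. *)
Definition entry N (x : 'rV[R]_N) (n : nat) : R := if insub n is Some i then x 0 i else 0.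

Definition select N k (tab : nat -> nat) (x : 'rV[R]_N) : 'rV[R]_k :=
  \row_(d < k) entry x (tab d).

Lemma entryP N a (x x' : 'rV[R]_N) n : entry (a *: x + x') n = a * entry x n + entry x' n.
Proof. by rewrite /entry; case: insub => [i|]; rewrite ?mxE // mulr0 addr0. Qed.

Lemma select_linear N k tab : linear (@select N k tab).
Proof. by move=> a x x'; apply/rowP => d; rewrite !mxE entryP. Qed.

Lemma entry_select N k tab (x : 'rV[R]_N) n : (n < k)%N ->
  entry (@select N k tab x) n = entry x (tab n).
Proof. by move=> ltn; rewrite /entry insubT mxE. Qed.

Lemma entry_out N (x : 'rV[R]_N) n : (N <= n)%N -> entry x n = 0.
Proof. by move=> le_Nn; rewrite /entry insubF // ltnNge le_Nn. Qed.

Lemma entry_eq0 N (x : 'rV[R]_N) : (forall n, (n < N)%N -> entry x n = 0) -> x = 0.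
Proof.
by move=> x0; apply/rowP => i; have := x0 i (ltn_ord i); rewrite /entry valK mxE.
Qed.

Lemma pr_entry (p : 'rV[R]_24) n : (n < 24)%N -> pr p n = entry p n.
Proof.
by move=> ltn; rewrite /pr /entry insubT; congr (p 0 _); apply: val_inj; rewrite /= inordK.
Qed.

End Select.

Section Tableau.
Variable R : realType.
Local Notation TM := (tilde_model R).

Definition flat (w : TM) : 'rV[R]_(3 * 3 + 6) := row_mx (mxvec w.1.2) w.2.

Lemma flat_linear a w w' : flat (a *: w + w') = a *: flat w + flat w'.
Proof.
rewrite /flat scale_row_mx add_row_mx -linearZ -linearD //.
Qed.

Lemma flat_frame w i j : flat w 0 (lshift 6 (mxvec_index i j)) = w.1.2 i j.
Proof. by rewrite row_mxEl mxvecE. Qed.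

Lemma flat_scalar w k : flat w 0 (rshift (3 * 3) k) = w.2 0 k.
Proof. by rewrite row_mxEr. Qed.

Lemma flat_ind (P : 'I_(3 * 3 + 6) -> Prop) :
  (forall i j, P (lshift 6 (mxvec_index i j))) -> (forall k, P (rshift (3 * 3) k)) ->
  forall a, P a.
Proof.
by move=> Pl Pr a; case: (split_ordP a) => [k ->|k ->] //; case/mxvec_indexP: k.
Qed.

Lemma flat_eq0 w : (forall a, flat w 0 a = 0) -> w.1.2 = 0 /\ w.2 = 0.
Proof.
move=> w0; split; first by apply/matrixP => i j; rewrite -flat_frame w0 mxE.
by apply/rowP => k; rewrite -flat_scalar w0 mxE.
Qed.

Variables (f : 'M[R]_3) (y : 'rV[R]_6).
Hypothesis uf : f \in unitmx.

(* The derivative of [jet] in the direction of the parameters, in terms of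
   the components e of the tangent vector in the frame. *)
Definition symbol_vec (q : 'rV[R]_24) (e : 'rV[R]_3) : TM :=
  (0, sym_part q e *m f, dscalar y 0 q e).

(** The sign is that of the contact forms dw - jet z p (dx), whose structure coefficients these
    matrices are. *)
Definition symbol (q : 'rV[R]_24) : 'M[R]_(3 * 3 + 6, 3) :=
  \matrix_(a, i) (- flat (symbol_vec q (delta_mx 0 i)) 0 a).

Lemma dscalar0E (q : 'rV[R]_24) e : dscalar y 0 q e = rv6 [:: 0; 0;
  pr q 18 * e 0 i30 + pr q 19 * e 0 i32; pr q 19 * e 0 i30 + pr q 20 * e 0 i32;
  pr q 21 * e 0 i30 + pr q 22 * e 0 i31; pr q 22 * e 0 i30 + pr q 23 * e 0 i31].
Proof.
apply/rowP => k; rewrite !mxE /y0 /y1 /y2 /y3 /y4 /y5 !mxE.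
by elim/ord6_ind: k; rewrite /=; ring.
Qed.

Lemma symbol_vecPl a q q' e :
  symbol_vec (a *: q + q') e = a *: symbol_vec q e + symbol_vec q' e.
Proof.
rewrite /symbol_vec -[RHS]/(a *: 0 + 0, a *: (sym_part q e *m f) + sym_part q' e *m f,
  a *: dscalar y 0 q e + dscalar y 0 q' e) scaler0 addr0; congr (_, _, _).
  rewrite scalemxAl -mulmxDl; congr (_ *m _); apply/matrixP => i k.
  by rewrite !mxE !sum3 /pr !mxE; ring.
rewrite !dscalar0E; apply/rowP => k; rewrite !mxE /pr !mxE.
by elim/ord6_ind: k; rewrite /=; ring.
Qed.

Lemma symbol_vecPr a q e e' :
  symbol_vec q (a *: e + e') = a *: symbol_vec q e + symbol_vec q e'.
Proof.
rewrite /symbol_vec -[RHS]/(a *: 0 + 0, a *: (sym_part q e *m f) + sym_part q e' *m f,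
  a *: dscalar y 0 q e + dscalar y 0 q e') scaler0 addr0; congr (_, _, _).
  rewrite scalemxAl -mulmxDl; congr (_ *m _); apply/matrixP => i k.
  by rewrite !mxE !sum3 !mxE; ring.
rewrite !dscalar0E; apply/rowP => k; rewrite !mxE.
by elim/ord6_ind: k; rewrite /=; ring.
Qed.

Lemma symbol_linear : linear symbol.
Proof.
have E q b i : symbol q b i = - flat (symbol_vec q (delta_mx 0 i)) 0 b by rewrite mxE.
move=> a q q'; apply/matrixP => b i; rewrite E [RHS]mxE [(a *: symbol q) b i]mxE !E.
by rewrite symbol_vecPl flat_linear; move: (flat _) (flat _) => u u'; rewrite !mxE; ring.
Qed.

Lemma symbol_mul n (C : 'M[R]_(3, n)) q a j :
  (symbol q *m C) a j = - flat (symbol_vec q (row j C^T)) 0 a.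
Proof.
rewrite (@linear_row3 _ (fun e => - flat (symbol_vec q e) 0 a)) => [|c e e']; last first.
  by rewrite symbol_vecPr flat_linear; move: (flat _) (flat _) => u u'; rewrite !mxE; ring.
by rewrite mxE; apply: eq_bigr => i _; rewrite [symbol q a i]mxE [(row _ _) 0 i]mxE [C^T _ _]mxE mulrC.
Qed.

(** The invertible f drops out, and the condition splits into contractions of five quadratic forms:
    three in all variables, one in the variables 1 and 3, one in 1 and 2. *)
Lemma symbol_mul_eq0 n (C : 'M[R]_(3, n)) q : symbol q *m C = 0 <->
  forall j, let e := row j C^T in
  [/\ forall i k, \sum_m pr q (sym_index i k m) * e 0 m = 0,
     pr q 18 * e 0 i30 + pr q 19 * e 0 i32 = 0,
     pr q 19 * e 0 i30 + pr q 20 * e 0 i32 = 0,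
     pr q 21 * e 0 i30 + pr q 22 * e 0 i31 = 0 &
     pr q 22 * e 0 i30 + pr q 23 * e 0 i31 = 0].
Proof.
split=> [S0 j e|H].
  have [|M0 D0] := @flat_eq0 (symbol_vec q e).
    by move=> a; apply: oppr_inj; rewrite -symbol_mul S0 oppr0 mxE.
  have {}M0 : sym_part q e = 0.
    by rewrite -[LHS](mulmxK uf) [_ *m f]M0 mul0mx.
  move: D0; rewrite /= dscalar0E => D0; split=> [i k||||].
  - by have := congr1 (fun A : 'M[R]_3 => A i k) M0; rewrite !mxE.
  - by have := congr1 (fun A : 'rV[R]_6 => A 0 (@i6 2 isT)) D0; rewrite !mxE.
  - by have := congr1 (fun A : 'rV[R]_6 => A 0 (@i6 3 isT)) D0; rewrite !mxE.
  - by have := congr1 (fun A : 'rV[R]_6 => A 0 (@i6 4 isT)) D0; rewrite !mxE.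
  - by have := congr1 (fun A : 'rV[R]_6 => A 0 (@i6 5 isT)) D0; rewrite !mxE.
apply/matrixP => a j; rewrite symbol_mul [RHS]mxE.
have [H1 h2 h3 h4 h5] := H j.
elim/flat_ind: a => [i k|k]; rewrite ?flat_frame ?flat_scalar /symbol_vec /=.
  have -> : sym_part q (row j C^T) = 0 by apply/matrixP => i' k'; rewrite !mxE H1.
  by rewrite mul0mx mxE oppr0.
rewrite dscalar0E h2 h3 h4 h5 mxE.
by elim/ord6_ind: k; rewrite /= oppr0.
Qed.

End Tableau.

(** * Bounds on the characters, valid for all flags *)

Section Characters.
Variable R : realType.
Variables (f : 'M[R]_3) (y : 'rV[R]_6).
Hypothesis uf : f \in unitmx.
Variable X : {vspace 'M[R]_(15, 3)}.
Hypothesis XP : forall P, P \in X <-> exists q, P = symbol f y q.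

Local Notation symb := (lin_of (symbol_linear f y)).

Definition symbol_at (B : 'M[R]_3) (k : nat) (q : 'rV[R]_24) : 'M[R]_(15, 3) :=
  symbol f y q *m (B *m (pid_mx k : 'M[R]_3)).

Lemma symbol_at_linear B k : linear (symbol_at B k).
Proof. by move=> a q q'; rewrite /symbol_at symbol_linear mulmxDl scalemxAl. Qed.

Lemma mulmxr_linear (C : 'M[R]_3) : linear (fun P : 'M[R]_(15, 3) => P *m C).
Proof. by move=> a P P'; rewrite mulmxDl scalemxAl. Qed.

Lemma columnsP B k P :
  P \in (linfun (fun P : 'M[R]_(15, 3) => P *m (B *m (pid_mx k : 'M[R]_3))) @: X)%VS <->
  exists q, P = symbol_at B k q.
Proof.
have E Q : linfun (fun P : 'M[R]_(15, 3) => P *m (B *m (pid_mx k : 'M[R]_3))) Q =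
    Q *m (B *m (pid_mx k : 'M[R]_3)) := lfunE (lin_of (mulmxr_linear _)) Q.
split=> [/memv_imgP[Q /XP[q ->] ->]|[q ->]]; first by exists q; rewrite E.
by apply/memv_imgP; exists (symbol f y q); rewrite ?E //; apply/XP; exists q.
Qed.

(** Rank-nullity: column dimensions are computed from kernels, which are given by explicit
    equations. *)
Lemma column_dim_ker B k :
  (column_dim X B k + \dim (lker (linfun (lin_of (symbol_at_linear B k)))) = 24)%N.
Proof.
have := limg_ker_dim (linfun (lin_of (symbol_at_linear B k))) fullv.
rewrite dimvf dim_rV capfv addnC => K; apply: etrans _ K; congr (\dim _ + _)%N.
apply/vspaceP => P; apply/idP/memv_imgP => [/columnsP[q ->]|[q _ ->]].
  by exists q; rewrite ?memvf // lfunE.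
by apply/columnsP; exists q; rewrite lfunE.
Qed.

Lemma mem_lker_symbol B k q : q \in lker (linfun (lin_of (symbol_at_linear B k))) <->
  forall j : 'I_3, (j < k)%N -> let e := row j B^T in
  [/\ forall i k, \sum_m pr q (sym_index i k m) * e 0 m = 0,
     pr q 18 * e 0 i30 + pr q 19 * e 0 i32 = 0,
     pr q 19 * e 0 i30 + pr q 20 * e 0 i32 = 0,
     pr q 21 * e 0 i30 + pr q 22 * e 0 i31 = 0 &
     pr q 22 * e 0 i30 + pr q 23 * e 0 i31 = 0].
Proof.
rewrite memv_ker lfunE /=.
have rowE j : row j (B *m (pid_mx k : 'M[R]_3))^T = (j < k)%N%:R *: row j B^T.
  apply/rowP => i; rewrite !mxE (bigD1 j) //= big1 => [|l lj].
    by rewrite mxE eqxx /= mulrC addr0.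
  by rewrite mxE (_ : (l == j :> nat) = false) ?mulr0 //; apply/negbTE.
split=> [/eqP/(symbol_mul_eq0 y uf) H j ltj|H].
  by have := H j; rewrite rowE ltj scale1r.
apply/eqP/(symbol_mul_eq0 y uf) => j; rewrite rowE.
have [ltj|le_kj] := ltnP j k; first by rewrite scale1r; exact: H.
rewrite scale0r; split=> [i l||||]; rewrite ?mxE ?mulr0 ?addr0 //.
by apply: big1 => m _; rewrite mxE mulr0.
Qed.

Lemma column_dim0 B : column_dim X B 0 = 0%N.
Proof.
rewrite /column_dim; apply/eqP; rewrite dimv_eq0 -subv0; apply/subvP => P.
by move=> /columnsP[q ->]; rewrite /symbol_at pid_mx_0 !mulmx0 mem0v.
Qed.

Lemma sum_sym_index (q : 'rV[R]_24) (e : 'rV[R]_3) :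
  (forall i k, \sum_m pr q (sym_index i k m) * e 0 m = 0) <->
  forall c, c \in [:: 0; 6; 12]%N ->
  [/\ entry q c * e 0 i30 + entry q (1 + c)%N * e 0 i31 + entry q (2 + c)%N * e 0 i32 = 0,
      entry q (1 + c)%N * e 0 i30 + entry q (3 + c)%N * e 0 i31 + entry q (4 + c)%N * e 0 i32 = 0 &
      entry q (2 + c)%N * e 0 i30 + entry q (4 + c)%N * e 0 i31 + entry q (5 + c)%N * e 0 i32 = 0].
Proof.
split=> [H c|H i k].
  rewrite !inE => /or3P[] /eqP ->.
  - have := H i30 i30; have := H i30 i31; have := H i30 i32.
    by rewrite !sum3 /sym_index /= !pr_entry.
  - have := H i31 i30; have := H i31 i31; have := H i31 i32.
    by rewrite !sum3 /sym_index /= !pr_entry.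
  have := H i32 i30; have := H i32 i31; have := H i32 i32.
  by rewrite !sum3 /sym_index /= !pr_entry.
have [//|a1 a2 a3] := H 0%N; have [//|b1 b2 b3] := H 6%N; have [//|c1 c2 c3] := H 12%N.
by rewrite sum3; elim/ord3_ind: i; elim/ord3_ind: k; rewrite /sym_index /= !pr_entry.
Qed.

Lemma symbol_inj q : symbol f y q = 0 -> q = 0.
Proof.
move=> S0; have S1 : symbol f y q *m 1%:M = 0 by rewrite S0 mul0mx.
have H := (symbol_mul_eq0 y uf 1%:M q).1 S1.
have e (j i : 'I_3) : (row j (1%:M : 'M[R]_3)^T) 0 i = (i == j)%:R by rewrite !mxE.
have [/sum_sym_index H0 h1 h2 h3 h4] := H i30.
have [/sum_sym_index H1 _ _ k3 k4] := H i31.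
have [/sum_sym_index H2 l1 l2 _ _] := H i32.
have {H0}[a a' a''] : [/\ [/\ entry q 0 = 0, entry q 1 = 0 & entry q 2 = 0],
    [/\ entry q 6 = 0, entry q 7 = 0 & entry q 8 = 0] &
    [/\ entry q 12 = 0, entry q 13 = 0 & entry q 14 = 0]].
  have := H0 12%N isT; have := H0 6%N isT; have := H0 0%N isT.
  by rewrite !e /= !(mulr0, mulr1, addr0).
have {H1}[[b1 b2] [b7 b8] [b13 b14]] : [/\ entry q 3 = 0 /\ entry q 4 = 0,
    entry q 9 = 0 /\ entry q 10 = 0 & entry q 15 = 0 /\ entry q 16 = 0].
  have [] := H1 12%N isT; have [] := H1 6%N isT; have [] := H1 0%N isT.
  by rewrite !e /= !(mulr0, mulr1, addr0, add0r).
have {H2}[c1 c2 c3] : [/\ entry q 5 = 0, entry q 11 = 0 & entry q 17 = 0].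
  have [] := H2 12%N isT; have [] := H2 6%N isT; have [] := H2 0%N isT.
  by rewrite !e /= !(mulr0, mulr1, addr0, add0r).
rewrite !e !pr_entry //= ?(mulr0, mulr1, addr0, add0r) in h1 h2 h3 h4 k3 k4 l1 l2.
case: a a' a'' => [a1 a2 a3] [a4 a5 a6] [a7 a8 a9].
by apply: entry_eq0 => n; do 24?[case: n => [//|n]].
Qed.

Lemma column_dim3 B : B \in unitmx -> column_dim X B 3 = 24%N.
Proof.
move=> uB; have := column_dim_ker B 3.
suff -> : lker (linfun (lin_of (symbol_at_linear B 3))) = 0%VS by rewrite dimv0 addn0.
apply/eqP; rewrite -subv0; apply/subvP => q; rewrite memv_ker lfunE /= memv0.
rewrite /symbol_at pid_mx_1 mulmx1 => /eqP S0; apply/eqP/symbol_inj.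
by rewrite -[LHS](mulmxK uB) S0 mul0mx.
Qed.

(** Rows 9 and 10 of the tableau, those of dI and dK, are zero, so a single column has at most 15 -
    2 independent entries; [sel] skips these rows. *)
Lemma column_dim1_le B : (column_dim X B 1 <= 13)%N.
Proof.
pose sel (P : 'M[R]_(15, 3)) : 'rV[R]_13 :=
  \row_d P (inord (if (d < 9)%N then (d : nat) else d.+2)) i30.
have sel_lin : linear sel by move=> a P P'; apply/rowP => d; rewrite !mxE.
apply: (dimv_le (phi := lin_of sel_lin)) => P /columnsP[q ->] /= s0.
have cols a (j : 'I_3) : (0 < j)%N -> symbol_at B 1 q a j = 0.
  move=> j0; rewrite /symbol_at mulmxA mxE big1 // => l _; rewrite [pid_mx _ _ _]mxE.
  by rewrite (_ : _ && _ = false) ?mulr0 //; case: eqP => //= ->; rewrite ltnNge j0.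
have s0E d (ltd : (d < 13)%N) := congr1 (fun A : 'rV[R]_13 => A 0 (Ordinal ltd)) s0.
apply/matrixP => a j; rewrite [RHS]mxE.
case: j => [[|j] ltj]; last exact: cols.
rewrite (_ : Ordinal ltj = i30); last exact: val_inj.
case: (split_ordP (a : 'I_(3 * 3 + 6))) => k ->.
  have ltk : (k < 13)%N by have := ltn_ord k; lia.
  have := s0E k ltk; rewrite [LHS]mxE [RHS]mxE /= ltn_ord => <-.
  by congr (symbol_at _ _ _ _ _); apply: val_inj; rewrite /= inordK // (ltn_trans ltk).
have [lt2|le2] := ltnP k 2.
  rewrite /symbol_at symbol_mul flat_scalar /= dscalar0E mxE.
  by case: k lt2 => [[|[|k]] ltk]; rewrite //= oppr0.
have ltk : (k + 7 < 13)%N by have := ltn_ord k; lia.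
have := s0E (k + 7)%N ltk; rewrite [LHS]mxE [RHS]mxE /=.
have -> : (k + 7 < 9)%N = false by lia.
move=> <-; congr (symbol_at _ _ _ _ _); apply: val_inj.
by have := ltn_ord k; rewrite /= inordK; lia.
Qed.

(** If [l] annihilates the first two columns of [B], the square of [l], placed in any of the three
    blocks of [sym_part], lies in the kernel; this leaves at most 24 - 3. *)
Lemma column_dim2_le B : B \in unitmx -> (column_dim X B 2 <= 21)%N.
Proof.
move=> uB; have := column_dim_ker B 2.
suff : (3 <= \dim (lker (linfun (lin_of (symbol_at_linear B 2)))))%N by lia.
(* The third row of the inverse annihilates the first two columns of [B]. *)
pose l := row i32 (invmx B).
have lB (j : 'I_3) : (j < 2)%N -> \sum_m l 0 m * (row j B^T) 0 m = 0.
  move=> ltj; have := congr1 (fun A : 'M[R]_3 => A i32 j) (mulVmx uB).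
  rewrite !mxE (_ : i32 == j = false); last by case: j ltj => [[|[|[|]]]].
  by move=> H; apply: etrans _ H; apply: eq_bigr => m _; rewrite !mxE.
have [m lm] : exists m, l 0 m != 0.
  apply/existsP; rewrite -negb_forall; apply/negP => /forallP l0.
  have := congr1 (fun A : 'M[R]_3 => A i32 i32) (mulVmx uB).
  rewrite !mxE big1 => [/eqP|m _]; first by rewrite eq_sym oner_eq0.
  by have := l0 m; rewrite mxE => /eqP ->; rewrite mul0r.
clearbody l.
pose L (x : 'rV[R]_3) n := nth 0 ([seq x 0 i30 * c | c <- [:: l 0 i30 * l 0 i30; l 0 i30 * l 0 i31;
    l 0 i30 * l 0 i32; l 0 i31 * l 0 i31; l 0 i31 * l 0 i32; l 0 i32 * l 0 i32]] ++
  [seq x 0 i31 * c | c <- [:: l 0 i30 * l 0 i30; l 0 i30 * l 0 i31;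
    l 0 i30 * l 0 i32; l 0 i31 * l 0 i31; l 0 i31 * l 0 i32; l 0 i32 * l 0 i32]] ++
  [seq x 0 i32 * c | c <- [:: l 0 i30 * l 0 i30; l 0 i30 * l 0 i31;
    l 0 i30 * l 0 i32; l 0 i31 * l 0 i31; l 0 i31 * l 0 i32; l 0 i32 * l 0 i32]]) n.
have L_lin : linear (fun x => \row_(n < 24) L x n : 'rV[R]_24).
  move=> a x x'; apply/rowP => n; rewrite !mxE /L.
  by case: n => n /= _; do 24?[case: n => [|n]; first by rewrite /= 2?mxE; ring]; rewrite /= ?nth_nil mulr0 addr0.
have LE x i k k' : pr (\row_(n < 24) L x n) (sym_index i k k') = x 0 i * (l 0 k * l 0 k').
  by elim/ord3_ind: i; elim/ord3_ind: k; elim/ord3_ind: k'; rewrite /sym_index /= pr_row // /L /=; ring.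
apply: (dimv_ge (psi := lin_of L_lin)) => x /=.
  move=> x0; apply/rowP => i; rewrite [RHS]mxE; apply/eqP.
  have := LE x i m m; rewrite x0 /pr mxE => /esym/eqP.
  by rewrite !mulf_eq0 !(negPf lm) !orbF.
apply/mem_lker_symbol => j ltj e; split=> [i k||||]; rewrite ?pr_row //= ?(mul0r, addr0) //.
rewrite (eq_bigr (fun m => x 0 i * l 0 k * (l 0 m * e 0 m))) => [|m' _].
  by rewrite -mulr_sumr lB // mulr0.
by rewrite LE; ring.
Qed.

End Characters.

(** * Exact characters and the prolongation of the tableau *)

Section Involutive.
Variable R : realType.
Variables (f : 'M[R]_3) (y : 'rV[R]_6).
Hypothesis uf : f \in unitmx.
Variable X : {vspace 'M[R]_(15, 3)}.
Hypothesis XP : forall P, P \in X <-> exists q, P = symbol f y q.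

(* A flag which is generic for the three blocks of the tableau. *)
Definition flag : 'M[R]_3 := mx3 [:: [:: 1; 0; 0]; [:: 0; 1; 0]; [:: 0; 1; 1]].

Lemma flag_unit : flag \in unitmx.
Proof.
pose G : 'M[R]_3 := mx3 [:: [:: 1; 0; 0]; [:: 0; 1; 0]; [:: 0; -1; 1]].
suff /mulmx1_unit[] : flag *m G = 1%:M by [].
apply/matrixP => i j; rewrite mxE sum3 !mxE.
by elim/ord3_ind: i; elim/ord3_ind: j; rewrite /=; ring.
Qed.

Lemma flag_row (j i : 'I_3) : row j flag^T 0 i =
  nth 0 (nth [::] [:: [:: 1; 0; 0]; [:: 0; 1; 1]; [:: 0; 0; 1]] j) i.
Proof. by rewrite !mxE; elim/ord3_ind: i; elim/ord3_ind: j. Qed.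

Lemma ker_flag1 q : q \in lker (linfun (lin_of (symbol_at_linear f y flag 1))) ->
  [/\ forall c, c \in [:: 0; 6; 12]%N ->
    [/\ entry q c = 0, entry q c.+1 = 0 & entry q c.+2 = 0],
  entry q 18 = 0, entry q 19 = 0, entry q 21 = 0 & entry q 22 = 0].
Proof.
move=> /(mem_lker_symbol y uf) /(_ i30 isT) [/sum_sym_index H].
rewrite !flag_row /= !(mulr0, mulr1, addr0) !pr_entry // => h1 h2 h3 h4.
by split=> // c /H; rewrite !flag_row /= !(mulr0, mulr1, addr0).
Qed.

(** The kernel consists of the quadratic forms without the first variable: three coefficients in
    each ternary block and one in each binary block, and 3 * 3 + 2 = 24 - 13. *)
Lemma column_dim_flag1 : column_dim X flag 1 = 13%N.
Proof.
have := column_dim_ker XP flag 1; have := column_dim1_le uf XP flag.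
suff : (\dim (lker (linfun (lin_of (symbol_at_linear f y flag 1)))) <= 11)%N by lia.
pose tab := nth 0%N [:: 3; 4; 5; 9; 10; 11; 15; 16; 17; 20; 23].
apply: (dimv_le (phi := lin_of (@select_linear R 24 11 tab))) => q /ker_flag1[H h1 h2 h3 h4] /= s0.
have s n : (n < 11)%N -> entry q (tab n) = 0.
  by move=> ltn; rewrite -(entry_select tab q ltn) s0 /entry insubT mxE.
have [a1 a2 a3] := H 0%N isT; have [a4 a5 a6] := H 6%N isT; have [a7 a8 a9] := H 12%N isT.
have := (s 0%N isT, s 1%N isT, s 2 isT, s 3 isT, s 4 isT, s 5 isT, s 6 isT, s 7 isT,
  s 8 isT, s 9 isT, s 10 isT) => -[[[[[[[[[[s1 s2] s3] s4] s5] s6] s7] s8] s9] s10] s11].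
by apply: entry_eq0 => n; do 24?[case: n => [//|n]].
Qed.

(** The second vector of [flag], (0, 1, 1), meets both remaining variables, so it also kills the
    coefficients 20 and 23 left in the binary blocks. One parameter remains in each ternary block,
    read at 5, 11 and 17. *)
Lemma column_dim_flag2 : column_dim X flag 2 = 21%N.
Proof.
have := column_dim_ker XP flag 2; have := column_dim2_le uf XP flag_unit.
suff : (\dim (lker (linfun (lin_of (symbol_at_linear f y flag 2)))) <= 3)%N by lia.
pose tab := nth 0%N [:: 5; 11; 17].
apply: (dimv_le (phi := lin_of (@select_linear R 24 3 tab))) => q qk /= s0.
have s n : (n < 3)%N -> entry q (tab n) = 0.
  by move=> ltn; rewrite -(entry_select tab q ltn) s0 /entry insubT mxE.
have q1 : q \in lker (linfun (lin_of (symbol_at_linear f y flag 1))).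
  apply/(mem_lker_symbol y uf) => j ltj.
  by have /(mem_lker_symbol y uf) /(_ j (ltnW ltj)) := qk.
have [H h1 h2 h3 h4] := ker_flag1 q1.
have /(mem_lker_symbol y uf) /(_ i31 isT) [/sum_sym_index K] := qk.
rewrite !flag_row /= !(mulr0, mulr1, addr0, add0r) !pr_entry // => k1 k2 k3 k4.
have {H}[[a1 a2 a3] [a4 a5 a6] [a7 a8 a9]] := (And3 (H 0%N isT) (H 6%N isT) (H 12%N isT)).
have E c : c \in [:: 0; 6; 12]%N -> entry q c.+2.+3 = 0 ->
    entry q c.+3 = 0 /\ entry q c.+4 = 0.
  move=> cI c5; have [_] := K c cI; rewrite !flag_row /= !(mulr0, mulr1, add0r).
  move=> e1 e2; have {}e1 : entry q c.+3 + entry q c.+4 = 0 := e1.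
  have {}e2 : entry q c.+4 + entry q c.+2.+3 = 0 := e2.
  by rewrite c5 addr0 in e2; rewrite e2 addr0 in e1.
have [b1 b2] := E 0%N isT (s 0%N isT); have [b3 b4] := E 6%N isT (s 1%N isT).
have [b5 b6] := E 12%N isT (s 2 isT).
have := (s 0%N isT, s 1%N isT, s 2 isT) => -[[s1 s2] s3].
by apply: entry_eq0 => n; do 24?[case: n => [//|n]].
Qed.

Definition characters (k : nat) : nat := nth 0%N [:: 0; 13; 8; 3]%N k.

(** [flag] attains the bounds 13 and 21 valid for all flags, and three columns always give 24. Under
    equality of the earlier characters, each bound on the next one follows by subtraction. *)
Lemma reduced_characters_symbol : reduced_characters X characters.
Proof.
have c0 B := column_dim0 XP B.
split=> [|B uB].
  exists flag; first exact: flag_unit.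
  have e3 := column_dim3 uf XP flag_unit.
  move=> [|[|[|[|k]]]] //= _; rewrite /character /=.
  - by rewrite c0 column_dim_flag1.
  - by rewrite column_dim_flag2 column_dim_flag1.
  by rewrite e3 column_dim_flag2.
have e1 := column_dim1_le uf XP B; have e2 := column_dim2_le uf XP uB.
have e3 := column_dim3 uf XP uB.
move=> [|[|[|[|k]]]] //= _ H; rewrite /character /=.
- by rewrite c0 subn0.
- by have := H 1%N isT; rewrite /character /= c0 /characters /= => ?; lia.
have := H 1%N isT; have := H 2%N isT; rewrite /character /= c0 e3 /characters /=; lia.
Qed.

(* Coordinates on the prolongation of the tableau: three copies of the cubic
   forms in three variables, for the sym_part, and two copies of those in two
   variables, for the second derivatives; 38 stands for the coordinate 0. *)
Definition prolong_index (n i : nat) : nat := nth 38%N (nth [::] [::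
  [:: 0; 1; 2]; [:: 1; 3; 4]; [:: 2; 4; 5]; [:: 3; 6; 7]; [:: 4; 7; 8]; [:: 5; 8; 9];
  [:: 10; 11; 12]; [:: 11; 13; 14]; [:: 12; 14; 15]; [:: 13; 16; 17];
  [:: 14; 17; 18]; [:: 15; 18; 19];
  [:: 20; 21; 22]; [:: 21; 23; 24]; [:: 22; 24; 25]; [:: 23; 26; 27];
  [:: 24; 27; 28]; [:: 25; 28; 29];
  [:: 30; 38; 31]; [:: 31; 38; 32]; [:: 32; 38; 33];
  [:: 34; 35; 38]; [:: 35; 36; 38]; [:: 36; 37; 38]]%N n) i.

Definition prolong (x : 'rV[R]_38) : {ffun 'I_3 -> 'M[R]_(15, 3)} :=
  [ffun i : 'I_3 => symbol f y (@select _ _ 24 (fun n => prolong_index n i) x)].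

Lemma prolong_linear : linear prolong.
Proof.
move=> a x x'; apply/ffunP => i; rewrite !ffunE select_linear symbol_linear //.
Qed.

Lemma prolongationP P : P \in tableau_prolongation X <->
  (forall i, P i \in X) /\ (forall i j, col i (P j) = col j (P i)).
Proof.
have L1 i : linear (fun P : {ffun 'I_3 -> 'M[R]_(15, 3)} => P i).
  by move=> a Q Q'; rewrite !ffunE.
have L2 i j : linear (fun P : {ffun 'I_3 -> 'M[R]_(15, 3)} => col i (P j) - col j (P i)).
  move=> a Q Q'; rewrite !ffunE; apply/matrixP => k l; rewrite !mxE; ring.
have E1 i Q : linfun (fun P : {ffun 'I_3 -> 'M[R]_(15, 3)} => P i) Q = Q i :=
  lfunE (lin_of (L1 i)) Q.
have E2 i j Q : linfun (fun P : {ffun 'I_3 -> 'M[R]_(15, 3)} =>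
    col i (P j) - col j (P i)) Q = col i (Q j) - col j (Q i) := lfunE (lin_of (L2 i j)) Q.
rewrite /tableau_prolongation; split=> [/memv_capP[]|[HX HC]].
  rewrite !memvE => /subv_bigcapP H1 /subv_bigcapP H2; split=> [i|i j].
    by have := H1 i isT; rewrite -memvE -memv_preim E1.
  have := H2 i isT => /subv_bigcapP /(_ j isT); rewrite -memvE memv_ker E2 subr_eq0.
  by move/eqP.
rewrite memv_cap !memvE; apply/andP; split; apply/subv_bigcapP => i _.
  by rewrite -memvE -memv_preim E1.
by apply/subv_bigcapP => j _; rewrite -memvE memv_ker E2 subr_eq0 HC.
Qed.

Lemma prolong_inj x : prolong x = 0 -> x = 0.
Proof.
move=> x0; have S0 (i : 'I_3) : @select _ _ 24 (fun n => prolong_index n i) x = 0.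
  apply: (@symbol_inj _ f y uf); have := congr1 (fun P : {ffun 'I_3 -> 'M[R]_(15, 3)} => P i) x0.
  by rewrite !ffunE.
have E n (i : 'I_3) : (n < 24)%N -> entry x (prolong_index n i) = 0.
  move=> ltn; rewrite -(entry_select (fun n => prolong_index n i) x ltn) S0.
  by rewrite /entry insubT mxE.
(* For each coordinate d, a row and a column of the table [prolong_index] where d occurs. *)
pose pick := zip [:: 0; 0; 0; 1; 1; 2; 3; 3; 4; 5; 6; 6; 6; 7; 7; 8; 9; 9; 10; 11;
  12; 12; 12; 13; 13; 14; 15; 15; 16; 17; 18; 18; 19; 20; 21; 21; 22; 23]%N
  [:: i30; i31; i32; i31; i32; i32; i31; i32; i32; i32;
      i30; i31; i32; i31; i32; i32; i31; i32; i32; i32;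
      i30; i31; i32; i31; i32; i32; i31; i32; i32; i32;
      i30; i32; i32; i32; i30; i31; i31; i31].
apply: entry_eq0 => d ltd.
have := E (nth (0%N, i30) pick d).1 (nth (0%N, i30) pick d).2.
by move: ltd; do 38?[case: d => [_ /(_ isT) //|d]].
Qed.

Definition pick_index (d : nat) : nat := nth 0%N
  [:: 0; 0; 0; 1; 1; 2; 3; 3; 4; 5; 6; 6; 6; 7; 7; 8; 9; 9; 10; 11;
  12; 12; 12; 13; 13; 14; 15; 15; 16; 17; 18; 18; 19; 20; 21; 21; 22; 23]%N d.

Definition pick_column (d : nat) : 'I_3 := nth i30
  [:: i30; i31; i32; i31; i32; i32; i31; i32; i32; i32;
      i30; i31; i32; i31; i32; i32; i31; i32; i32; i32;
      i30; i31; i32; i31; i32; i32; i31; i32; i32; i32;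
      i30; i32; i32; i32; i30; i31; i31; i31] d.

Lemma col_symbolP (q q' : 'rV[R]_24) (i j : 'I_3) :
  col i (symbol f y q) = col j (symbol f y q') <->
  sym_part q (delta_mx 0 i) = sym_part q' (delta_mx 0 j) /\
  dscalar y 0 q (delta_mx 0 i) = dscalar y 0 q' (delta_mx 0 j).
Proof.
have E q0 k : col k (symbol f y q0) = \col_a (- flat (symbol_vec f y q0 (delta_mx 0 k)) 0 a).
  by apply/colP => a; rewrite [LHS]mxE [LHS]mxE [RHS]mxE.
rewrite !E; split=> [e|[e1 e2]]; last first.
  by apply/colP => a; rewrite /symbol_vec e1 e2.
have {}e a : flat (symbol_vec f y q (delta_mx 0 i)) 0 a =
    flat (symbol_vec f y q' (delta_mx 0 j)) 0 a.
  by apply: oppr_inj; have /colP/(_ a) := e; rewrite [LHS]mxE [RHS]mxE.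
split; last by apply/rowP => k; have := e (rshift (3 * 3) k); rewrite !flat_scalar.
apply: (mulmx_injl uf); apply/matrixP => k l.
by have := e (lshift 6 (mxvec_index k l)); rewrite !flat_frame.
Qed.

Lemma prolong_sub x : prolong x \in tableau_prolongation X.
Proof.
apply/prolongationP; split=> [i|i j].
  by rewrite ffunE; apply/XP; eexists.
have lt24 a k l : (sym_index a k l < 24)%N.
  by elim/ord3_ind: a; elim/ord3_ind: k; elim/ord3_ind: l.
have dE (a b : 'I_3) : (delta_mx 0 a : 'rV[R]_3) 0 b = (b == a)%:R by rewrite mxE eqxx.
have E n l : (n < 24)%N -> pr (@select _ _ 24 (fun n => prolong_index n l) x) n =
    entry x (prolong_index n l).
  by move=> ltn; rewrite pr_entry // entry_select.
have x38 : entry x 38 = 0 by rewrite entry_out.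
rewrite !ffunE; apply/col_symbolP; split.
  apply/matrixP => a k; rewrite !mxE !sum3 !dE !E //.
  elim/ord3_ind: i; elim/ord3_ind: j; elim/ord3_ind: a; elim/ord3_ind: k;
    by rewrite /= ?(mulr0, mulr1, addr0, add0r).
rewrite !dscalar0E !E // !dE; apply/rowP => k; rewrite !mxE.
by elim/ord3_ind: i; elim/ord3_ind: j; elim/ord6_ind: k;
  rewrite /= ?x38 ?(mulr0, mulr1, addr0, add0r, mul0r).
Qed.

(** Column symmetry adds to the symmetry of [sym_index], so each ternary block holds the
    coefficients of a cubic form, which may be read at any of their positions. In a binary block the
    derivative in the missing direction vanishes, because the entry symmetric to it is zero in the
    tableau. *)
Lemma prolong_surj P : P \in tableau_prolongation X -> exists x, P = prolong x.
Proof.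
move=> /prolongationP[PX PC].
have [q qE] : exists q : 'I_3 -> 'rV[R]_24, forall i, P i = symbol f y (q i).
  by have [q qE] := choice (fun i => (XP (P i)).1 (PX i)); exists q.
have C i j := (col_symbolP (q j) (q i) i j).1.
have {}C i j : sym_part (q j) (delta_mx 0 i) = sym_part (q i) (delta_mx 0 j) /\
    dscalar y 0 (q j) (delta_mx 0 i) = dscalar y 0 (q i) (delta_mx 0 j).
  by apply: C; rewrite -!qE.
have lt24 a k l : (sym_index a k l < 24)%N.
  by elim/ord3_ind: a; elim/ord3_ind: k; elim/ord3_ind: l.
have dE (a b : 'I_3) : (delta_mx 0 a : 'rV[R]_3) 0 b = (b == a)%:R by rewrite mxE eqxx.
have E a k i j : entry (q j) (sym_index a k i) = entry (q i) (sym_index a k j).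
  rewrite -!pr_entry //; have [/(congr1 (fun A : 'M[R]_3 => A a k)) + _] := C i j.
  rewrite !mxE (bigD1 i) // [in RHS](bigD1 j) //= !dE !eqxx !mulr1.
  rewrite !big1 ?addr0 // => m /negPf nm; by rewrite dE nm mulr0.
have D i j k : dscalar y 0 (q j) (delta_mx 0 i) 0 k = dscalar y 0 (q i) (delta_mx 0 j) 0 k.
  by have [_ ->] := C i j.
pose x : 'rV[R]_38 := \row_d entry (q (pick_column d)) (pick_index d).
have xE d : (d < 38)%N -> entry x d = entry (q (pick_column d)) (pick_index d).
  by move=> ltd; rewrite /entry insubT mxE.
have x38 : entry x 38 = 0 by rewrite entry_out.
have S a k l (i : 'I_3) : entry x (prolong_index (sym_index a k l) i) = entry (q i) (sym_index a k l).
  (* These two exchanges link any position of a cubic coefficient with the one chosen by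
     [pick_index] and [pick_column]. *)
  have := E a k i l; have := E a l i k.
  by elim/ord3_ind: a; elim/ord3_ind: k; elim/ord3_ind: l; elim/ord3_ind: i;
    rewrite /= xE //= /pick_index /pick_column /=.
have {D}[D1 D2 D3] : [/\ forall k, dscalar y 0 (q i31) (delta_mx 0 i30) 0 k =
    dscalar y 0 (q i30) (delta_mx 0 i31) 0 k,
  forall k, dscalar y 0 (q i32) (delta_mx 0 i30) 0 k =
    dscalar y 0 (q i30) (delta_mx 0 i32) 0 k &
  forall k, dscalar y 0 (q i32) (delta_mx 0 i31) 0 k =
    dscalar y 0 (q i31) (delta_mx 0 i32) 0 k] by split=> k; apply: D.
rewrite !dscalar0E !dE in D1 D2 D3.
have {}S n (i : 'I_3) : (n < 18)%N -> entry x (prolong_index n i) = entry (q i) n.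
  have := S (nth i30 [:: i30; i30; i30; i30; i30; i30; i31; i31; i31; i31; i31; i31;
                         i32; i32; i32; i32; i32; i32] n)
    (nth i30 [:: i30; i30; i30; i31; i31; i32; i30; i30; i30; i31; i31; i32;
                 i30; i30; i30; i31; i31; i32] n)
    (nth i30 [:: i30; i31; i32; i31; i32; i32; i30; i31; i32; i31; i32; i32;
                 i30; i31; i32; i31; i32; i32] n) i.
  by do 18?[case: n => [//|n]].
have := (D1 (@i6 2 isT), D1 (@i6 3 isT), D1 (@i6 4 isT), D1 (@i6 5 isT)).
have := (D2 (@i6 2 isT), D2 (@i6 3 isT), D2 (@i6 4 isT), D2 (@i6 5 isT)).
have := (D3 (@i6 2 isT), D3 (@i6 3 isT), D3 (@i6 4 isT), D3 (@i6 5 isT)).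
rewrite !mxE /= !(mulr0, mulr1, addr0, add0r) !pr_entry //.
move=> [[[a1 a2] a3] a4] [[[b1 b2] b3] b4] [[[c1 c2] c3] c4].
exists x; apply/ffunP => i; rewrite qE ffunE; congr (symbol _ _ _).
apply/rowP => n; rewrite mxE.
have -> : q i 0 n = entry (q i) n by rewrite /entry valK.
case: n => n ltn /=.
have [/S -> //|le_n] := ltnP n 18.
move: ltn le_n; do 18?[case: n => [//|n]]; move: i; apply: ord3_ind.
all: do 6?[case: n => [|n]]; move=> // _ _.
all: rewrite /prolong_index /= ?x38 ?xE // /pick_column /pick_index /=.
Qed.

Lemma involutive_symbol : involutive_tableau X.
Proof.
exists characters; first exact: reduced_characters_symbol.
rewrite (dimv_limg (f := lin_of prolong_linear) (k := 38)) => [|||P].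
- by rewrite unlock.
- exact: dim_rV.
- exact: prolong_inj.
- by split=> [/prolong_surj[x ->]|[x ->]]; [exists x|apply: prolong_sub].
Qed.

Lemma last_character_symbol : last_character X 3 3.
Proof.
exists characters; first exact: reduced_characters_symbol.
by split=> // k; case: k => [|[|[|[|k]]]].
Qed.

End Involutive.

(** * Contact forms *)

Section LinearExpansion.
Variable R : realType.

Lemma linear_row n (f : 'rV[R]_n -> R^o) e : linear f ->
  f e = \sum_i e 0 i * f (delta_mx 0 i).
Proof.
move=> fP; rewrite {1}[e]row_sum_delta -[LHS]/(lin_of fP _) linear_sum.
by apply: eq_bigr => i _; rewrite linearZ.
Qed.

End LinearExpansion.

Section StructureEquations.
Variable R : realType.
Local Notation TM := (tilde_model R).
Local Notation Y := 'rV[R]_(3 + (3 * 3 + 6) + 24).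

(* A point of Y consists of a point [base] of the model space of Sigma_tilde and
   of the parameters [params] of an integral element at this point. *)
Definition base (v : Y) : TM := (lsubmx (lsubmx v),
  vec_mx (lsubmx (rsubmx (lsubmx v))), rsubmx (rsubmx (lsubmx v))).
Definition params (v : Y) : 'rV[R]_24 := rsubmx v.
Definition assemble (z : TM) (p : 'rV[R]_24) : Y :=
  row_mx (row_mx z.1.1 (flat z)) p.
Definition unflat (t : 'rV[R]_(3 * 3 + 6)) : TM := (0, vec_mx (lsubmx t), rsubmx t).

Lemma base_assemble z p : base (assemble z p) = z.
Proof.
case: z => [[x f] y].
by rewrite /base /assemble /flat /= !(row_mxKl, row_mxKr) mxvecK.
Qed.

Lemma params_assemble z p : params (assemble z p) = p.
Proof. by rewrite /params /assemble row_mxKr. Qed.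

Lemma assemble_base v : assemble (base v) (params v) = v.
Proof. by rewrite /assemble /flat /base /params /= vec_mxK !hsubmxK. Qed.

Lemma base_linear : linear base.
Proof. by move=> a u v; rewrite /base !linearP. Qed.

Lemma params_linear : linear params.
Proof. by move=> a u v; rewrite /params linearP. Qed.

Lemma flatK w : w.1.1 = 0 -> unflat (flat w) = w.
Proof.
by case: w => [[x f] y] /= ->; rewrite /unflat /flat row_mxKl row_mxKr mxvecK.
Qed.

Lemma unflatK t : flat (unflat t) = t.
Proof. by rewrite /flat /unflat /= vec_mxK hsubmxK. Qed.

Lemma unflat_linear : linear unflat.
Proof.
move=> a t t'; rewrite /unflat !linearP.
by rewrite -[RHS]/(a *: 0 + 0, _, _) scaler0 addr0.
Qed.

Lemma flat_linear' : linear (@flat R). Proof. exact: flat_linear. Qed.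

Lemma sym_partPr (p : 'rV[R]_24) a e e' :
  sym_part p (a *: e + e') = a *: sym_part p e + sym_part p e'.
Proof. by apply/matrixP => i k; rewrite !mxE !sum3 !mxE; ring. Qed.

Lemma sym_partPl a (p p' : 'rV[R]_24) e :
  sym_part (a *: p + p') e = a *: sym_part p e + sym_part p' e.
Proof. by apply/matrixP => i k; rewrite !mxE !sum3 /pr !mxE; ring. Qed.

Lemma dscalarPl (y : 'rV[R]_6) a dy dy' q q' e :
  dscalar y (a *: dy + dy') (a *: q + q') e = a *: dscalar y dy q e + dscalar y dy' q' e.
Proof.
apply/rowP => k; rewrite !mxE /pr /y0 /y1 /y2 /y3 /y4 /y5 !mxE.
by elim/ord6_ind: k; rewrite /=; ring.
Qed.

Lemma dscalarPr (y dy : 'rV[R]_6) a q e e' :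
  dscalar y dy q (a *: e + e') = a *: dscalar y dy q e + dscalar y dy q e'.
Proof. by apply/rowP => k; rewrite !mxE; elim/ord6_ind: k; rewrite /=; ring. Qed.

Lemma mulmx_linear_l m n l (a : R) (r r' : 'M[R]_(m, n)) (A : 'M[R]_(n, l)) :
  (a *: r + r') *m A = a *: (r *m A) + r' *m A.
Proof. by rewrite mulmxDl scalemxAl. Qed.

Lemma jetP (z : TM) (p : 'rV[R]_24) (a : R) (r r' : 'rV[R]_3) :
  jet z p (a *: r + r') = a *: jet z p r + jet z p r'.
Proof.
by rewrite /jet mulmx_linear_l connectionP scalar_partP mulmx_linear_l.
Qed.

Lemma djetPl (z : TM) p (a : R) (u u' : TM) (q q' : 'rV[R]_24) r :
  djet z p (a *: u + u') (a *: q + q') r = a *: djet z p u q r + djet z p u' q' r.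
Proof.
rewrite /djet -[(a *: u + u').1.2]/(a *: u.1.2 + u'.1.2) -[(a *: u + u').2]/(a *: u.2 + u'.2).
have -> : r *m (a *: u.1.2 + u'.1.2)^T = a *: (r *m u.1.2^T) + r *m u'.1.2^T.
  by rewrite linearP mulmxDr -scalemxAr.
rewrite sym_partPl dtorsionPl connectionP dscalarPl scalar_partP.
move: (sym_part _ _) (sym_part _ _) (dtorsion _ _ _) (dtorsion _ _ _) => s1 s2 d1 d2.
move: (connection _ _ _) (connection _ _ _) (connection _ _ _) => c1 c2 c3.
rewrite -[RHS]/(a *: 0 + 0, a *: (_ + _) + (_ + _), a *: (_ + _) + (_ + _)).
rewrite scaler0 addr0; congr (_, _, _); last by rewrite scalerDr addrACA.
rewrite mulmxDr -scalemxAr scalerDr [RHS]addrACA; congr (_ + _).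
by rewrite scalemxAl -mulmxDl !scalerDr; congr (_ *m _); rewrite [RHS]addrACA; congr (_ + _); rewrite addrACA.
Qed.

Lemma djetPr (z : TM) p u q (a : R) (r r' : 'rV[R]_3) :
  djet z p u q (a *: r + r') = a *: djet z p u q r + djet z p u q r'.
Proof.
rewrite /djet !mulmx_linear_l sym_partPr dtorsionP !connectionP dscalarPr scalar_partP.
move: (sym_part _ _) (sym_part _ _) (dtorsion _ _ _) (dtorsion _ _ _) => s1 s2 d1 d2.
move: (connection _ _ _) (connection _ _ _) (connection _ _ _) (connection _ _ _) => c1 c2 c3 c4.
rewrite -[RHS]/(a *: 0 + 0, a *: (_ + _) + (_ + _), a *: (_ + _) + (_ + _)).
rewrite scaler0 addr0; congr (_, _, _); last by rewrite scalerDr addrACA.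
rewrite !mulmxDl -!scalemxAl !scalerDr.
by rewrite [RHS]addrACA; congr (_ + _); rewrite [RHS]addrACA; congr (_ + _); rewrite addrACA.
Qed.

Lemma djet0 (z : TM) p q r : djet z p 0 q r = symbol_vec z.1.2 z.2 q (r *m z.1.2^T).
Proof.
have c0 : connection z.2 p 0 = 0.
  by have := connectionP z.2 p (-1) 0 0; rewrite scaler0 addr0 scaleN1r addNr.
have s0 : scalar_part z.2 p 0 = 0.
  by have := scalar_partP z.2 p (-1) 0 0; rewrite scaler0 addr0 scaleN1r addNr.
have d0 : dtorsion z.2 0 (r *m z.1.2^T) = 0.
  by have := dtorsionPl z.2 (-1) 0 0 (r *m z.1.2^T); rewrite scaler0 addr0 scaleN1r addNr.
rewrite /djet /symbol_vec /= trmx0 !mulmx0 c0 s0 d0 !addr0 //.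
Qed.

Lemma second_jet_linear (y : 'rV[R]_6) p : linear (second_jet y p).
Proof.
have eE k a (e e' : 'rV[R]_k) i : (a *: e + e') 0 i = a * e 0 i + e' 0 i by rewrite !mxE.
move=> a e e'; apply/rowP => n; rewrite eE /second_jet.
rewrite [LHS]mxE [X in _ = _ * X + _]mxE [X in _ = _ + X]mxE !eE.
by case: n => n /= _; do 24?[case: n => [|n]; first by rewrite /=; ring];
  rewrite /= ?nth_nil mulr0 addr0.
Qed.

End StructureEquations.

Lemma is_derive_of_line (R : realType) (V W : normedModType R) (f : V -> W) y v d :
  is_derive (0 : R^o) 1 (fun t : R^o => f (y + t *: v)) d -> is_derive y v f d.
Proof.
have e : y + (0 : R) *: v = y by rewrite scale0r addr0.
move=> [df <-]; apply: DeriveDef.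
  apply/derivable1P; have <- : (fun t : R^o => f (y + t *: v)) = fun t : R => f (t *: v + y).
    by apply: funext => t; rewrite addrC.
  exact: df.
by rewrite -[in LHS]e derive_along.
Qed.

Section CanonicalForms.
Variable R : realType.
Local Notation TM := (tilde_model R).
Local Notation Y := 'rV[R]_(3 + (3 * 3 + 6) + 24).

(* The difference between a tangent vector and its projection, along the
   fibre, to the integral element. *)
Definition vertical (y v : Y) : 'rV[R]_(3 * 3 + 6) :=
  flat (base v - jet (base y) (params y) (base v).1.1).

Definition contact_form (a : 'I_15) : lform Y 1 :=
  fun y v => vertical y (v ord0) 0 a.

Lemma flat_sub w w' : flat (w - w') = flat w - flat w' :> 'rV[R]_(3 * 3 + 6).
Proof. by rewrite -!(raddfB (lin_of (@flat_linear' R))). Qed.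

Lemma flat_add w w' a : flat (w + w') 0 a = flat w 0 a + flat w' 0 a :> R.
Proof. by rewrite -[w]scale1r flat_linear !scale1r mxE. Qed.

Lemma vertical_linear y : linear (vertical y).
Proof.
move=> a u v; rewrite /vertical base_linear -[(a *: base u + base v).1.1]/(a *: (base u).1.1 + (base v).1.1).
by rewrite jetP opprD addrACA -scalerBr flat_linear.
Qed.

Lemma base_vertical y v :
  base v = jet (base y) (params y) (base v).1.1 + unflat (vertical y v).
Proof.
by rewrite /vertical flatK ?addrA ?[_ + base v]addrC ?addrK //= subrr.
Qed.

Lemma is_derive_flat_jet z p u q r a :
  is_derive (0 : R^o) 1 (fun t : R^o => flat (jet (z + t *: u) (p + t *: q) r) 0 a : R^o)
    (flat (djet z p u q r) 0 a).
Proof.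
elim/flat_ind: a => [i j|k]; rewrite ?flat_frame ?flat_scalar.
  have -> : (fun t : R^o => flat (jet (z + t *: u) (p + t *: q) r)
      0 (lshift 6 (mxvec_index i j)) : R^o) =
    fun t => (jet (z + t *: u) (p + t *: q) r).1.2 i j.
    by apply: funext => t; rewrite flat_frame.
  exact: is_derive_jet_frame.
have -> : (fun t : R^o => flat (jet (z + t *: u) (p + t *: q) r)
    0 (rshift (3 * 3) k) : R^o) =
  fun t => (jet (z + t *: u) (p + t *: q) r).2 0 k.
  by apply: funext => t; rewrite flat_scalar.
exact: is_derive_jet_scalar.
Qed.

Lemma derive_flat_jet y v r a :
  is_derive y v (fun y => flat (jet (base y) (params y) r) 0 a : R^o)
    (flat (djet (base y) (params y) (base v) (params v) r) 0 a).
Proof.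
have bE t : base (y + t *: v) = base y + t *: base v by rewrite addrC base_linear addrC.
have pE t : params (y + t *: v) = params y + t *: params v.
  by rewrite addrC params_linear addrC.
apply: is_derive_of_line.
have -> : (fun t : R^o => flat (jet (base (y + t *: v)) (params (y + t *: v)) r) 0 a : R^o) =
  fun t => flat (jet (base y + t *: base v) (params y + t *: params v) r) 0 a.
  by apply: funext => t; rewrite bE pE.
exact: is_derive_flat_jet.
Qed.

Lemma derive_contact_form a y v w :
  'D_v (fun y => contact_form a y w : R^o) y =
  - flat (djet (base y) (params y) (base v) (params v) (base (w ord0)).1.1) 0 a.
Proof.
set r := (base (w ord0)).1.1.
have -> : (fun y => contact_form a y w : R^o) = (fun=> flat (base (w ord0)) 0 a) -
    (fun y => flat (jet (base y) (params y) r) 0 a : R^o).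
  apply: funext => y'; rewrite /contact_form /vertical flat_sub.
  by rewrite mxE [X in _ + X]mxE.
have := is_deriveB (is_derive_cst (flat (base (w ord0)) 0 a : R^o) y v) (derive_flat_jet y v r a).
by case=> _ ->; rewrite sub0r.
Qed.

Lemma dext_contact_form a y v : dext (contact_form a) y v =
  flat (djet (base y) (params y) (base (v ord_max)) (params (v ord_max))
    (base (v ord0)).1.1) 0 a -
  flat (djet (base y) (params y) (base (v ord0)) (params (v ord0))
    (base (v ord_max)).1.1) 0 a.
Proof.
rewrite /dext big_ord_recl big_ord1 expr0 mul1r expr1 mulN1r.
rewrite !derive_contact_form opprK addrC.
have -> : lift ord0 (ord0 : 'I_1) = ord_max :> 'I_2 by apply: val_inj.
by have -> : lift ord_max (ord0 : 'I_1) = ord0 :> 'I_2 by apply: val_inj.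
Qed.

(** The forms pi completing the coframe: dp corrected by [second_jet], which is the choice that
    absorbs the torsion. *)
Definition fibre_form (y v : Y) : 'rV[R]_24 :=
  params v - second_jet (base y).2 (params y) (coframe_at (base y) (base v)).

Lemma coframe_linear z : linear (coframe_at z : TM -> 'rV[R]_3).
Proof.
move=> a u v; rewrite /coframe_at -[(a *: u + v).1.1]/(a *: u.1.1 + v.1.1).
by rewrite mulmx_linear_l.
Qed.

Lemma fibre_form_linear y : linear (fibre_form y).
Proof.
move=> a u v; rewrite /fibre_form params_linear base_linear coframe_linear.
by rewrite second_jet_linear opprD addrACA scalerBr.
Qed.

Lemma entry_linear (U : lmodType R) n (f : U -> 'rV[R]_n) (i : 'I_n) :
  linear f -> linear (fun u => f u 0 i : R^o).
Proof. by move=> fP a u v; rewrite fP !mxE. Qed.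

(** Splits [v] into its projection to the integral element, lifted by [second_jet], a part measured
    by the contact forms and a part measured by [fibre_form]. In d theta they yield a symmetric
    term, the theta terms and the pi wedge omega terms. *)
Lemma djet_split y v r :
  djet (base y) (params y) (base v) (params v) r =
  djet (base y) (params y) (jet (base y) (params y) (base v).1.1)
    (second_jet (base y).2 (params y) (coframe_at (base y) (base v))) r +
  (djet (base y) (params y) (unflat (vertical y v)) 0 r +
   symbol_vec (base y).1.2 (base y).2 (fibre_form y v) (r *m (base y).1.2^T)).
Proof.
rewrite -(djet0 _ (params y)).
have A u q u' q' : djet (base y) (params y) (u + u') (q + q') r =
    djet (base y) (params y) u q r + djet (base y) (params y) u' q' r.
  by rewrite -[u]scale1r -[q]scale1r djetPl !scale1r.
by rewrite -A -A add0r addr0 -base_vertical addrC subrK.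
Qed.

(** Its entries are the forms beta which multiply theta^b in [contact_structure]. *)
Definition base_variation (y : Y) b (v : Y) : 'rV[R]_(3 * 3 + 6) :=
  flat (djet (base y) (params y) (unflat (delta_mx 0 b)) 0 (base v).1.1).

Lemma base_variation_linear y b : linear (base_variation y b).
Proof.
move=> a u v; rewrite /base_variation base_linear.
by rewrite -[(a *: base u + base v).1.1]/(a *: (base u).1.1 + (base v).1.1) djetPr flat_linear.
Qed.

Lemma flat_djet_unflat (y : Y) (t : 'rV[R]_(3 * 3 + 6)) (r : 'rV[R]_3) a :
  flat (djet (base y) (params y) (unflat t) 0 r) 0 a =
  \sum_b t 0 b * flat (djet (base y) (params y) (unflat (delta_mx 0 b)) 0 r) 0 a.
Proof.
have L : linear (fun t => @flat R (djet (base y) (params y) (unflat t) 0 r)).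
  move=> c t1 t2; rewrite unflat_linear -{1}[0 : 'rV[R]_24](addr0 0).
  by rewrite -{1}[0 : 'rV[R]_24](scaler0 _ c) djetPl flat_linear.
exact: (linear_row t (entry_linear a L)).
Qed.

Lemma flat_symbol_vec (f : 'M[R]_3) (y : 'rV[R]_6) q e a :
  - flat (symbol_vec f y q e) 0 a =
  \sum_n \sum_i symbol f y (delta_mx 0 n) a i * (q 0 n * e 0 i).
Proof.
have L q0 : linear (fun e => symbol_vec f y q0 e).
  by move=> c e1 e2; rewrite symbol_vecPr.
have L' e0 : linear (fun q => symbol_vec f y q e0).
  by move=> c e1 e2; rewrite symbol_vecPl.
have Lf (U : lmodType R) (g : U -> TM) : linear g -> linear (fun u => - @flat R (g u)).
  by move=> gP c u v; rewrite gP (@flat_linear R) opprD scalerN.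
have := linear_row q (entry_linear a (Lf _ _ (L' e))).
have E u : (fun q0 => (- flat (symbol_vec f y q0 e)) 0 a : R^o) u = - flat (symbol_vec f y u e) 0 a.
  by rewrite mxE.
rewrite {1}E => ->; apply: eq_bigr => n _.
have := linear_row e (entry_linear a (Lf _ _ (L (delta_mx 0 n)))) => /= ->.
rewrite mulr_sumr; apply: eq_bigr => i _.
by rewrite [symbol _ _ _ _ _]mxE [(- flat _) 0 a]mxE; ring.
Qed.

Section AtPoint.
Variables (omega : 'I_3 -> lform Y 1) (y : Y).
Hypothesis omegaE : forall i v, covec (omega i) y v = coframe_at (base y) (base v) 0 i.
Hypothesis uf : (base y).1.2 \in unitmx.
Local Notation f := (base y).1.2.

Let pi (e : 'I_24) : {linear Y -> R^o} := lin_of (entry_linear e (fibre_form_linear y)).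
Let beta a b : {linear Y -> R^o} := lin_of (entry_linear a (base_variation_linear y b)).

Lemma contact_coframe : coframe contact_form omega y pi.
Proof.
have uft : f^T \in unitmx by rewrite unitmx_tr.
pose back (w : 'rV[R]_15 * 'rV[R]_3 * 'rV[R]_24) : Y :=
  let z := jet (base y) (params y) (w.1.2 *m invmx f^T) + unflat w.1.1 in
  assemble z (w.2 + second_jet (base y).2 (params y) (coframe_at (base y) z)).
exists back => [v|[[t o] q]].
  have -> : \row_a covec (contact_form a) y v = vertical y v.
    by apply/rowP => a; rewrite mxE.
  have -> : \row_i covec (omega i) y v = coframe_at (base y) (base v).
    by apply/rowP => i; rewrite mxE omegaE.
  have -> : \row_e pi e v = fibre_form y v by apply/rowP => e; rewrite mxE.
  rewrite /back /= /coframe_at mulmxK // -base_vertical.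
  by rewrite subrK assemble_base.
rewrite /back /=; set z := jet _ _ _ + _; set v := assemble _ _.
have bv : base v = z by rewrite base_assemble.
have zx : z.1.1 = o *m invmx f^T by rewrite /= addr0.
congr (_, _, _); apply/rowP => k; rewrite mxE.
- by rewrite /covec /contact_form /vertical bv zx addrC addKr unflatK.
- by rewrite omegaE bv /coframe_at zx mulmxKV.
by rewrite /pi /= /fibre_form bv params_assemble addrK.
Qed.

(** After [djet_split] the lifted parts of the two vectors cancel by [djet_sym]; the other parts are
    exactly the beta wedge theta and pi wedge omega terms, so no torsion remains. *)
Lemma contact_structure : structure_equations contact_form omega y pi
  (fun a e i => symbol f (base y).2 (delta_mx 0 e) a i) (fun _ _ _ => 0).
Proof.
move=> a; exists (beta a) => v; rewrite dext_contact_form !djet_split.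
set v0 := v ord0; set v1 := v ord_max.
have S := djet_sym (base y) (params y) (base v0).1.1 (base v1).1.1.
rewrite !flat_add -[second_jet _ _ (coframe_at (base y) (base v1))]/(second_jet (base y).2
  (params y) ((base v1).1.1 *m f^T)) -S {S}.
rewrite -[(base v0).1.1 *m f^T]/(coframe_at (base y) (base v0)).
rewrite -[(base v1).1.1 *m f^T]/(coframe_at (base y) (base v1)).
have F := flat_symbol_vec f (base y).2 _ _ a.
have [F0 F1] := (F (fibre_form y v0) (coframe_at (base y) (base v1)),
  F (fibre_form y v1) (coframe_at (base y) (base v0))).
have U0 := flat_djet_unflat y (vertical y v0) (base v1).1.1 a.
have U1 := flat_djet_unflat y (vertical y v1) (base v0).1.1 a.
have cancel (s u p u' p' : R) : s + (u + p) - (s + (u' + p')) = (- p' - - p) + (u - u').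
  by ring.
rewrite cancel F0 F1 {cancel F F0 F1}.
rewrite [X in _ + X = _](congr2 (fun s t : R => s - t) U1 U0) {U0 U1}.
rewrite [X in _ = _ + X + _]big1 => [|i _]; last first.
  by apply: big1 => j _; rewrite mul0r.
rewrite addr0 -!sumrB; congr (_ + _).
  apply: eq_bigr => n _; rewrite -sumrB; apply: eq_bigr => i _.
  by rewrite /wedge11 !omegaE -mulrBr.
apply: eq_bigr => b _; rewrite /wedge11 /= /base_variation /covec /contact_form -/v0 -/v1.
by rewrite [in RHS]mulrC; congr (_ - _); rewrite mulrC.
Qed.

End AtPoint.
End CanonicalForms.

(** * Involutivity of the contact system *)

Section Involutivity.
Variable R : realType.
Local Notation TM := (tilde_model R).
Local Notation Y := 'rV[R]_(3 + (3 * 3 + 6) + 24).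

Lemma mem_span_matrices m n r (F : 'I_r -> 'M[R]_(m, n)) P :
  P \in <<[seq F e | e : 'I_r]>>%VS <-> exists c : 'I_r -> R, P = \sum_e c e *: F e.
Proof.
have -> : <<[seq F e | e : 'I_r]>>%VS = (\sum_e <[F e]>)%VS.
  by rewrite span_def big_map big_enum.
split=> [/memv_sumP[vs vsF ->]|[c ->]].
  have [c cE] := choice (fun e => vlineP _ _ (vsF e isT)).
  by exists c; apply: eq_bigr => e _; rewrite cE.
by apply: memv_sumr => e _; rewrite memvZ ?memv_line.
Qed.

Lemma flat0 a : flat (0 : TM) 0 a = 0.
Proof. by have := flat_add (0 : TM) 0 a; rewrite addr0 => /esym/eqP; rewrite -subr_eq0 addrK => /eqP. Qed.

Lemma jet0 z (p : 'rV[R]_24) : jet z p 0 = 0.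
Proof.
by have := jetP z p (-1) 0 0; rewrite scaler0 addr0 scaleN1r addNr.
Qed.

Section AtPoint.
Variables (omega : 'I_3 -> lform Y 1) (y : Y).
Hypothesis omegaE : forall i v, covec (omega i) y v = coframe_at (base y) (base v) 0 i.
Hypothesis uf : (base y).1.2 \in unitmx.
Local Notation f := (base y).1.2.

Lemma base_eq0 v : (forall a, covec (@contact_form R a) y v = 0) ->
  (forall i, covec (omega i) y v = 0) -> base v = 0.
Proof.
move=> t0 o0; have x0 : (base v).1.1 = 0.
  have uft : f^T \in unitmx by rewrite unitmx_tr.
  rewrite -[LHS](mulmxK uft) -[_ *m f^T]/(coframe_at (base y) (base v)).
  have -> : coframe_at (base y) (base v) = 0.
    by apply/rowP => i; rewrite -omegaE o0 mxE.
  by rewrite mul0mx.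
rewrite (base_vertical y v) x0 jet0 add0r.
have -> : vertical y v = 0 by apply/rowP => a; rewrite [LHS]t0 mxE.
have := unflat_linear (-1 : R) 0 0; rewrite scaler0 addr0 scaleN1r addNr.
by move=> ->.
Qed.

Lemma dext_symbol a i (v : 'I_2 -> Y) : base (v ord0) = 0 ->
  coframe_at (base y) (base (v ord_max)) = delta_mx 0 i ->
  dext (@contact_form R a) y v = symbol f (base y).2 (params (v ord0)) a i.
Proof.
move=> u0 wi; have x0 : (base (v ord0)).1.1 = 0 by rewrite u0.
rewrite dext_contact_form x0 u0.
have djet00 z p q : djet (base y) p z q 0 = 0.
  by have := djetPr (base y) p z q (-1) 0 0; rewrite scaler0 addr0 scaleN1r addNr.
rewrite djet00 flat0 sub0r djet0 -[_ *m _]/(coframe_at (base y) (base (v ord_max))) wi.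
by rewrite [RHS]mxE.
Qed.

(** The coframe and the coefficients [A], [tau] are arbitrary here. Evaluating d theta on a vector
    along the fibre, where theta and omega vanish, and on a vector dual to omega^i isolates the
    coefficients of pi wedge omega^i; hence the span is always the image of [symbol]. *)
Lemma tableau_symbol X : is_tableau (@contact_form R) omega y X ->
  forall P, P \in X <-> exists q, P = symbol f (base y).2 q.
Proof.
move=> [r [pi [A [tau [[back _ backK] st ->]]]]].
have backE t o q : let v := back (t, o, q) in
    [/\ forall a, covec (@contact_form R a) y v = t 0 a,
        forall i, covec (omega i) y v = o 0 i & forall e, pi e v = q 0 e].
  have [e1 e2 e3] := backK (t, o, q).
  split=> k; [have := congr1 (fun A : 'rV[R]__ => A 0 k) e1
    |have := congr1 (fun A : 'rV[R]__ => A 0 k) e2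
    |have := congr1 (fun A : 'rV[R]__ => A 0 k) e3]; by rewrite mxE.
have key u : base u = 0 -> symbol f (base y).2 (params u) =
    \sum_e pi e u *: (\matrix_(a, i) A a e i).
  move=> u0; apply/matrixP => a i; rewrite summxE.
  have ut b : covec (@contact_form R b) y u = 0.
    by rewrite /covec /contact_form /vertical u0 jet0 subrr flat0.
  have uo j : covec (omega j) y u = 0.
    by rewrite omegaE u0 /coframe_at mul0mx mxE.
  (* Dual to omega^i in the given coframe: theta and pi vanish on it. *)
  pose w := back (0, delta_mx 0 i, 0).
  have [wt wo wp] := backE 0 (delta_mx 0 i) 0.
  have wi : coframe_at (base y) (base w) = delta_mx 0 i.
    by apply/rowP => j; rewrite -omegaE wo.
  pose v (j : 'I_2) := if (j : nat) is 0 then u else w.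
  rewrite -(@dext_symbol a i v u0 wi); have [beta ->] := st a.
  rewrite [X in _ + X]big1 ?addr0 => [|b _]; last first.
    by rewrite /wedge11 /= ut wt mxE !mulr0 subrr.
  rewrite [X in _ + X]big1 ?addr0 => [|j _]; last first.
    by apply: big1 => k _; rewrite /wedge11 /= !uo mul0r mulr0 subrr mulr0.
  apply: eq_bigr => e _; rewrite !mxE (bigD1 i) //= big1 => [|j ji].
    by rewrite /wedge11 /= wo wp !mxE !eqxx mulr1 mul0r subr0 addr0 mulrC.
  by rewrite /wedge11 /= wo uo !mxE (negPf ji) andbF !mulr0 subrr mulr0.
move=> P; rewrite mem_span_matrices; split=> [[c ->]|[q ->]].
  have [ut uo up] := backE 0 0 (\row_e c e).
  have u0 := base_eq0 (fun a => etrans (ut a) (mxE _ _ _ _)) (fun i => etrans (uo i) (mxE _ _ _ _)).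
  exists (params (back (0, 0, \row_e c e))); rewrite (key _ u0).
  by apply: eq_bigr => e _; rewrite up mxE.
exists (fun e => pi e (assemble 0 q)).
by rewrite -key ?params_assemble // base_assemble.
Qed.

End AtPoint.

Theorem contact_involutive (O : set Y) (omega : 'I_3 -> lform Y 1) :
  (forall y, O y -> (base y).1.2 \in unitmx) ->
  (forall y i v, covec (omega i) y v = coframe_at (base y) (base v) 0 i) ->
  involutive_pfaffian O (@contact_form R) omega /\
  depend_on_functions O (@contact_form R) omega 3 3.
Proof.
move=> Ou oE; split; [split|]; first split.
- move=> y Oy t u H.
  have [back _ backK] := contact_coframe (oE y) (Ou y Oy).
  split=> [a|i].
    have [e1 e2 _] := backK (delta_mx 0 a, 0, 0).
    have := H (back (delta_mx 0 a, 0, 0)).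
    rewrite (bigD1 a) //= !big1 => [||b ba]; last first.
    + have := congr1 (fun A : 'rV[R]_15 => A 0 b) e1; rewrite mxE => ->.
      by rewrite mxE (negPf ba) andbF mulr0.
    + move=> i _; have := congr1 (fun A : 'rV[R]_3 => A 0 i) e2; rewrite mxE => ->.
      by rewrite mxE mulr0.
    have := congr1 (fun A : 'rV[R]_15 => A 0 a) e1; rewrite mxE => ->.
    by rewrite mxE !eqxx mulr1 !addr0.
  have [e1 e2 _] := backK (0, delta_mx 0 i, 0).
  have := H (back (0, delta_mx 0 i, 0)).
  rewrite [X in _ + X](bigD1 i) //= !big1 => [||b _]; last first.
  + have := congr1 (fun A : 'rV[R]_15 => A 0 b) e1; rewrite mxE => ->.
    by rewrite mxE mulr0.
  + move=> j ji; have := congr1 (fun A : 'rV[R]_3 => A 0 j) e2; rewrite mxE => ->.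
    by rewrite mxE (negPf ji) andbF mulr0.
  have := congr1 (fun A : 'rV[R]_3 => A 0 i) e2; rewrite mxE => ->.
  by rewrite mxE !eqxx mulr1 addr0 add0r.
(* With zero torsion, the terms in pi and omega can be grouped as gamma_i wedge omega^i. *)
- move=> y Oy a; have [beta E] := contact_structure (oE y) a.
  pose pi (e : 'I_24) v := fibre_form y v 0 e.
  have gl i : linear (fun v => \sum_e symbol (base y).1.2 (base y).2 (delta_mx 0 e) a i *
      fibre_form y v 0 e : R^o).
    move=> c u v; rewrite fibre_form_linear scaler_sumr -big_split; apply: eq_bigr => e _.
    move: (symbol _ _ _ _ _) (fibre_form _ _) (fibre_form _ _) => s p p'.
    by rewrite !mxE /GRing.scale /=; ring.
  exists beta, (fun i => lin_of (gl i)) => v; rewrite E.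
  rewrite [X in _ + X + _]big1 ?addr0 => [|i _]; last by apply: big1 => j _; rewrite mul0r.
  rewrite addrC; congr (_ + _); rewrite exchange_big; apply: eq_bigr => i _.
  rewrite /wedge11 /= !mulr_suml -sumrB; apply: eq_bigr => e _.
  by rewrite mulrBr !mulrA.
- move=> y Oy; split.
    eexists; eexists; eexists; split; first exact: (contact_coframe (oE y) (Ou y Oy)).
    exact: (contact_structure (oE y)).
  by move=> X /(tableau_symbol (oE y) (Ou y Oy)) XP; exact: (involutive_symbol (Ou y Oy) XP).
by move=> y Oy X /(tableau_symbol (oE y) (Ou y Oy)) XP; exact: (last_character_symbol (Ou y Oy) XP).
Qed.

End Involutivity.

(** * The frame bundle *)

Section MatrixCalculus.
Variables (R : realType) (V : normedModType R).

Lemma differentiable_mx m n (f : V -> 'M[R]_(m, n)) x :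
  (forall i j, differentiable (fun y => f y i j : R^o) x) -> differentiable f x.
Proof.
move=> df; have -> : f = \sum_(ij : 'I_m * 'I_n)
    (fun y => (f y ij.1 ij.2 : R^o) *: (delta_mx ij.1 ij.2 : 'M[R]_(m, n))).
  apply: funext => y; rewrite fct_sumE {1}[f y]matrix_sum_delta pair_bigA.
  by apply: eq_bigr => -[].
elim/big_ind: _ => [|g h dg dh|ij _]; first exact: differentiable_cst.
  exact: differentiableD.
by apply: differentiable_scaled; [exact: df|exact: differentiable_cst].
Qed.

Lemma differentiable_entry m n (f : V -> 'M[R]_(m, n)) x i j :
  differentiable f x -> differentiable (fun y => f y i j : R^o) x.
Proof.
by move=> df; exact: (differentiable_comp df (differentiable_coord _ i j)).
Qed.

Lemma mulmx_entryE m n k (f : V -> 'M[R]_(m, n)) (g : V -> 'M[R]_(n, k)) i j :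
  (fun y => (f y *m g y) i j : R^o) =
  \sum_l (fun y => (f y i l : R^o) *: (g y l j : R^o)).
Proof. by apply: funext => y; rewrite fct_sumE mxE. Qed.

Lemma differentiable_mulmx m n k (f : V -> 'M[R]_(m, n)) (g : V -> 'M[R]_(n, k)) x :
  differentiable f x -> differentiable g x -> differentiable (fun y => f y *m g y) x.
Proof.
move=> df dg; apply: differentiable_mx => i j; rewrite mulmx_entryE.
apply: differentiable_sum => l.
by apply: differentiable_scaled; exact: differentiable_entry.
Qed.

Lemma derive_mulmx m n k (f : V -> 'M[R]_(m, n)) (g : V -> 'M[R]_(n, k)) x v :
  differentiable f x -> differentiable g x ->
  'D_v (fun y => f y *m g y) x = 'D_v f x *m g x + f x *m 'D_v g x.
Proof.
move=> df dg; apply/matrixP => i j.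
rewrite derive_coord; last exact/diff_derivable/differentiable_mulmx.
have dfe l := differentiable_entry i l df; have dge l := differentiable_entry l j dg.
have -> : 'D_v (fun y => (f y *m g y) i j) x =
    'D_v (\sum_l (fun y => (f y i l : R^o) *: (g y l j : R^o))) x.
  by rewrite -mulmx_entryE.
rewrite derive_sum => [|l]; last exact/diff_derivable/differentiable_scaled.
rewrite !mxE -big_split; apply: eq_bigr => l _.
rewrite derive_scaled // addrC; congr (_ + _).
  by rewrite derive_coord //; exact: diff_derivable.
by rewrite derive_coord //; exact: diff_derivable.
Qed.

Lemma differentiable_trmx m n (f : V -> 'M[R]_(m, n)) x :
  differentiable f x -> differentiable (fun y => (f y)^T) x.
Proof.
move=> df; apply: differentiable_mx => i j.
have -> : (fun y => (f y)^T i j : R^o) = fun y => f y j i by apply: funext => y; rewrite mxE.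
exact: differentiable_entry.
Qed.

Lemma derive_trmx m n (f : V -> 'M[R]_(m, n)) x v :
  differentiable f x -> 'D_v (fun y => (f y)^T) x = ('D_v f x)^T.
Proof.
move=> df; apply/matrixP => i j; rewrite derive_coord; last exact/diff_derivable/differentiable_trmx.
rewrite [RHS]mxE derive_coord; last exact: diff_derivable.
by congr ('D_v _ x); apply: funext => y; rewrite mxE.
Qed.

End MatrixCalculus.

Section Jacobian.
Variables (R : realType) (n m : nat) (phi : 'rV[R]_n -> 'rV[R]_m) (U : set 'rV[R]_n).
Hypothesis oU : open U.
Hypothesis sphi : smooth_on U phi.

Lemma mul_jacobian x v : U x -> v *m jacobian phi x = 'D_v phi x.
Proof. by move=> Ux; rewrite deriveEjacobian //; exact: (sphi [::]). Qed.

Lemma differentiable_jacobian x : U x -> differentiable (jacobian phi) x.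
Proof.
move=> Ux; apply: differentiable_mx => i j.
apply: (@differentiable_eq_near _ _ _ (fun y => 'D_(delta_mx 0 i) phi y 0 j : R^o)).
  apply: filterS (open_near oU Ux) => y Uy.
  by rewrite -mul_jacobian // -rowE mxE.
exact: (differentiable_entry _ _ (sphi [:: delta_mx 0 i] Ux)).
Qed.

Lemma derive_jacobian x v w : U x ->
  w *m 'D_v (jacobian phi) x = 'D_v (fun y => 'D_w phi y) x.
Proof.
move=> Ux; have dJ := differentiable_jacobian Ux.
have dw : differentiable (fun _ : 'rV[R]_n => w) x by exact: differentiable_cst.
have := derive_mulmx v dw dJ; rewrite derive_cst mul0mx add0r => <-.
by apply: derive_eq_near; apply: filterS (open_near oU Ux) => y Uy; rewrite mul_jacobian.
Qed.

(** Symmetry of second derivatives in matrix form; the Jacobian acts on row vectors from the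
    right. *)
Lemma derive_jacobian_sym x v w : U x ->
  w *m 'D_v (jacobian phi) x = v *m 'D_w (jacobian phi) x.
Proof.
move=> Ux; apply: etrans (derive_jacobian v w Ux) _.
exact: etrans (derive_sym _ _ oU sphi Ux) (esym (derive_jacobian w v Ux)).
Qed.

End Jacobian.

Section Frames.
Variables (R : realType) (S : charted 'rV[R]_3).
Hypothesis HS : analytic_manifold S.
Implicit Types (c : chart S) (u : S).

Let HA := analytic_differentiable_atlas HS.

Definition jac c c' (x : 'rV[R]_3) : 'M[R]_3 := jacobian (transition c c') x.

Lemma smooth_transition c c' : smooth_on (overlap c c') (transition c c').
Proof. by case: HS => _ _ /(_ c c')[_ []]. Qed.

Lemma open_overlap c c' : open (overlap c c').
Proof. by case: HA => _ /(_ c c'). Qed.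

Lemma mul_jac c c' x v : v *m jac c c' x = 'd (transition c c') x v.
Proof. by rewrite /jac mul_rV_lin1. Qed.

Lemma mul_jacK c c' u : dom c u -> dom c' u ->
  jac c c' (coord c u) *m jac c' c (coord c' u) = 1%:M.
Proof.
move=> cu c'u; apply/row_matrixP => i; rewrite row_mul !rowE mulmx1.
rewrite !mul_jac (transition_comp HA) //; exact: transition_id.
Qed.

Lemma tangent_jac c c' u v : tangent u v -> dom c u -> dom c' u ->
  v c' = v c *m jac c c' (coord c u).
Proof. by case=> _ vt cu c'u; rewrite mul_jac; apply: vt. Qed.

(** [frame_mx] is chosen by [xget], so a matrix representing [f] has to be exhibited: its columns
    are the values of [f] on lifts of the standard basis. *)
Lemma frame_mxP c u f v : is_frame u f -> dom c u -> tangent u v ->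
  f v = v c *m (frame_mx c u f)^T.
Proof.
move=> [_ fD _] cu tv.
have [e eP] : {e : 'I_3 -> tvec S & forall i, tangent u (e i) /\ e i c = delta_mx 0 i}.
  apply: (@choice _ _ (fun i w => tangent u w /\ w c = delta_mx 0 i)) => i.
  by have [w tw wc] := tangent_lift HA (delta_mx 0 i) cu; exists w.
have te i : tangent u (e i) by case: (eP i).
have ec i : e i c = delta_mx 0 i by case: (eP i).
have t0 : tangent u (0 : tvec S).
  by have := tangentD (-1) tv tv; rewrite scaleN1r addNr.
have f0 : f 0 = 0.
  by have := fD (-1) 0 0 t0 t0; rewrite scaler0 addr0 scaleN1r addNr.
pose A : 'M[R]_3 := \matrix_(j, i) f (e i) 0 j.
have AP w : tangent u w -> f w = w c *m A^T.
  move=> tw; have {1}-> : w = w c 0 i30 *: e i30 + (w c 0 i31 *: e i31 +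
      (w c 0 i32 *: e i32 + 0)).
    apply: (tangent_inj cu) => //; first by do 3![apply: tangentD => //].
    rewrite -[RHS]/(w c 0 i30 *: e i30 c + (w c 0 i31 *: e i31 c +
      (w c 0 i32 *: e i32 c + 0))) !ec.
    by rewrite {1}[w c]row_sum_delta sum3 addr0 addrA.
  rewrite !fD //; try by do ?[apply: tangentD => //].
  rewrite f0 addr0.
  by apply/rowP => j; rewrite !mxE sum3 !mxE addrA.
rewrite /frame_mx; case: (@xgetP _ 0 [set B : 'M[R]_3 | forall v, tangent u v -> f v = v c *m B^T])
  => [B -> /(_ v tv) //|/(_ A)]; by case.
Qed.

Lemma frame_mx_unique c u f (A : 'M[R]_3) : is_frame u f -> dom c u ->
  (forall v, tangent u v -> f v = v c *m A^T) -> frame_mx c u f = A.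
Proof.
move=> fr cu AP; apply: trmx_inj; apply/row_matrixP => i; rewrite !rowE.
have [e te ec] := tangent_lift HA (delta_mx 0 i : 'rV[R]_3) cu.
by rewrite -ec -(frame_mxP fr cu te) AP.
Qed.

Lemma frame_mx_unit c u f : is_frame u f -> dom c u -> frame_mx c u f \in unitmx.
Proof.
move=> fr cu; have [_ _ [_ _ surj]] := fr.
have [e eP] : {e : 'I_3 -> tvec S & forall i, tangent u (e i) /\ f (e i) = delta_mx 0 i}.
  apply: (@choice _ _ (fun i w => tangent u w /\ f w = delta_mx 0 i)) => i.
  by have [w tw wf] := surj (delta_mx 0 i) I; exists w.
rewrite -unitmx_tr; set A := _^T.
suff /mulmx1_unit[] : (\matrix_i e i c) *m A = 1%:M by [].
apply/row_matrixP => i; rewrite row_mul rowK row1.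
by case: (eP i) => te <-; rewrite (frame_mxP fr cu te).
Qed.

Lemma frame_exists c u (A : 'M[R]_3) : A \in unitmx -> dom c u ->
  exists2 f, is_frame u f & frame_mx c u f = A.
Proof.
move=> uA cu; have uAt : A^T \in unitmx by rewrite unitmx_tr.
pose f (v : tvec S) : 'rV[R]_3 := if pselect (tangent u v) is left _ then v c *m A^T else 0.
have fE v : tangent u v -> f v = v c *m A^T by rewrite /f; case: pselect.
have fr : is_frame u f.
  split=> [v ntv|a v w tv tw|].
  - by rewrite /f; case: pselect.
  - rewrite !fE //; last exact: tangentD.
    by rewrite -[(a *: v + w) c]/(a *: v c + w c) mulmxDl scalemxAl.
  split=> // [v w|x _].
    rewrite !inE => tv tw; rewrite !fE // => e; apply: (tangent_inj cu) => //.
    by rewrite -[LHS](mulmxK uAt) e mulmxK.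
  have [v tv vc] := tangent_lift HA (x *m invmx A^T) cu.
  by exists v => //; rewrite fE // vc mulmxKV.
by exists f => //; exact: frame_mx_unique.
Qed.

Lemma frame_mx_change c c' u f : is_frame u f -> dom c u -> dom c' u ->
  frame_mx c' u f = frame_mx c u f *m (jac c' c (coord c' u))^T.
Proof.
move=> fr cu c'u; apply: frame_mx_unique => // v tv.
by rewrite trmx_mul trmxK mulmxA -tangent_jac // -frame_mxP.
Qed.

End Frames.

Section Coordinates.
Variable R : realType.
Local Notation TM := (tilde_model R).

Lemma poly_map_eq (V W : normedModType R) (f g : V -> W) : f =1 g -> poly_map f -> poly_map g.
Proof. by move=> /funext ->. Qed.

Lemma poly_map_differentiable (V W : normedModType R) (f : V -> W) x :
  poly_map f -> differentiable f x.
Proof. by move=> [sf _]; apply: (sf [::]). Qed.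

Lemma poly_map_continuous (V W : normedModType R) (f : V -> W) : poly_map f -> continuous f.
Proof. by move=> pf x; apply/differentiable_continuous/poly_map_differentiable. Qed.

Lemma poly_map_entry m n i j : poly_map (fun A : 'M[R]_(m, n) => A i j : R^o).
Proof.
have L : linear (fun A : 'M[R]_(m, n) => A i j : R^o) by move=> a A B; rewrite !mxE.
by apply: (poly_map_linear (f := lin_of L)) => A; apply: coord_continuous.
Qed.

(** A linear map on row vectors is a polynomial in the entries, which also yields its continuity. *)
Lemma poly_map_of_row n (W : normedModType R) (f : 'rV[R]_n -> W) :
  linear f -> poly_map f.
Proof.
move=> fP; apply: (@poly_map_eq _ _ (fun v : 'rV[R]_n => \sum_i (v 0 i : R^o) *: f (delta_mx 0 i))).
  move=> v; rewrite {2}[v]row_sum_delta -[RHS]/(lin_of fP _) linear_sum.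
  by apply: eq_bigr => i _; rewrite linearZ.
apply: poly_map_sum => i _; apply: poly_map_scaled; last exact: poly_map_cst.
exact: poly_map_entry.
Qed.

Lemma poly_map_mul (V : normedModType R) (f g : V -> R^o) :
  poly_map f -> poly_map g -> poly_map (fun x => f x * g x : R^o).
Proof. exact: poly_map_scaled. Qed.

Lemma poly_map_prod (V : normedModType R) (I : Type) (r : seq I) (f : I -> V -> R^o) :
  (forall i, poly_map (f i)) -> poly_map (fun x => \prod_(i <- r) f i x : R^o).
Proof.
move=> pf; elim: r => [|i r IH].
  by apply: poly_map_eq (poly_map_cst V (1 : R^o)) => x; rewrite big_nil.
apply: poly_map_eq (poly_map_mul (pf i) IH) => x; by rewrite big_cons.
Qed.

Lemma poly_map_mx (V : normedModType R) m n (f : V -> 'M[R]_(m, n)) :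
  (forall i j, poly_map (fun x => f x i j : R^o)) -> poly_map f.
Proof.
move=> pf; apply: (@poly_map_eq _ _ (fun x => \sum_i \sum_j
    (f x i j : R^o) *: (delta_mx i j : 'M[R]_(m, n)))).
  by move=> x; rewrite -matrix_sum_delta.
apply: poly_map_sum => i _; apply: poly_map_sum => j _.
by apply: poly_map_scaled => //; exact: poly_map_cst.
Qed.

Lemma poly_map_det (V : normedModType R) n (f : V -> 'M[R]_n) :
  (forall i j, poly_map (fun x => f x i j : R^o)) -> poly_map (fun x => \det (f x) : R^o).
Proof.
move=> pf; apply: poly_map_sum => s _; apply: poly_map_mul; first exact: poly_map_cst.
exact: poly_map_prod.
Qed.

Lemma open_unitmx (V : normedModType R) n (f : V -> 'M[R]_n) :
  (forall i j, poly_map (fun x => f x i j : R^o)) -> open [set x | f x \in unitmx].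
Proof.
move=> pf; have -> : [set x | f x \in unitmx] = (fun x => \det (f x) : R^o) @^-1` [set r | r != 0].
  by apply: funext => x; apply: propext; rewrite /= unitmxE unitfE.
apply: open_comp => [x _|]; last exact: open_neq.
exact: (poly_map_continuous (poly_map_det pf)).
Qed.

Lemma continuous_pos : continuous (fun z : TM => z.1.1).
Proof. by move=> z; apply: cvg_comp; exact: cvg_fst. Qed.

Lemma continuous_frame : continuous (fun z : TM => z.1.2).
Proof. by move=> z; apply: cvg_comp; [exact: cvg_fst|exact: cvg_snd]. Qed.

Lemma continuous_scalars : continuous (fun z : TM => z.2).
Proof. by move=> z; exact: cvg_snd. Qed.

Lemma poly_map_pos : poly_map (fun z : TM => z.1.1).
Proof.
have L : linear (fun z : TM => z.1.1) by [].
exact: (poly_map_linear (f := lin_of L) continuous_pos).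
Qed.

Lemma poly_map_frame : poly_map (fun z : TM => z.1.2).
Proof.
have L : linear (fun z : TM => z.1.2) by [].
exact: (poly_map_linear (f := lin_of L) continuous_frame).
Qed.

Lemma poly_map_scalars : poly_map (fun z : TM => z.2).
Proof.
have L : linear (fun z : TM => z.2) by [].
exact: (poly_map_linear (f := lin_of L) continuous_scalars).
Qed.

Lemma poly_map_entry_comp (V : normedModType R) m n (f : {linear V -> 'M[R]_(m, n)}) i j :
  continuous f -> poly_map (fun z => f z i j : R^o).
Proof.
move=> cf; have L : linear (fun z => f z i j : R^o) by move=> a A B; rewrite linearP !mxE.
apply: (poly_map_linear (f := lin_of L)) => z.
exact: (@continuous_comp _ _ _ f (fun A : 'M[R]_(m, n) => A i j) z (cf z)
  (@coord_continuous _ _ _ i j (f z))).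
Qed.

Lemma poly_map_frame_entry i j : poly_map (fun z : TM => z.1.2 i j : R^o).
Proof.
have L : linear (fun z : TM => z.1.2) by [].
exact: (poly_map_entry_comp (f := lin_of L) _ _ continuous_frame).
Qed.

Lemma poly_map_scalar_entry k : poly_map (fun z : TM => z.2 0 k : R^o).
Proof.
have L : linear (fun z : TM => z.2) by [].
exact: (poly_map_entry_comp (f := lin_of L) _ _ continuous_scalars).
Qed.

Lemma linear_diff (V W : normedModType R) (f : V -> W) z v :
  linear f -> continuous f -> 'd f z v = f v.
Proof. by move=> L cf; have -> := diff_lin z (f := lin_of L) cf. Qed.

End Coordinates.

(** * Changes of chart on the total space *)

Section SigmaTilde.
Variables (R : realType) (S : charted 'rV[R]_3).
Hypothesis HS : analytic_manifold S.
Local Notation TM := (tilde_model R).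
Local Notation St := (Sigma_tilde S).
Implicit Types (c : chart S) (p : St) (z : TM).

Let HA := analytic_differentiable_atlas HS.

Definition pos p : S := (sval p.1).1.

Lemma domE c p : @dom _ _ St c p = dom c (pos p). Proof. by []. Qed.

Lemma coordE c p : @Defs.coord _ _ St c p =
  ((coord c (pos p), frame_mx c (pos p) (sval p.1).2), p.2) :> TM.
Proof. by []. Qed.

Lemma frame_of p : is_frame (pos p) (sval p.1).2.
Proof. exact: (svalP p.1). Qed.

(* Under a change of chart, the matrix of a frame is multiplied by the inverse
   Jacobian; the latter is written as the Jacobian of the inverse change. *)
Definition inverse_jac c c' (x : 'rV[R]_3) : 'M[R]_3 :=
  jac c' c (transition c c' x).

(** An explicit formula on the whole model space; it agrees with the transition on overlaps, and
    differentials of the transition are computed from it. *)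
Definition change c c' z : TM :=
  ((transition c c' z.1.1, z.1.2 *m (inverse_jac c c' z.1.1)^T), z.2).

Lemma coord_change c c' p : @dom _ _ St c p -> @dom _ _ St c' p ->
  @Defs.coord _ _ St c' p = change c c' (@Defs.coord _ _ St c p).
Proof.
move=> cp c'p; rewrite !coordE /change /inverse_jac /= (transitionE HA) //.
by rewrite (frame_mx_change HS (frame_of p) cp c'p).
Qed.

Lemma coord_unit c p : @dom _ _ St c p -> (@Defs.coord _ _ St c p).1.2 \in unitmx.
Proof. by move=> cp; exact: (frame_mx_unit HS (frame_of p) cp). Qed.

Lemma coord_surj c u (A : 'M[R]_3) y : dom c u -> A \in unitmx ->
  exists p, [/\ @dom _ _ St c p, pos p = u & @Defs.coord _ _ St c p = ((coord c u, A), y)].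
Proof.
move=> cu uA; have [f fr <-] := frame_exists HS uA cu.
by exists (exist _ (u, f) fr, y).
Qed.

Lemma tilde_inj c p q : @dom _ _ St c p -> @dom _ _ St c q ->
  @Defs.coord _ _ St c p = @Defs.coord _ _ St c q -> p = q.
Proof.
move=> cp cq; rewrite !coordE => -[e1 e2 e3].
have eu : pos p = pos q by case: HA => inj _ _; exact: (inj c).
case: p q cp cq e1 e2 e3 eu => [[[u f] fu] y] [[[u' f'] fu'] y'].
rewrite /pos /= => cp cq _ e2 -> eu; subst u'; congr (_, _).
have ef : f = f'.
  apply: funext => v; have [tv|ntv] := pselect (tangent u v).
    have /= h := frame_mxP HS fu cp tv; have /= h' := frame_mxP HS fu' cq tv.
    by rewrite h h' e2.
  by case: (fu) => /= -> // _ _; case: (fu') => /= -> //.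
by subst f'; congr exist; exact: Prop_irrelevance.
Qed.

(** The fibre coordinate ranges over all of GL(3): every invertible matrix is realized by a frame,
    through [coord_surj]. *)
Lemma tilde_overlapE c c' z : @overlap _ _ St c c' z <->
  overlap c c' z.1.1 /\ z.1.2 \in unitmx.
Proof.
split=> [[p [cp c'p] <-]|[[u [cu c'u] ux] uz]].
  by split; [exists (pos p)|exact: coord_unit].
have [p [cp pu pE]] := coord_surj z.2 cu uz.
exists p; first by split=> //; rewrite domE pu.
by rewrite pE ux; case: z {ux uz pE} => [[]].
Qed.

Lemma tilde_codomE c z : @codom_chart _ _ St c z <->
  codom_chart c z.1.1 /\ z.1.2 \in unitmx.
Proof.
split=> [[p cp <-]|[[u cu ux] uz]].
  by split; [exists (pos p)|exact: coord_unit].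
have [p [cp pu pE]] := coord_surj z.2 cu uz.
by exists p => //; rewrite pE ux; case: z {ux uz pE} => [[]].
Qed.

Lemma codom_overlap c : codom_chart c = overlap c c.
Proof. by rewrite /codom_chart /overlap setIid. Qed.

Lemma open_frames (A : set 'rV[R]_3) : open A ->
  open [set z : TM | A z.1.1 /\ z.1.2 \in unitmx].
Proof.
move=> oA; apply: openI.
  by apply: open_comp => // z _; exact: continuous_pos.
by apply: open_unitmx => i j; exact: poly_map_frame_entry.
Qed.

Lemma open_tilde_overlap c c' : open (@overlap _ _ St c c').
Proof.
have -> : @overlap _ _ St c c' = [set z : TM | overlap c c' z.1.1 /\ z.1.2 \in unitmx].
  by apply: funext => z; apply: propext; exact: tilde_overlapE.
exact/open_frames/(open_overlap HS).
Qed.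

Lemma open_tilde_codom c : open (@codom_chart _ _ St c).
Proof.
have -> : @codom_chart _ _ St c = [set z : TM | codom_chart c z.1.1 /\ z.1.2 \in unitmx].
  by apply: funext => z; apply: propext; exact: tilde_codomE.
by apply: open_frames; rewrite codom_overlap; exact: open_overlap.
Qed.

Lemma transition_mem c c' x : overlap c c' x -> overlap c' c (transition c c' x).
Proof. by move=> [u [cu c'u] <-]; rewrite (transitionE HA) //; exists u. Qed.

Lemma differentiable_inverse_jac c c' x : overlap c c' x ->
  differentiable (inverse_jac c c') x.
Proof.
move=> ox; have dJ : differentiable (jac c' c) (transition c c' x).
  exact: (differentiable_jacobian (@open_overlap _ _ HS c' c)
    (@smooth_transition _ _ HS c' c) (transition_mem ox)).
exact: (differentiable_comp (smooth_transition HS [::] ox) dJ).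
Qed.

Lemma jac_inverse_jac c c' x : overlap c c' x -> jac c c' x *m inverse_jac c c' x = 1%:M.
Proof.
by move=> [u [cu c'u] <-]; rewrite /inverse_jac (transitionE HA) // mul_jacK.
Qed.

Lemma diff_posE z v : 'd (fun z : TM => z.1.1) z v = v.1.1.
Proof. by apply: linear_diff => //; exact: continuous_pos. Qed.

Lemma diff_frameE z v : 'd (fun z : TM => z.1.2) z v = v.1.2.
Proof. by apply: linear_diff => //; exact: continuous_frame. Qed.

Lemma diff_scalarsE z v : 'd (fun z : TM => z.2) z v = v.2.
Proof. by apply: linear_diff => //; exact: continuous_scalars. Qed.

(** [K] plays the inverse Jacobian, [D] its derivative and [X] that of [J]; differentiating J K = 1
    gives the second hypothesis. The term in [X] is the non-tensorial one, which cancels in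
    [dcoframe_change]. *)
Lemma coframe_product_change (a : 'rV[R]_3) (b F J K D X : 'M[R]_3) :
  J *m K = 1%:M -> J *m D = - (X *m K) ->
  a *m J *m (b *m K^T + F *m D^T)^T = a *m b^T - a *m X *m K *m F^T.
Proof.
move=> JK JD; have -> : (b *m K^T + F *m D^T)^T = K *m b^T + D *m F^T.
  by rewrite linearD /= !trmx_mul !trmxK.
rewrite mulmxDr; congr (_ + _).
  by rewrite mulmxA -[a *m J *m K]mulmxA JK mulmx1.
by rewrite mulmxA -[a *m J *m D]mulmxA JD mulmxN mulNmx [a *m (X *m K)]mulmxA.
Qed.

Section AtPoint.
Variables (c c' : chart S) (z : TM).
Hypothesis oz : overlap c c' z.1.1.

Let dpos : differentiable (fun z : TM => z.1.1) z :=
  poly_map_differentiable z (@poly_map_pos R).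
Let dframe : differentiable (fun z : TM => z.1.2) z :=
  poly_map_differentiable z (@poly_map_frame R).
Let dscalars : differentiable (fun z : TM => z.2) z :=
  poly_map_differentiable z (@poly_map_scalars R).

Let dtrans : differentiable (fun z : TM => transition c c' z.1.1) z.
Proof. exact: (differentiable_comp dpos (smooth_transition HS [::] oz)). Qed.

Let dinv : differentiable (fun z : TM => inverse_jac c c' z.1.1) z.
Proof. exact: (differentiable_comp dpos (differentiable_inverse_jac oz)). Qed.

Let dnew : differentiable (fun z : TM => z.1.2 *m (inverse_jac c c' z.1.1)^T) z.
Proof. exact: (differentiable_mulmx dframe (differentiable_trmx dinv)). Qed.

Lemma differentiable_change : differentiable (change c c') z.
Proof. exact: (differentiable_pair (differentiable_pair dtrans dnew) dscalars). Qed.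

Lemma diff_change v : 'd (change c c') z v =
  ((v.1.1 *m jac c c' z.1.1, v.1.2 *m (inverse_jac c c' z.1.1)^T +
    z.1.2 *m ('D_(v.1.1) (inverse_jac c c') z.1.1)^T), v.2).
Proof.
rewrite (diff_pair (differentiable_pair dtrans dnew) dscalars) /=.
rewrite (diff_pair dtrans dnew) diff_scalarsE; congr (_, _, _).
  have := diff_comp dpos (smooth_transition HS [::] oz).
  by move=> /(congr1 (@^~ v)) /= ->; rewrite mul_jac diff_posE.
rewrite -deriveE // (derive_mulmx v dframe (differentiable_trmx dinv)).
rewrite deriveE // diff_frameE (derive_trmx _ dinv) deriveE //.
congr (_ + _ *m _^T); have := diff_comp dpos (differentiable_inverse_jac oz).
move=> /(congr1 (@^~ v)) /= ->; rewrite diff_posE deriveE //.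
exact: differentiable_inverse_jac.
Qed.

(** The Jacobian acting on dx cancels against its inverse acting on the frame, as eta is
    tautological. *)
Lemma coframe_change v : coframe_at (change c c' z) ('d (change c c') z v) = coframe_at z v.
Proof.
rewrite diff_change /coframe_at /= trmx_mul trmxK !mulmxA; congr (_ *m _).
by rewrite -mulmxA jac_inverse_jac ?mulmx1.
Qed.

(* The derivative of the inverse Jacobian is expressed by the second
   derivatives of the change of coordinates, which are symmetric. *)
Lemma dcoframe_change v w :
  dcoframe ('d (change c c') z v) ('d (change c c') z w) = dcoframe v w.
Proof.
pose J := jac c c' z.1.1; pose K := inverse_jac c c' z.1.1.
have JK : J *m K = 1%:M by exact: jac_inverse_jac.
have oU := @open_overlap _ _ HS c c'.
have dJ : differentiable (jac c c') z.1.1.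
  exact: (differentiable_jacobian oU (smooth_transition HS (c := c) (c' := c')) oz).
have DK u : J *m 'D_u (inverse_jac c c') z.1.1 = - ('D_u (jac c c') z.1.1 *m K).
  apply/eqP; rewrite -addr_eq0 addrC.
  rewrite -(derive_mulmx u dJ (differentiable_inverse_jac oz)).
  rewrite -(@derive_cst _ _ _ (1%:M : 'M[R]_3) z.1.1 u); apply/eqP.
  by apply: derive_eq_near; apply: filterS (open_near oU oz) => x ox; rewrite jac_inverse_jac.
have E (a b : TM) : a.1.1 *m J *m (b.1.2 *m K^T + z.1.2 *m ('D_(b.1.1) (inverse_jac c c') z.1.1)^T)^T =
   a.1.1 *m b.1.2^T - a.1.1 *m 'D_(b.1.1) (jac c c') z.1.1 *m K *m z.1.2^T :> 'rV[R]_3.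
  exact: coframe_product_change JK (DK _).
rewrite (diff_change v) (diff_change w).
apply: etrans (_ : _ = (w.1.1 *m v.1.2^T - w.1.1 *m 'D_(v.1.1) (jac c c') z.1.1 *m K *m z.1.2^T) -
  (v.1.1 *m w.1.2^T - v.1.1 *m 'D_(w.1.1) (jac c c') z.1.1 *m K *m z.1.2^T)) _.
  by congr (_ - _); [exact: (E w v)|exact: (E v w)].
have -> : w.1.1 *m 'D_(v.1.1) (jac c c') z.1.1 = v.1.1 *m 'D_(w.1.1) (jac c c') z.1.1.
  exact: (derive_jacobian_sym oU (@smooth_transition _ _ HS c c') _ _ oz).
rewrite /dcoframe; move: (_ *m K *m _) => X.
by rewrite opprB addrA subrK.
Qed.

(** The equations see the vectors only through eta, d eta and the scalar components, each of which
    is invariant. *)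
Lemma integral_pair_change v w : integral_pair z v w ->
  integral_pair (change c c' z) ('d (change c c') z v) ('d (change c c') z w).
Proof.
by rewrite /integral_pair !coframe_change dcoframe_change !diff_change.
Qed.

End AtPoint.

Lemma tilde_transition_near c c' z : @overlap _ _ St c c' z ->
  @transition _ _ St c c' z = change c c' z.
Proof.
move=> [p [cp c'p] <-]; rewrite /transition.
case: (@xgetP _ 0 [set @Defs.coord _ _ St c' q | q in
    [set q | [/\ @dom _ _ St c q, @dom _ _ St c' q &
      @Defs.coord _ _ St c q = @Defs.coord _ _ St c p]]]) => [x -> [q [cq c'q]] e <-|H].
  by rewrite -e; exact: coord_change.
by case: (H (@Defs.coord _ _ St c' p)); exists p.
Qed.

Lemma differentiable_tilde_atlas : differentiable_atlas St.
Proof.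
split; [exact: tilde_inj|exact: open_tilde_overlap|move=> c c' z oz].
apply: (@differentiable_eq_near _ _ _ (change c c')).
  apply: filterS (open_near (@open_tilde_overlap c c') oz) => y oy.
  by rewrite tilde_transition_near.
by case/tilde_overlapE: oz => oz _; exact: differentiable_change.
Qed.

Lemma diff_tilde_transition c c' z v : @overlap _ _ St c c' z ->
  'd (@transition _ _ St c c') z v = 'd (change c c') z v.
Proof.
move=> oz; have [_ _ dt] := differentiable_tilde_atlas.
have dc : differentiable (change c c') z by case/tilde_overlapE: oz => ? _; exact: differentiable_change.
apply: etrans (esym (deriveE v (dt c c' z oz))) _; apply: etrans _ (deriveE v dc).
apply: derive_eq_near; apply: filterS (open_near (@open_tilde_overlap c c') oz) => y oy.
exact: tilde_transition_near.
Qed.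

Lemma tangent_change c c' p v : @dom _ _ St c p -> @dom _ _ St c' p -> tangent p v ->
  v c' = 'd (change c c') (@Defs.coord _ _ St c p) (v c).
Proof.
move=> cp c'p [_ tv].
apply: (etrans (tv c c' cp c'p) (diff_tilde_transition _ _)).
by exists p.
Qed.

Lemma overlap_pos c c' p : @dom _ _ St c p -> @dom _ _ St c' p ->
  overlap c c' (@Defs.coord _ _ St c p).1.1.
Proof. by move=> cp c'p; exists (pos p). Qed.

Lemma integral_pair_tangent c c' p v w : @dom _ _ St c p -> @dom _ _ St c' p ->
  tangent p v -> tangent p w ->
  integral_pair (@Defs.coord _ _ St c p) (v c) (w c) ->
  integral_pair (@Defs.coord _ _ St c' p) (v c') (w c').
Proof.
move=> cp c'p tv tw H; rewrite (tangent_change cp c'p tv) (tangent_change cp c'p tw).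
rewrite (coord_change cp c'p); exact: integral_pair_change (overlap_pos cp c'p) _ _ H.
Qed.

Lemma coframe_tangent c c' p v : @dom _ _ St c p -> @dom _ _ St c' p -> tangent p v ->
  coframe_at (@Defs.coord _ _ St c' p) (v c') = coframe_at (@Defs.coord _ _ St c p) (v c).
Proof.
move=> cp c'p tv; rewrite (tangent_change cp c'p tv) (coord_change cp c'p).
exact: coframe_change (overlap_pos cp c'p) _.
Qed.

End SigmaTilde.

(** * The differential ideal *)

Section FormsOfDegreeTwo.
Variables (R : realType) (V : normedModType R).

Lemma multilinear_alt1 (f : V -> R) :
  (forall a u u', f (a *: u + u') = a * f u + f u') ->
  multilinear_alt (fun v : 'I_1 -> V => f (v ord0)).
Proof.
move=> fP; split=> [i a u u' v|v i j]; first by rewrite [i]ord1 eqxx.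
by rewrite [i]ord1 [j]ord1 eqxx.
Qed.

Lemma form1E (a : lform V 1) z v : a z v = covec a z (v ord0).
Proof. by congr (a z _); apply: funext => i; rewrite [i]ord1. Qed.

Lemma lift_ord0 (v : 'I_2 -> V) : (fun j : 'I_1 => v (lift ord0 j)) = fun=> v ord_max.
Proof. by apply: funext => j; congr v; apply: val_inj; rewrite [j]ord1. Qed.

Lemma lift_ord_max (v : 'I_2 -> V) : (fun j : 'I_1 => v (lift ord_max j)) = fun=> v ord0.
Proof. by apply: funext => j; congr v; apply: val_inj; rewrite [j]ord1. Qed.

Lemma wedge2E (a b : lform V 1) z v : wedge a b z v =
  covec a z (v ord0) * covec b z (v ord_max) - covec a z (v ord_max) * covec b z (v ord0).
Proof.
rewrite /wedge big_ord_recl big_ord1.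
have -> : lift ord0 ord0 = ord_max :> 'I_2 by apply: val_inj.
by rewrite lift_ord0 lift_ord_max /= expr0 expr1 mul1r mulN1r mulNr.
Qed.

Lemma dext2E (a : lform V 1) z v : dext a z v =
  'D_(v ord0) (fun y => covec a y (v ord_max) : R^o) z -
  'D_(v ord_max) (fun y => covec a y (v ord0) : R^o) z.
Proof.
rewrite /dext big_ord_recl big_ord1.
have -> : lift ord0 ord0 = ord_max :> 'I_2 by apply: val_inj.
by rewrite lift_ord0 lift_ord_max /= expr0 expr1 mul1r mulN1r.
Qed.

Lemma dfunE (f : V -> R) z v : dfun f z v = 'D_(v ord0) (f : V -> R^o) z.
Proof. by rewrite /dfun /dext big_ord1 expr0 mul1r. Qed.

Lemma is_derive_lin (f : V -> R^o) z w : linear f -> continuous f -> is_derive z w f (f w).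
Proof.
move=> L cf; have df : differentiable f z by exact: (poly_map_differentiable z (poly_map_linear (f := lin_of L) cf)).
by apply: DeriveDef; [exact: diff_derivable|rewrite deriveE // linear_diff].
Qed.

Lemma is_derive_mul (f g : V -> R^o) z w (f' g' : R^o) : is_derive z w f f' ->
  is_derive z w g g' -> is_derive z w (fun y => f y * g y : R^o) (f z * g' + g z * f').
Proof. exact: is_deriveM. Qed.

End FormsOfDegreeTwo.

Section Generators.
Variable R : realType.
Local Notation TM := (tilde_model R).
Implicit Types (z u w : TM) (i : 'I_3) (v : 'I_2 -> TM).

Lemma etaE i z (v : 'I_1 -> TM) : eta i z v = coframe_at z (v ord0) 0 i.
Proof. by rewrite /eta /coframe_at mxE; apply: eq_bigr => j _; rewrite mxE mulrC. Qed.

Lemma covec_eta i z u : covec (eta i) z u = coframe_at z u 0 i.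
Proof. exact: etaE. Qed.

Lemma coframe_entryPr i z : linear (fun u => coframe_at z u 0 i : R^o).
Proof. by move=> a u u'; rewrite /coframe_at mulmxDl -scalemxAl !mxE. Qed.

Lemma coframe_entryPl i u : linear (fun z => coframe_at z u 0 i : R^o).
Proof. by move=> a z z'; rewrite /coframe_at [_^T]linearP mulmxDr -scalemxAr !mxE. Qed.

Lemma poly_map_coframe i u : poly_map (fun z => coframe_at z u 0 i : R^o).
Proof.
apply: (@poly_map_eq _ _ _ (fun z => \sum_j (z.1.2 i j : R^o) *: (u.1.1 0 j : R^o))).
  by move=> z; rewrite mxE; apply: eq_bigr => j _; rewrite mxE mulrC.
apply: poly_map_sum => j _; apply: poly_map_scaled; last exact: poly_map_cst.
exact: poly_map_frame_entry.
Qed.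

Lemma is_derive_coframe i z u w :
  is_derive z w (fun y => coframe_at y u 0 i : R^o) (coframe_at w u 0 i).
Proof.
exact: (is_derive_lin _ _ (coframe_entryPl i u) (poly_map_continuous (poly_map_coframe i u))).
Qed.

Lemma scalar_entryP k : linear (fun z : TM => z.2 0 k : R^o).
Proof. by move=> a z z'; rewrite !mxE. Qed.

Lemma is_derive_scalar_entry k z w : is_derive z w (fun y : TM => y.2 0 k : R^o) (w.2 0 k).
Proof.
exact: (is_derive_lin _ _ (scalar_entryP k) (poly_map_continuous (poly_map_scalar_entry R k))).
Qed.

Lemma dcoframeE i u (v : TM) : dcoframe u v 0 i = coframe_at u v 0 i - coframe_at v u 0 i.
Proof. by rewrite /dcoframe /coframe_at [LHS]mxE [X in _ + X]mxE. Qed.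

Lemma dext_eta i z v : dext (eta i) z v = dcoframe (v ord0) (v ord_max) 0 i.
Proof.
have D u w : 'D_w (fun y => covec (eta i) y u : R^o) z = coframe_at w u 0 i.
  have -> : (fun y => covec (eta i) y u : R^o) = (fun y => coframe_at y u 0 i : R^o).
    by apply: funext => y; rewrite covec_eta.
  by have [_ E] := is_derive_coframe i z u w.
by rewrite dext2E !D dcoframeE.
Qed.

Lemma covec_dfun_scalar k z u :
  covec (dfun (fun y : TM => y.2 0 k)) z u = u.2 0 k.
Proof. by rewrite /covec dfunE; have [_ ->] := is_derive_scalar_entry k z u. Qed.

Lemma theta1E z u : covec (@theta1 R) z u = y0 u.2 -
  y2 z.2 * coframe_at z u 0 i30 - y3 z.2 * coframe_at z u 0 i32.
Proof.
rewrite -[LHS]/(covec (dfun (@cI R)) z u - cI1 z * covec (@eta1 R) z u - cI3 z * covec (@eta3 R) z u).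
by rewrite !covec_eta (covec_dfun_scalar _ z).
Qed.

Lemma theta2E z u : covec (@theta2 R) z u = y1 u.2 -
  y4 z.2 * coframe_at z u 0 i30 - y5 z.2 * coframe_at z u 0 i31 +
  y1 z.2 * y0 z.2 * coframe_at z u 0 i32.
Proof.
rewrite -[LHS]/(covec (dfun (@cK R)) z u - cK1 z * covec (@eta1 R) z u -
  cK2 z * covec (@eta2 R) z u + cK z * cI z * covec (@eta3 R) z u).
by rewrite !covec_eta (covec_dfun_scalar _ z).
Qed.

(** The sign matches [integral_pair], which records - d theta^1 = dI_1 wedge eta^1 + I_1 d eta^1 +
    dI_3 wedge eta^3 + I_3 d eta^3. *)
Lemma dext_theta1 z v : let u := v ord0 in let w := v ord_max in
  - dext (@theta1 R) z v = y2 u.2 * coframe_at z w 0 i30 - y2 w.2 * coframe_at z u 0 i30 +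
    y2 z.2 * dcoframe u w 0 i30 + (y3 u.2 * coframe_at z w 0 i32 - y3 w.2 * coframe_at z u 0 i32) +
    y3 z.2 * dcoframe u w 0 i32.
Proof.
have D u w : 'D_w (fun y => covec (@theta1 R) y u : R^o) z =
    - (y2 z.2 * coframe_at w u 0 i30 + coframe_at z u 0 i30 * y2 w.2) -
    (y3 z.2 * coframe_at w u 0 i32 + coframe_at z u 0 i32 * y3 w.2).
  have -> : (fun y => covec (@theta1 R) y u : R^o) = (fun y => (y0 u.2 -
    y2 y.2 * coframe_at y u 0 i30 - y3 y.2 * coframe_at y u 0 i32) : R^o).
    by apply: funext => y; rewrite theta1E.
  have d2 := is_derive_mul (is_derive_scalar_entry (@i6 2 isT) z w) (is_derive_coframe i30 z u w).
  have d3 := is_derive_mul (is_derive_scalar_entry (@i6 3 isT) z w) (is_derive_coframe i32 z u w).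
  have [_ E] := is_deriveB (is_deriveB (is_derive_cst (y0 u.2 : R^o) z w) d2) d3.
  by apply: etrans E _; rewrite sub0r.
by rewrite /= dext2E !D !dcoframeE; ring.
Qed.

Lemma dext_theta2 z v : let u := v ord0 in let w := v ord_max in
  - dext (@theta2 R) z v = y4 u.2 * coframe_at z w 0 i30 - y4 w.2 * coframe_at z u 0 i30 +
    y4 z.2 * dcoframe u w 0 i30 + (y5 u.2 * coframe_at z w 0 i31 - y5 w.2 * coframe_at z u 0 i31) +
    y5 z.2 * dcoframe u w 0 i31 -
    ((y1 u.2 * y0 z.2 + y1 z.2 * y0 u.2) * coframe_at z w 0 i32 -
     (y1 w.2 * y0 z.2 + y1 z.2 * y0 w.2) * coframe_at z u 0 i32) -
    y1 z.2 * y0 z.2 * dcoframe u w 0 i32.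
Proof.
have D u w : 'D_w (fun y => covec (@theta2 R) y u : R^o) z =
    - (y4 z.2 * coframe_at w u 0 i30 + coframe_at z u 0 i30 * y4 w.2) -
    (y5 z.2 * coframe_at w u 0 i31 + coframe_at z u 0 i31 * y5 w.2) +
    (y1 z.2 * y0 z.2 * coframe_at w u 0 i32 +
     coframe_at z u 0 i32 * (y1 z.2 * y0 w.2 + y0 z.2 * y1 w.2)).
  have -> : (fun y => covec (@theta2 R) y u : R^o) = (fun y => (y1 u.2 -
    y4 y.2 * coframe_at y u 0 i30 - y5 y.2 * coframe_at y u 0 i31 +
    y1 y.2 * y0 y.2 * coframe_at y u 0 i32) : R^o).
    by apply: funext => y; rewrite theta2E.
  have d4 := is_derive_mul (is_derive_scalar_entry (@i6 4 isT) z w) (is_derive_coframe i30 z u w).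
  have d5 := is_derive_mul (is_derive_scalar_entry (@i6 5 isT) z w) (is_derive_coframe i31 z u w).
  have d10 := is_derive_mul (is_derive_mul (is_derive_scalar_entry (@i6 1 isT) z w)
    (is_derive_scalar_entry (@i6 0 isT) z w)) (is_derive_coframe i32 z u w).
  have [_ E] := is_deriveD (is_deriveB (is_deriveB (is_derive_cst (y1 u.2 : R^o) z w) d4) d5) d10.
  by apply: etrans E _; rewrite sub0r.
by rewrite /= dext2E !D !dcoframeE; ring.
Qed.

Definition pair_of (u v : TM) : 'I_2 -> TM := fun j => if j == ord0 then u else v.

Lemma Theta1E z v : let u := v ord0 in let w := v ord_max in
  Theta1 z v = dcoframe u w 0 i30 +
    y0 z.2 * (coframe_at z u 0 i30 * coframe_at z w 0 i32 - coframe_at z w 0 i30 * coframe_at z u 0 i32) -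
    (coframe_at z u 0 i31 * coframe_at z w 0 i32 - coframe_at z w 0 i31 * coframe_at z u 0 i32).
Proof.
move=> u w; rewrite -[LHS]/(dext (@eta1 R) z v + cI z * wedge (@eta1 R) (@eta3 R) z v - wedge (@eta2 R) (@eta3 R) z v).
by rewrite !wedge2E dext_eta !covec_eta.
Qed.

Lemma Theta2E z v : let u := v ord0 in let w := v ord_max in
  Theta2 z v = dcoframe u w 0 i31 +
    (coframe_at z u 0 i30 * coframe_at z w 0 i32 - coframe_at z w 0 i30 * coframe_at z u 0 i32).
Proof.
move=> u w; rewrite -[LHS]/(dext (@eta2 R) z v + wedge (@eta1 R) (@eta3 R) z v).
by rewrite !wedge2E dext_eta !covec_eta.
Qed.

Lemma Theta3E z v : let u := v ord0 in let w := v ord_max in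
  Theta3 z v = dcoframe u w 0 i32 -
    y1 z.2 * (coframe_at z u 0 i30 * coframe_at z w 0 i31 - coframe_at z w 0 i30 * coframe_at z u 0 i31).
Proof.
move=> u w; rewrite -[LHS]/(dext (@eta3 R) z v - cK z * wedge (@eta1 R) (@eta2 R) z v).
by rewrite !wedge2E dext_eta !covec_eta.
Qed.

Lemma integral_pairP z u (v : TM) : integral_pair z u v <->
  [/\ [/\ Theta1 z (pair_of u v) = 0, Theta2 z (pair_of u v) = 0 & Theta3 z (pair_of u v) = 0],
      covec (@theta1 R) z u = 0, covec (@theta2 R) z u = 0,
      dext (@theta1 R) z (pair_of u v) = 0 & dext (@theta2 R) z (pair_of u v) = 0].
Proof.
have N (a b : R) : - a = b -> (a = 0 <-> b = 0).
  by move=> <-; split=> [->|/eqP]; rewrite ?oppr0 // oppr_eq0 => /eqP.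
have [N1 N1'] := N _ _ (dext_theta1 z (pair_of u v)).
have [N2 N2'] := N _ _ (dext_theta2 z (pair_of u v)).
move: N1 N1' N2 N2'; rewrite Theta1E Theta2E Theta3E theta1E theta2E /integral_pair.
rewrite -[pair_of u v ord0]/u -[pair_of u v ord_max]/v; cbv zeta.
move: (coframe_at z u) (coframe_at z v) (dcoframe u v) => e e' d N1 N1' N2 N2'.
split=> -[[a1 a2 a3] a4 a5 a6 a7].
  split; [split| | |exact: N1'|exact: N2']; clear N1 N1' N2 N2' a6 a7; lra.
split; [split| | |exact: N1|exact: N2]; clear N1 N1' N2 N2' a6 a7; lra.
Qed.

End Generators.

Section IdealOnJets.
Variable R : realType.
Local Notation TM := (tilde_model R).

Lemma poly_map_smooth (V W : normedModType R) (U : set V) (f : V -> W) :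
  poly_map f -> smooth_on U f.
Proof. by move=> [sf _] vs x _; apply: sf. Qed.

Lemma smooth_alt_function (V : normedModType R) (U : set V) (f : V -> R) :
  smooth_on U (f : V -> R^o) -> smooth_alt U (fun x (_ : 'I_0 -> V) => f x).
Proof. by move=> sf; split=> // x _; split=> [[]|? []]. Qed.

Section Smoothness.
Variable U : set TM.
Hypothesis oU : open U.

Lemma smooth_alt_eta i : smooth_alt U (@Defs.eta R i).
Proof.
split=> [z _|v].
  have -> : @Defs.eta R i z = fun v => coframe_at z (v ord0) 0 i.
    by apply: funext => v; rewrite etaE.
  by apply: (@multilinear_alt1 _ _ (fun u => coframe_at z u 0 i)); exact: coframe_entryPr.
have -> : (fun z => Defs.eta i z v : R^o) = (fun z => coframe_at z (v ord0) 0 i : R^o).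
  by apply: funext => z; rewrite etaE.
exact/poly_map_smooth/poly_map_coframe.
Qed.

Lemma smooth_scalar k : smooth_on U (fun z : TM => z.2 0 k : R^o).
Proof. exact/poly_map_smooth/poly_map_scalar_entry. Qed.

Lemma smooth_alt_dscalar k : smooth_alt U (dfun (fun z : TM => z.2 0 k)).
Proof. exact/(smooth_alt_dext oU)/smooth_alt_function/smooth_scalar. Qed.

Lemma smooth_alt_Theta1 : smooth_alt U (@Theta1 R).
Proof.
apply: smooth_alt_sub => //; last exact: (smooth_alt_wedge oU (smooth_alt_eta _) (smooth_alt_eta _)).
apply: smooth_alt_add => //; first exact/(smooth_alt_dext oU)/smooth_alt_eta.
apply: (smooth_alt_fscale oU); first exact: smooth_scalar.
exact: (smooth_alt_wedge oU (smooth_alt_eta _) (smooth_alt_eta _)).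
Qed.

Lemma smooth_alt_Theta2 : smooth_alt U (@Theta2 R).
Proof.
apply: smooth_alt_add => //; first exact/(smooth_alt_dext oU)/smooth_alt_eta.
exact: (smooth_alt_wedge oU (smooth_alt_eta _) (smooth_alt_eta _)).
Qed.

Lemma smooth_alt_Theta3 : smooth_alt U (@Theta3 R).
Proof.
apply: smooth_alt_sub => //; first exact/(smooth_alt_dext oU)/smooth_alt_eta.
apply: (smooth_alt_fscale oU); first exact: smooth_scalar.
exact: (smooth_alt_wedge oU (smooth_alt_eta _) (smooth_alt_eta _)).
Qed.

Lemma smooth_alt_scaled_eta k i : smooth_alt U (fscale (fun z : TM => z.2 0 k) (@Defs.eta R i)).
Proof. exact: (smooth_alt_fscale oU (smooth_scalar _) (smooth_alt_eta _)). Qed.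

Lemma smooth_alt_theta1 : smooth_alt U (@theta1 R).
Proof.
do 2![apply: smooth_alt_sub => //; last exact: smooth_alt_scaled_eta].
exact: smooth_alt_dscalar.
Qed.

Lemma smooth_alt_theta2 : smooth_alt U (@theta2 R).
Proof.
apply: smooth_alt_add => //.
  do 2![apply: smooth_alt_sub => //; last exact: smooth_alt_scaled_eta].
  exact: smooth_alt_dscalar.
apply: (smooth_alt_fscale oU); last exact: smooth_alt_eta.
exact: (smooth_on_scaled oU (smooth_scalar _) (smooth_scalar _)).
Qed.

End Smoothness.

(** The expansion required by [dext_eq0]: a vector carrying the dx-components, constant along the
    motion, plus scalar coefficients on a fixed basis of the other directions. *)
Lemma split_flat (w : TM) :
  ((w.1.1, 0, 0) : TM) + \sum_a flat w 0 a *: unflat (delta_mx 0 a) = w.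
Proof.
have L := @unflat_linear R.
have <- : unflat (flat w) = \sum_a flat w 0 a *: unflat (delta_mx 0 a).
  rewrite {1}[flat w]row_sum_delta -[LHS]/(lin_of L _) linear_sum.
  by apply: eq_bigr => a _; rewrite linearZ.
case: w => [[x f] y]; rewrite /unflat /flat /= row_mxKl row_mxKr mxvecK.
by rewrite -[LHS]/(x + 0, 0 + f, 0 + y) addr0 !add0r.
Qed.

(** Along z + t v_i the parameters move as p + t q_i, with q_i given by [second_jet]. The moving
    vectors stay in planes of the family, so [w] vanishes on them, and [djet_sym] is the symmetry
    asked for by [dext_eq0]. *)
Lemma dext_jet_eq0 (U : set TM) k (w : lform TM k) z p (r : 'I_k.+1 -> 'rV[R]_3) :
  open U -> smooth_alt U w ->
  (forall z p (r : 'I_k -> 'rV[R]_3), U z -> w z (fun i => jet z p (r i)) = 0) ->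
  U z -> dext w z (fun i => jet z p (r i)) = 0.
Proof.
move=> oU sw w0 Uz.
pose v i := jet z p (r i).
pose q i := second_jet z.2 p (r i *m z.1.2^T).
apply: (@dext_eq0 _ _ U oU k w z v _ (fun a => unflat (delta_mx 0 a))
  (fun i j a t => flat (jet (z + t *: v i) (p + t *: q i) (r j)) 0 a)
  (fun i j a => flat (djet z p (v i) (q i) (r j)) 0 a)
  (fun i j => ((r j, 0, 0) : TM)) sw Uz).
- by move=> i j a; exact: is_derive_flat_jet.
- by move=> i j; rewrite !scale0r !addr0 (split_flat (jet z p (r j))).
- by move=> i j a; rewrite /v /q djet_sym.
move=> i; have nU : \forall t \near (0 : R^o), U (z + t *: v i).
  have dline : differentiable (fun t : R^o => z + t *: v i) 0.
    by apply: differentiableD => //; exact: differentiableZl.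
  have U0 : nbhs (z + (0 : R^o) *: v i) U by rewrite scale0r addr0; exact: (open_near oU Uz).
  by apply: (differentiable_continuous dline); exact: U0.
apply: filterS nU => t Ut; rewrite -[RHS](w0 _ (p + t *: q i) (fun j => r (lift i j)) Ut).
by congr (w _ _); apply: funext => j; exact: (split_flat (jet _ _ (r (lift i j)))).
Qed.

Variable S : charted 'rV[R]_3.
Hypothesis HS : analytic_manifold S.
Local Notation St := (Sigma_tilde S).

Lemma generators_jet k (w : mform St k) : @generators R S k w ->
  forall c U z p (r : 'I_k -> 'rV[R]_3), open U ->
    smooth_alt U (w c) /\ w c z (fun i => jet z p (r i)) = 0.
Proof.
move=> [] c U z p r oU; (split; [by [exact: smooth_alt_Theta1|exact: smooth_alt_Theta2|
  exact: smooth_alt_Theta3|exact: smooth_alt_theta1|exact: smooth_alt_theta2]|]).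
- have /integral_pairP[[H _ _] _ _ _ _] := jet_integral z p (r ord0) (r ord_max).
  by rewrite Theta1E -[RHS]H Theta1E.
- have /integral_pairP[[_ H _] _ _ _ _] := jet_integral z p (r ord0) (r ord_max).
  by rewrite Theta2E -[RHS]H Theta2E.
- have /integral_pairP[[_ _ H] _ _ _ _] := jet_integral z p (r ord0) (r ord_max).
  by rewrite Theta3E -[RHS]H Theta3E.
- have /integral_pairP[_ H _ _ _] := jet_integral z p (r ord0) 0.
  by rewrite form1E.
have /integral_pairP[_ _ H _ _] := jet_integral z p (r ord0) 0.
by rewrite form1E.
Qed.

Lemma I_tilde_jet k (w : mform St k) : @I_tilde R S k w -> forall c,
  smooth_alt (@codom_chart _ _ St c) (w c) /\
  forall z p (r : 'I_k -> 'rV[R]_3), @codom_chart _ _ St c z ->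
    w c z (fun i => jet z p (r i)) = 0.
Proof.
elim=> {k w} [k w gw|k w w' _ IH _ IH'|k f w [fa fs _] _ IH|k a w [aa as_ _] _ IH|k w _ IH] c;
  have oU := @open_tilde_codom _ _ HS c.
- split=> [|z p r _]; first by case: (generators_jet gw c 0 0 (fun=> 0) oU).
  by case: (generators_jet gw c z p r oU).
- have [sw w0] := IH c; have [sw' w0'] := IH' c.
  split=> [|z p r Uz]; first exact: smooth_alt_add.
  by rewrite -[LHS]/(w c z _ + w' c z _) w0 // w0' // addr0.
- have [sw w0] := IH c; split=> [|z p r Uz]; first exact: (smooth_alt_fscale oU (fs c _) sw).
  by rewrite /fscale w0 // mulr0.
- have [sw w0] := IH c; split=> [|z p r Uz].
    by apply: (smooth_alt_wedge oU _ sw); split; [exact: aa|exact: as_].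
  by apply: big1 => i _; rewrite (w0 z p (fun j => r (lift i j))) // mulr0.
have [sw w0] := IH c; split=> [|z p r Uz]; first exact: (smooth_alt_dext oU sw).
exact: dext_jet_eq0 oU sw w0 Uz.
Qed.

End IdealOnJets.

Section VolumeForm.
Variable R : realType.
Local Notation TM := (tilde_model R).

Lemma det2E (A : 'M[R]_2) :
  \det A = A ord0 ord0 * A ord_max ord_max - A ord_max ord0 * A ord0 ord_max.
Proof.
rewrite (expand_det_col _ ord0) big_ord_recl big_ord1 /cofactor !det_mx11 !mxE /=.
have e : lift ord0 ord0 = ord_max :> 'I_2 by apply: val_inj.
have e' : lift ord_max ord0 = ord0 :> 'I_2 by apply: val_inj.
by rewrite !e !e' /= expr0 expr1 mul1r mulN1r mulrN.
Qed.

(** [wedge] expands as the determinant does along its first column. Thus Omega is nonzero on a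
    3-plane exactly when eta restricts to an isomorphism of it. *)
Lemma OmegaE (S : charted 'rV[R]_3) c (z : TM) v :
  @Omega R S c z v = \det (\matrix_(m, i) coframe_at z (v m) 0 i).
Proof.
rewrite (expand_det_col _ ord0); apply: eq_bigr => i _.
rewrite /cofactor det2E [X in _ = X * _]mxE.
set u := v (lift i ord0); set w := v (lift i ord_max).
have E (a b : 'I_2) : (row' i (col' ord0 (\matrix_(m, j) coframe_at z (v m) 0 j))) a b =
    coframe_at z (v (lift i a)) 0 (lift ord0 b) by rewrite !mxE.
have e1 : lift ord0 (ord0 : 'I_2) = i31 by apply: val_inj.
have e2 : lift ord0 (ord_max : 'I_2) = i32 by apply: val_inj.
have e0 : ord0 = i30 by apply: val_inj.
rewrite !E e1 e2 e0 wedge2E !covec_eta addn0.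
by rewrite [RHS]mulrA [_ * (-1) ^+ i]mulrC.
Qed.

End VolumeForm.

(** * Integral elements of the whole differential ideal *)

Section IntegralElements.
Variables (R : realType) (S : charted 'rV[R]_3).
Hypothesis HS : analytic_manifold S.
Local Notation TM := (tilde_model R).
Local Notation St := (Sigma_tilde S).
Local Notation crd c p := (@Defs.coord _ _ St c p : TM).
Implicit Types (c : chart S) (p : St) (v : tvec St) (b : 'I_3 -> tvec St) (E : set (tvec St)).

Let HA := differentiable_tilde_atlas HS.

Definition adapted c p b := (forall m, tangent p (b m)) /\
  forall m, coframe_at (crd c p) (b m c) = delta_mx 0 m.

Definition expanded c p b v := v = \sum_m coframe_at (crd c p) (v c) 0 m *: b m.

Definition integral_basis c p b := adapted c p b /\
  forall m n, integral_pair (crd c p) (b m c) (b n c).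

Lemma tvec_sumE c (t : 'I_3 -> R) b : (\sum_m t m *: b m) c = \sum_m t m *: b m c.
Proof. by rewrite fct_sumE. Qed.

Lemma coframe_sum z (t : 'I_3 -> R) (u : 'I_3 -> TM) :
  coframe_at z (\sum_m t m *: u m) = \sum_m t m *: coframe_at z (u m).
Proof.
rewrite -[LHS]/(lin_of (coframe_linear z) _) linear_sum.
by apply: eq_bigr => m _; rewrite linearZ.
Qed.

Lemma jet_sum z q (t : 'I_3 -> R) (r : 'I_3 -> 'rV[R]_3) :
  jet z q (\sum_m t m *: r m) = \sum_m t m *: jet z q (r m).
Proof.
have L : linear (jet z q) by move=> a r0 r1; exact: jetP.
rewrite -[LHS]/(lin_of L _) linear_sum.
by apply: eq_bigr => m _; rewrite linearZ.
Qed.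

Lemma integral_basis_chart c c' p b : @dom _ _ St c p -> @dom _ _ St c' p ->
  integral_basis c p b -> integral_basis c' p b.
Proof.
move=> cp c'p [[tb bE] bI]; split; first split=> // m.
  by rewrite (coframe_tangent HS cp c'p (tb m)).
by move=> m n; exact: (integral_pair_tangent HS cp c'p (tb m) (tb n)).
Qed.

Lemma expanded_chart c c' p b v : @dom _ _ St c p -> @dom _ _ St c' p -> tangent p v ->
  expanded c p b v -> expanded c' p b v.
Proof. by move=> cp c'p tv; rewrite /expanded (coframe_tangent HS cp c'p tv). Qed.

(** Either condition says how v is determined by its eta-components: [jet] is linear in r, and r is
    recovered from these components by inverting the frame. *)
Lemma jet_expanded c p b q : @dom _ _ St c p -> adapted c p b ->
  (forall m, b m c = jet (crd c p) q (b m c).1.1) ->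
  forall v, tangent p v -> v c = jet (crd c p) q (v c).1.1 <-> expanded c p b v.
Proof.
move=> cp [tb bE] qE v tv; have uf := coord_unit HS cp.
set z := crd c p in uf bE qE *.
pose s := coframe_at z (v c); pose r := \sum_m s 0 m *: (b m c).1.1.
have sumE : (\sum_m s 0 m *: b m) c = jet z q r.
  by rewrite tvec_sumE jet_sum; apply: eq_bigr => m _; rewrite -qE.
have rE : r = (v c).1.1.
  have uft : z.1.2^T \in unitmx by rewrite unitmx_tr.
  rewrite -[LHS](mulmxK uft) -[RHS](mulmxK uft); congr (_ *m _).
  rewrite -[RHS]/s [RHS]row_sum_delta /r mulmx_suml; apply: eq_bigr => m _.
  by rewrite -scalemxAl; congr (_ *: _); exact: bE.
split=> [E|E]; last by rewrite {1}E sumE rE.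
have sE : v c = (\sum_m s 0 m *: b m) c by rewrite sumE rE.
exact: (tangent_inj cp tv (tangent_sum (fun m => s 0 m) tb) sE).
Qed.

Lemma integral_basis_jet c p b : @dom _ _ St c p -> integral_basis c p b ->
  exists q, forall v, tangent p v ->
    v c = jet (crd c p) q (v c).1.1 <-> expanded c p b v.
Proof.
move=> cp [ab bI]; have [q qE] := integral_jet (coord_unit HS cp) ab.2 bI.
by exists q; exact: jet_expanded.
Qed.

(** Seven members of the ideal give all the equations: the five generators, d theta^1 and d
    theta^2. *)
Lemma integral_element_pair p E : E `<=` tangent p ->
  (forall k (w : mform St k), @I_tilde R S k w -> vanishes_on w p E) ->
  forall c, @dom _ _ St c p -> forall v w, E v -> E w ->
  integral_pair (crd c p) (v c) (w c).
Proof.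
move=> Et EI c cp v w Ev Ew.
pose vw (j : 'I_2) := if j == ord0 then v else w.
have Evw j : E (vw j) by rewrite /vw; case: ifP.
have vwE : (fun j => vw j c) = pair_of (v c) (w c).
  by apply: funext => j; rewrite /vw /pair_of; case: ifP.
have I2 (g : mform St 2) : @I_tilde R S 2 g -> g c (crd c p) (pair_of (v c) (w c)) = 0.
  by move=> Ig; rewrite -vwE; exact: EI Ig c cp vw Evw.
have I1 (g : mform St 1) : @I_tilde R S 1 g -> covec (g c) (crd c p) (v c) = 0.
  by move=> Ig; exact: (EI _ _ Ig c cp (fun=> v)).
apply/integral_pairP; split; first split.
- exact: (I2 (fun=> @Theta1 R) (ideal_gen (gen_Theta1 S))).
- exact: (I2 (fun=> @Theta2 R) (ideal_gen (gen_Theta2 S))).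
- exact: (I2 (fun=> @Theta3 R) (ideal_gen (gen_Theta3 S))).
- exact: (I1 (fun=> @theta1 R) (ideal_gen (gen_theta1 S))).
- exact: (I1 (fun=> @theta2 R) (ideal_gen (gen_theta2 S))).
- exact: (I2 (fun=> dext (@theta1 R)) (ideal_d (ideal_gen (gen_theta1 S)))).
- exact: (I2 (fun=> dext (@theta2 R)) (ideal_d (ideal_gen (gen_theta2 S)))).
Qed.

(* The dual basis of the restrictions of the eta^i to an integral element. *)
Lemma integral_element_basis p E (H : is_plane 3 p E) :
  prolongation_space (exist _ (p, E) H : grassmann St 3 15) -> exists b,
  forall c, @dom _ _ St c p -> integral_basis c p b /\
    forall v, E v <-> expanded c p b v.
Proof.
have [Et [e [Ee _]]] := H => -[EI0 nO0].
have EI : forall k (w : mform St k), @I_tilde R S k w -> vanishes_on w p E by exact: EI0.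
have nO : ~ vanishes_on (@Omega R S) p E by exact: nO0.
have Elin (t : 'I_3 -> R) : E (\sum_i t i *: e i) by rewrite Ee; exists t.
have ein i : E (e i).
  suff -> : e i = \sum_j (j == i)%:R *: e j by exact: Elin.
  rewrite (bigD1 i) //= eqxx scale1r big1 ?addr0 // => j /negPf ->.
  by rewrite scale0r.
pose C c : 'M[R]_3 := \matrix_i coframe_at (crd c p) (e i c).
have CE c v t : v = \sum_i t i *: e i ->
    coframe_at (crd c p) (v c) = (\row_i t i) *m C c.
  move=> ->; rewrite tvec_sumE coframe_sum mulmx_sum_row.
  by apply: eq_bigr => i _; rewrite mxE rowK.
have Cchart c c' : @dom _ _ St c p -> @dom _ _ St c' p -> C c' = C c.
  by move=> cp c'p; apply/row_matrixP => i; rewrite !rowK; exact: (coframe_tangent HS cp c'p (Et _ (ein i))).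
(* If the matrix of eta on the basis [e] were singular in every chart, the determinant formula would
   make Omega vanish on E. *)
have [c0 [c0p uC0]] : exists c, @dom _ _ St c p /\ C c \in unitmx.
  apply: contrapT => nC; apply: nO => c cp v Ev.
  rewrite OmegaE; apply/eqP/negPn/negP => d0.
  apply: nC; exists c; split => //.
  have [t tE] : {t : 'I_3 -> ('I_3 -> R) & forall m, v m = \sum_i t m i *: e i}.
    apply: (@choice _ _ (fun m s => v m = \sum_i s i *: e i)) => m.
    by have := Ev m; rewrite Ee => -[s _ <-]; exists s.
  have : (\matrix_(m, i) coframe_at (crd c p) (v m c) 0 i) = (\matrix_m \row_i t m i) *m C c.
    by apply/row_matrixP => m; rewrite row_mul !rowK (CE c _ _ (tE m)).
  move=> ME; move: d0; rewrite ME det_mulmx mulf_eq0 negb_or => /andP[_].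
  by rewrite unitmxE unitfE.
pose D := invmx (C c0).
pose b m := \sum_i D m i *: e i.
exists b => c cp; have uC : C c \in unitmx by rewrite (Cchart c0 c).
have DE : D = invmx (C c) by rewrite (Cchart c0 c).
have bE m : coframe_at (crd c p) (b m c) = delta_mx 0 m.
  rewrite (CE c _ (D m) erefl) (_ : \row_i D m i = row m D); last by apply/rowP => i; rewrite !mxE.
  by rewrite -row_mul DE mulVmx // row1.
have Eb m : E (b m) by exact: Elin.
split; first split; first by split=> // m; exact: Et.
  by move=> m n; exact: (integral_element_pair Et EI cp).
have bsum (s : 'rV[R]_3) : \sum_m s 0 m *: b m = \sum_i (s *m D) 0 i *: e i.
  under eq_bigr do rewrite scaler_sumr.
  rewrite exchange_big /=; apply: eq_bigr => i _.
  by rewrite mxE scaler_suml; apply: eq_bigr => m _; rewrite scalerA.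
move=> v; split=> [|->]; last by rewrite bsum; exact: Elin.
rewrite Ee => -[t _ tv]; rewrite /expanded bsum (CE c v t (esym tv)) DE mulmxK // -tv.
by apply: eq_bigr => i _; rewrite mxE.
Qed.

(** A form of the ideal must vanish in every chart, so the basis is carried to each chart before
    [integral_basis_jet] and [I_tilde_jet] apply. *)
Lemma prolongation_of_basis c p b E (H : is_plane 3 p E) : @dom _ _ St c p ->
  integral_basis c p b -> (forall v, E v <-> tangent p v /\ expanded c p b v) ->
  prolongation_space (exist _ (p, E) H : grassmann St 3 15).
Proof.
move=> cp ib EP; split=> [k w Iw c' c'p v Ev|/(_ c cp b)] /=.
  have ib' := integral_basis_chart cp c'p ib.
  have [q qP] := integral_basis_jet c'p ib'.
  have [_ w0] := I_tilde_jet HS Iw c'.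
  rewrite -[RHS](w0 (crd c' p) q (fun i => (v i c').1.1)); last by exists p.
  congr (w c' _ _); apply: funext => i.
  have /EP[tv ev] := Ev i; apply/(qP _ tv).
  exact: expanded_chart cp c'p tv ev.
have [[tb bE] _] := ib.
have Eb m : E (b m).
  apply/EP; split; first exact: tb.
  rewrite /expanded bE (bigD1 m) //= mxE !eqxx scale1r big1 ?addr0 // => j /negPf jm.
  by rewrite mxE jm andbF scale0r.
move=> /(_ Eb); rewrite OmegaE (_ : (\matrix_(m, i) _) = 1%:M) ?det1.
  by move/eqP; rewrite oner_eq0.
by apply/row_matrixP => m; rewrite row1 rowK; exact: bE.
Qed.

End IntegralElements.

(** * The parametrization of the prolongation *)

Section PlaneCoordinates.
Variables (R : realType) (V : normedModType R) (M : charted V) (n q : nat).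

Lemma graph_inj (g : splitting V n q) (a a' : 'M[R]_(n, q)) :
  (forall w, graph g a w -> graph g a' w) -> a = a'.
Proof.
have [g' gK g'K] := split_bij g => H; apply/row_matrixP => i; rewrite !rowE.
have := H (g' (delta_mx 0 i, delta_mx 0 i *m a)).
by rewrite /graph /= g'K /= => /(_ erefl).
Qed.

Lemma plane_coord_unique (c : chart M) (g : splitting V n q) p E a a' :
  differentiable_atlas M -> dom c p ->
  plane_coord c g p E a -> plane_coord c g p E a' -> a = a'.
Proof.
move=> HA cp aP aP'; apply: (@graph_inj g) => w gw.
have [v tv vc] := tangent_lift HA w cp.
by move: gw; rewrite -vc => /(aP v tv)/(aP' v tv).
Qed.

Lemma plane_coordE (c : chart M) (g : splitting V n q) p E a :
  differentiable_atlas M -> dom c p -> plane_coord c g p E a ->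
  xget 0 (plane_coord c g p E) = a.
Proof.
move=> HA cp aP; case: xgetP => [b _ bP|/(_ a)//].
exact: plane_coord_unique HA cp bP aP.
Qed.

End PlaneCoordinates.

Section PolynomialJets.
Variable R : realType.
Local Notation TM := (tilde_model R).
Local Notation Y := 'rV[R]_(3 + (3 * 3 + 6) + 24).
Implicit Types (y : Y) (z : TM) (p : 'rV[R]_24).

Ltac poly_rec := lazymatch goal with
  | |- poly_map (fun t => (@?f t + @?g t)%R) => refine (@poly_map_add _ _ _ f g _ _); poly_rec
  | |- poly_map (fun t => (@?f t * @?g t)%R) => refine (@poly_map_mul _ _ f g _ _); poly_rec
  | |- poly_map (fun t => (- @?f t)%R) => refine (@poly_map_opp _ _ _ f _); poly_rec
  | _ => idtac
  end.

Lemma poly_map_base : poly_map (@base R).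
Proof. exact/poly_map_of_row/base_linear. Qed.

Lemma poly_map_param n : poly_map (fun y => pr (params y) n : R^o).
Proof. by apply: poly_map_of_row => a u v; rewrite /pr params_linear !mxE. Qed.

Lemma poly_map_scalar_coord k : poly_map (fun y => (base y).2 0 k : R^o).
Proof. by apply: poly_map_of_row => a u v; rewrite base_linear !mxE. Qed.

Lemma poly_map_frame_coord i j : poly_map (fun y => (base y).1.2 i j : R^o).
Proof. by apply: poly_map_of_row => a u v; rewrite base_linear !mxE. Qed.

Lemma poly_map_coframe_coord (r : 'rV[R]_3) i :
  poly_map (fun y => (r *m (base y).1.2^T) 0 i : R^o).
Proof.
apply: poly_map_of_row => a u v; rewrite base_linear.
rewrite -[(a *: base u + base v).1.2]/(a *: (base u).1.2 + (base v).1.2).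
by rewrite [_^T]linearP mulmxDr -scalemxAr !mxE.
Qed.

Section Composition.
Variables (V : normedModType R) (s : V -> 'rV[R]_6) (p : V -> 'rV[R]_24) (e : V -> 'rV[R]_3).
Hypothesis ps : forall k, poly_map (fun x => s x 0 k : R^o).
Hypothesis pp : forall n, poly_map (fun x => pr (p x) n : R^o).
Hypothesis pe : forall m, poly_map (fun x => e x 0 m : R^o).

Lemma poly_map_connection i k : poly_map (fun x => connection (s x) (p x) (e x) i k : R^o).
Proof.
apply: (@poly_map_eq _ _ _ (fun x => (\sum_m pr (p x) (sym_index i k m) * e x 0 m) +
    torsion_part (s x) (e x) i k : R^o)).
  by move=> x; rewrite [in RHS]mxE [sym_part _ _ _ _]mxE.
apply: poly_map_add.
  by apply: poly_map_sum => m _; exact: poly_map_mul.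
elim/ord3_ind: i; elim/ord3_ind: k; (apply: poly_map_eq;
  first by move=> x; rewrite [RHS]mxE /=; reflexivity); rewrite /y0 /y1; poly_rec => //;
  exact: poly_map_cst.
Qed.

Lemma poly_map_scalar_part k : poly_map (fun x => scalar_part (s x) (p x) (e x) 0 k : R^o).
Proof.
elim/ord6_ind: k; (apply: poly_map_eq;
  first by move=> x; rewrite [RHS]mxE /=; reflexivity);
  rewrite /y0 /y1 /y2 /y3 /y4 /y5; poly_rec => //; exact: poly_map_cst.
Qed.

End Composition.

Lemma poly_map_flat_jet r a : poly_map (fun y => flat (jet (base y) (params y) r) 0 a : R^o).
Proof.
have pe m := poly_map_coframe_coord r m; have pp n := poly_map_param n.
have ps k := poly_map_scalar_coord k.
elim/flat_ind: a => [i j|k].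
  apply: (@poly_map_eq _ _ _ (fun y => \sum_k
    connection (base y).2 (params y) (r *m (base y).1.2^T) i k * (base y).1.2 k j : R^o)).
    by move=> y; rewrite flat_frame [RHS]mxE.
  apply: poly_map_sum => k _; apply: poly_map_mul; last exact: poly_map_frame_coord.
  exact: (poly_map_connection ps pp pe).
apply: poly_map_eq (poly_map_scalar_part ps pp pe k).
by move=> y; rewrite flat_scalar.
Qed.

End PolynomialJets.

(** * Recovering the parameters from a plane *)

Section JetRecovery.
Variable R : realType.
Local Notation TM := (tilde_model R).
Local Notation Y := 'rV[R]_(3 + (3 * 3 + 6) + 24).
Implicit Types (y : Y) (z : TM) (p : 'rV[R]_24) (a : 'M[R]_(3, 15)).

Definition jet_mx z p : 'M[R]_(3, 15) := \matrix_(l, a) flat (jet z p (delta_mx 0 l)) 0 a.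

Lemma mul_jet_mx z p (r : 'rV[R]_3) : r *m jet_mx z p = flat (jet z p r) :> 'rV[R]_15.
Proof.
apply/rowP => a; rewrite mxE.
rewrite (@linear_row3 _ (fun r => flat (jet z p r) 0 a)) => [|c e e'].
  by apply: eq_bigr => l _; rewrite [jet_mx _ _ _ _]mxE.
by rewrite jetP flat_linear; move: (flat _) (flat _) => u u'; rewrite !mxE.
Qed.

(** The dx-components of the m-th vector of the basis dual to eta. *)
Definition frame_vec z m : 'rV[R]_3 := delta_mx 0 m *m (invmx z.1.2)^T.

Lemma frame_vecK z m : z.1.2 \in unitmx -> frame_vec z m *m z.1.2^T = delta_mx 0 m.
Proof. by move=> uf; rewrite /frame_vec -mulmxA -trmx_mul mulmxV // trmx1 mulmx1. Qed.

Definition recover_frame z a m : 'M[R]_3 :=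
  vec_mx (lsubmx (frame_vec z m *m a : 'rV[R]_(3 * 3 + 6))) *m invmx z.1.2.

Definition recover_scalars z a m : 'rV[R]_6 :=
  rsubmx (frame_vec z m *m a : 'rV[R]_(3 * 3 + 6)).

(** Left inverse of [jet_mx z]: the matrix is evaluated on the basis dual to eta, df is turned into
    df f^-1, and [jet_param] reads the result. *)
Definition recover z a : 'rV[R]_24 :=
  jet_param (recover_frame z a) (fun m => ((0, 0, recover_scalars z a m) : TM)).

Lemma jet_paramK (y : 'rV[R]_6) p :
  jet_param (fun m => connection y p (delta_mx 0 m))
    (fun m => ((0, 0, scalar_part y p (delta_mx 0 m)) : TM)) = p.
Proof.
have CE i k m : connection y p (delta_mx 0 m) i k =
    \sum_l pr p (sym_index i k l) * (l == m)%:R + torsion_part y (delta_mx 0 m) i k.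
  by rewrite [LHS]mxE [X in X + _]mxE; congr (_ + _); apply: eq_bigr => l _; rewrite mxE eqxx.
apply/rowP => n; rewrite -[n in RHS]inord_val -/(pr p n) mxE.
case: n => n ltn /=; rewrite /y2 /y3 /y4 /y5 /=.
do 24?[case: n ltn => [|n] ltn; first by
  rewrite /= ?CE ?sum3 [in LHS]mxE ?mxE /=; ring].
by [].
Qed.

Lemma recoverK z p : z.1.2 \in unitmx -> recover z (jet_mx z p) = p.
Proof.
move=> uf; rewrite -[RHS](jet_paramK z.2) /recover.
have E m : frame_vec z m *m jet_mx z p = flat (jet z p (frame_vec z m)) by exact: mul_jet_mx.
congr jet_param; apply: funext => m; rewrite /recover_frame /recover_scalars E /flat.
  by rewrite row_mxKl mxvecK /jet mulmxK // frame_vecK.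
by rewrite row_mxKr /jet frame_vecK.
Qed.

End JetRecovery.

Section Differentiability.
Variables (R : realType) (V : normedModType R).

Lemma differentiable_ext (W : normedModType R) (f g : V -> W) x :
  f =1 g -> differentiable f x -> differentiable g x.
Proof. by move=> /funext ->. Qed.

(** Cramer's formula, valid at invertible matrices, which form an open set. *)
Lemma differentiable_invmx n (f : V -> 'M[R]_n) x :
  (forall i j, poly_map (fun x => f x i j : R^o)) -> f x \in unitmx ->
  differentiable (fun x => invmx (f x)) x.
Proof.
move=> pf ux; apply: (@differentiable_eq_near _ _ _
    (fun x => ((\det (f x))^-1 : R^o) *: \adj (f x))).
  by apply: filterS (open_near (open_unitmx pf) ux) => y uy; rewrite /invmx [f y \in _]uy.
apply: differentiable_scaled.
  apply: differentiableV; first exact: (poly_map_differentiable _ (poly_map_det pf)).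
  by rewrite -unitfE -unitmxE.
apply: differentiable_mx => i j; apply: poly_map_differentiable.
apply: (@poly_map_eq _ _ _ (fun y => (-1) ^+ (j + i) * \det (row' j (col' i (f y))) : R^o)).
  by move=> y; rewrite mxE.
apply: poly_map_mul; first exact: poly_map_cst.
apply: poly_map_det => k l; apply: poly_map_eq (pf (lift j k) (lift i l)) => y.
by rewrite !mxE.
Qed.

Section JetParameters.
Variables (C : V -> 'I_3 -> 'M[R]_3) (b : V -> 'I_3 -> tilde_model R) (x : V).
Hypothesis dC : forall m i k, differentiable (fun u => C u m i k : R^o) x.
Hypothesis db : forall m k, differentiable (fun u => (b u m).2 0 k : R^o) x.

Lemma differentiable_jet_param : differentiable (fun u => jet_param (C u) (b u)) x.
Proof.
apply: differentiable_mx => i [n ltn].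
do 24?[case: n ltn => [|n] ltn; first by
  (apply: differentiable_ext; first by move=> u; rewrite [RHS]mxE /=; reflexivity);
  first [exact: dC|exact: db]].
by [].
Qed.

End JetParameters.

Variables (f : V -> tilde_model R) (p : V -> 'rV[R]_24) (x : V).
Hypothesis dpos : differentiable (fun u => (f u).1.1) x.
Hypothesis dframe : differentiable (fun u => (f u).1.2) x.
Hypothesis dscal : differentiable (fun u => (f u).2) x.
Hypothesis dp : differentiable p x.

Lemma differentiable_assemble : differentiable (fun u => assemble (f u) (p u)) x.
Proof.
apply: differentiable_mx => i k; rewrite [i]ord1.
case: (split_ordP k) => j ->; last first.
  by apply: (differentiable_ext _ (differentiable_entry 0 j dp)) => u; rewrite row_mxEr.
case: (split_ordP j) => l ->.
  by apply: (differentiable_ext _ (differentiable_entry 0 l dpos)) => u; rewrite row_mxEl row_mxEl.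
elim/flat_ind: l => [i' j'|k'].
  apply: (differentiable_ext _ (differentiable_entry i' j' dframe)) => u.
  by rewrite row_mxEl row_mxEr flat_frame.
apply: (differentiable_ext _ (differentiable_entry 0 k' dscal)) => u.
by rewrite row_mxEl row_mxEr flat_scalar.
Qed.

End Differentiability.

Section LeftInverse.
Variable R : realType.
Local Notation TM := (tilde_model R).
Local Notation GM := (TM * 'M[R]_(3, 15))%type.

Lemma linear_differentiable_of_cont (V W : normedModType R) (f : V -> W) x :
  linear f -> continuous f -> differentiable f x.
Proof.
by move=> L cf; exact: (poly_map_differentiable x (poly_map_linear (f := lin_of L) cf)).
Qed.

(** A left inverse of [psi] extended to the ambient model and differentiable where the frame is
    invertible; its continuity makes [psi] a homeomorphism onto its image. *)
Definition recover_point (u : GM) := assemble u.1 (recover u.1 u.2).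

Lemma differentiable_recover_point (u : GM) : u.1.1.2 \in unitmx ->
  differentiable recover_point u.
Proof.
move=> uf.
have dfst : differentiable (fun v : GM => v.1) u.
  by apply: linear_differentiable_of_cont => // v; exact: cvg_fst.
have dsnd : differentiable (fun v : GM => v.2) u.
  by apply: linear_differentiable_of_cont => // v; exact: cvg_snd.
have dpos : differentiable (fun v : GM => v.1.1.1) u.
  exact: (differentiable_comp dfst (poly_map_differentiable u.1 (@poly_map_pos R))).
have dframe : differentiable (fun v : GM => v.1.1.2) u.
  exact: (differentiable_comp dfst (poly_map_differentiable u.1 (@poly_map_frame R))).
have dscal : differentiable (fun v : GM => v.1.2) u.
  exact: (differentiable_comp dfst (poly_map_differentiable u.1 (@poly_map_scalars R))).
have dinv : differentiable (fun v : GM => invmx v.1.1.2) u.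
  exact: (differentiable_comp dfst (differentiable_invmx (@poly_map_frame_entry R) uf)).
have dx m : differentiable (fun v : GM => frame_vec v.1 m) u.
  apply: differentiable_mulmx; first exact: differentiable_cst.
  exact: differentiable_trmx.
have dt m : differentiable (fun v : GM => frame_vec v.1 m *m v.2) u.
  exact: differentiable_mulmx.
apply: differentiable_assemble => //.
apply: differentiable_jet_param => [m i k|m k].
  apply: differentiable_entry; apply: differentiable_mulmx => //.
  apply: differentiable_mx => i' j'.
  apply: (differentiable_ext _ (differentiable_entry 0 (lshift 6 (mxvec_index i' j')) (dt m))).
  by move=> v; rewrite [RHS]mxE [RHS]mxE.
apply: (differentiable_ext _ (differentiable_entry 0 (rshift (3 * 3) k) (dt m))).
by move=> v; rewrite [RHS]mxE.
Qed.

End LeftInverse.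

Section Splitting.
Variable R : realType.
Local Notation TM := (tilde_model R).
Local Notation Y := 'rV[R]_(3 + (3 * 3 + 6) + 24).

Lemma split_fibre_linear (a : R) (u w : TM) :
  (((a *: u + w).1.1, flat (a *: u + w)) : 'rV[R]_3 * 'rV[R]_15) =
  a *: (u.1.1, flat u) + (w.1.1, flat w).
Proof. by rewrite flat_linear. Qed.

Lemma split_fibre_bij : bijective (fun w : TM => (w.1.1, flat w) : 'rV[R]_3 * 'rV[R]_15).
Proof.
exists (fun xt => (xt.1, vec_mx (lsubmx (xt.2 : 'rV[R]_(3 * 3 + 6))), rsubmx (xt.2 : 'rV[R]_(3 * 3 + 6)))).
  by move=> [[x f] y]; rewrite /flat /= row_mxKl row_mxKr mxvecK.
by move=> [x t]; rewrite /flat /= vec_mxK hsubmxK.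
Qed.

(** The R^3 factor is the dx-direction, so the coordinate of an integral element is its matrix
    [jet_mx]. *)
Definition split_fibre : splitting TM 3 15 := Splitting split_fibre_linear split_fibre_bij.

Lemma graph_jet z p (w : TM) : graph split_fibre (jet_mx z p) w <-> w = jet z p w.1.1.
Proof.
have inj : injective split_fibre by exact: bij_inj split_fibre_bij.
rewrite /graph /=; split=> [e|e]; last by rewrite mul_jet_mx {1}e.
by apply: inj; rewrite -[LHS]/(w.1.1, flat w) -[RHS]/(w.1.1, flat (jet z p w.1.1)) e mul_jet_mx.
Qed.

Definition psi (y : Y) : TM * 'M[R]_(3, 15) := (base y, jet_mx (base y) (params y)).

Lemma poly_map_jet_mx : poly_map (fun y : Y => jet_mx (base y) (params y)).
Proof.
apply: poly_map_mx => l a.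
apply: (@poly_map_eq _ _ _ (fun y => flat (jet (base y) (params y) (delta_mx 0 l)) 0 a : R^o)).
  by move=> y; rewrite [RHS]mxE.
exact: poly_map_flat_jet.
Qed.

Lemma poly_map_psi : poly_map psi.
Proof.
apply: (@poly_map_eq _ _ _ (fun y : Y => ((base y, 0) : TM * 'M[R]_(3, 15)) +
    \sum_l \sum_a (jet_mx (base y) (params y) l a : R^o) *:
      ((0, delta_mx l a) : TM * 'M[R]_(3, 15)))).
  move=> y; rewrite /psi {2}[jet_mx (base y) (params y)]matrix_sum_delta.
  have E (A : 'I_3 -> 'I_15 -> R) : \sum_l \sum_a A l a *: ((0, delta_mx l a) : TM * 'M[R]_(3, 15)) =
      (0, \sum_l \sum_a A l a *: delta_mx l a).
    have L : linear (fun B : 'M[R]_(3, 15) => (0, B) : TM * 'M[R]_(3, 15)).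
      by move=> c B B'; rewrite -[RHS]/(c *: 0 + 0, c *: B + B') scaler0 addr0.
    rewrite -[RHS]/(lin_of L _) linear_sum; apply: eq_bigr => l _.
    by rewrite linear_sum; apply: eq_bigr => a _; rewrite linearZ.
  by rewrite (E (fun l a => jet_mx (base y) (params y) l a)) -[LHS]/(base y + 0, 0 + _) addr0 add0r.
apply: poly_map_add.
  apply: poly_map_of_row => a u v; rewrite base_linear.
  by rewrite -[RHS]/(a *: base u + base v, a *: 0 + 0) scaler0 addr0.
apply: poly_map_sum => l _; apply: poly_map_sum => a _.
apply: poly_map_scaled; last exact: poly_map_cst.
apply: (@poly_map_eq _ _ _ (fun y => flat (jet (base y) (params y) (delta_mx 0 l)) 0 a : R^o)).
  by move=> y; rewrite [RHS]mxE.
exact: poly_map_flat_jet.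
Qed.

Lemma diff_base (y u : Y) : 'd (@base R) y u = base u.
Proof. exact: linear_diff (@base_linear R) (poly_map_continuous (@poly_map_base R)). Qed.

(** On vectors with zero base component the differential of [psi] is the symbol up to sign, so the
    claim reduces to [symbol_inj]. *)
Lemma psi_immersion (y u : Y) : (base y).1.2 \in unitmx -> 'd psi y u = 0 -> u = 0.
Proof.
move=> uf.
have dQ := poly_map_differentiable y poly_map_jet_mx.
have := diff_pair (poly_map_differentiable y (@poly_map_base R)) dQ.
move=> /(congr1 (@^~ u)) => -> /= e.
have bu : base u = 0 by apply: etrans (esym (diff_base y u)) (congr1 fst e).
have Qu : 'D_u (fun y : Y => jet_mx (base y) (params y)) y = 0.
  exact: etrans (deriveE u dQ) (congr1 snd e).
have Q0 l a : flat (djet (base y) (params y) 0 (params u) (delta_mx 0 l)) 0 a = 0.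
  have := congr1 (fun A : 'M[R]_(3, 15) => A l a) Qu.
  rewrite derive_coord; last exact: diff_derivable.
  have -> : (fun y : Y => jet_mx (base y) (params y) l a : R^o) =
      (fun y => flat (jet (base y) (params y) (delta_mx 0 l)) 0 a : R^o).
    by apply: funext => y'; rewrite [LHS]mxE.
  have [_ ->] := derive_flat_jet y u (delta_mx 0 l) a.
  by rewrite bu [RHS]mxE.
(* Right multiplication by the frame passes from the basis dual to eta, used by [symbol], to the
   coordinate basis, used by [jet_mx]. *)
have S0 : symbol (base y).1.2 (base y).2 (params u) *m (base y).1.2 = 0.
  apply/matrixP => a j; rewrite symbol_mul [RHS]mxE rowE.
  by move: (Q0 j a); rewrite djet0 => ->; rewrite oppr0.
have pu : params u = 0.
  apply: (@symbol_inj _ (base y).1.2 (base y).2 uf).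
  by rewrite -[LHS](mulmxK uf) S0 mul0mx.
have lin0 (W : lmodType R) (f : Y -> W) : linear f -> f 0 = 0.
  by move=> L; rewrite -[LHS]/(lin_of L 0) linear0.
rewrite -[LHS]assemble_base -[RHS]assemble_base bu pu.
by rewrite (lin0 _ _ (@base_linear R)) (lin0 _ _ (@params_linear R)).
Qed.

Lemma psi_inj (y y' : Y) : (base y).1.2 \in unitmx -> psi y = psi y' -> y = y'.
Proof.
move=> uf e; have eb : base y = base y' := congr1 fst e.
have eq : jet_mx (base y) (params y) = jet_mx (base y') (params y') := congr1 snd e.
rewrite -[LHS]assemble_base -[RHS]assemble_base -eb; congr assemble.
by rewrite -(recoverK (params y) uf) eq -eb recoverK.
Qed.

Lemma recover_pointK (y : Y) : (base y).1.2 \in unitmx -> recover_point (psi y) = y.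
Proof. by move=> uf; rewrite /recover_point recoverK // assemble_base. Qed.

End Splitting.

Section Prolongation.
Variables (R : realType) (S : charted 'rV[R]_3).
Hypothesis HS : analytic_manifold S.
Local Notation TM := (tilde_model R).
Local Notation Y := 'rV[R]_(3 + (3 * 3 + 6) + 24).
Local Notation St := (Sigma_tilde S).
Local Notation G := (grassmann St 3 15).
Local Notation crd c p := (@Defs.coord _ _ St c p : TM).
Local Notation gchart c := ((c, split_fibre R) : chart G).
Implicit Types (c : chart S) (p : St) (x : G).

Let HA := differentiable_tilde_atlas HS.

(** Tangent lifts of [jet z q] at the vectors [frame_vec] form an integral basis, whose span is the
    plane sought. *)
Lemma exists_integral_element c z q : @codom_chart _ _ St c z ->
  exists x, [/\ prolongation_space x, @dom _ _ G (gchart c) x &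
    @Defs.coord _ _ G (gchart c) x = (z, jet_mx z q)].
Proof.
move=> [p cp pz]; have uf := coord_unit HS cp; rewrite pz in uf.
have [b bP] : {b : 'I_3 -> tvec St & forall m, tangent p (b m) /\ b m c = jet z q (frame_vec z m)}.
  apply: (@choice _ _ (fun m v => tangent p v /\ v c = jet z q (frame_vec z m))) => m.
  by have [v tv vc] := tangent_lift HA (jet z q (frame_vec z m)) cp; exists v.
have tb m : tangent p (b m) by case: (bP m).
have bc m : b m c = jet z q (frame_vec z m) by case: (bP m).
have ib : integral_basis c p b.
  split=> [|m n]; last by rewrite pz !bc; exact: jet_integral.
  by split=> // m; rewrite pz bc coframe_jet frame_vecK.
have bj m : b m c = jet (crd c p) q (b m c).1.1 by rewrite pz bc.
have expP := jet_expanded HS cp ib.1 bj.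
pose E : set (tvec St) := [set v | tangent p v /\ expanded c p b v].
have cofE (t : 'I_3 -> R) : coframe_at (crd c p) ((\sum_m t m *: b m) c) = \row_m t m.
  rewrite tvec_sumE coframe_sum [RHS]row_sum_delta.
  by apply: eq_bigr => m _; rewrite mxE; congr (_ *: _); exact: ib.1.2.
have H : is_plane 3 p E.
  split=> [v []//|]; exists b; split=> [|t t0 m].
    apply/seteqP; split=> [v [tv ev]|_ [t _ <-]].
      by exists (fun m => coframe_at (crd c p) (v c) 0 m).
    split; first exact: tangent_sum.
    by rewrite /expanded cofE; apply: eq_bigr => m _; rewrite mxE.
  have := congr1 (fun s : 'rV[R]_3 => s 0 m) (cofE t); rewrite [RHS]mxE => <-.
  rewrite t0; have -> : (0 : tvec St) c = 0 by [].
  by rewrite /coframe_at mul0mx mxE.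
have aP : plane_coord (c : chart St) (split_fibre R) p E (jet_mx z q).
  move=> v tv; have [e1 e2] := expP v tv; rewrite pz in e1 e2.
  split=> [[_ ev]|gv]; first by apply/graph_jet/e2.
  by split=> //; apply/e1/graph_jet.
exists (exist _ (p, E) H); split.
- exact: (prolongation_of_basis HS H cp ib (fun v => iff_refl _)).
- by split=> //; exists (jet_mx z q).
have aE := plane_coordE HA cp aP.
exact: (congr2 pair pz aE).
Qed.

Lemma integral_element_coord c x : prolongation_space x -> @dom _ _ St c (sval x).1 ->
  exists q, @dom _ _ G (gchart c) x /\
    @Defs.coord _ _ G (gchart c) x = (crd c (sval x).1, jet_mx (crd c (sval x).1) q).
Proof.
case: x => [[p E] H] Nx cp; have {}cp : @dom _ _ St c p := cp.
have [b bP] := integral_element_basis HS Nx.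
have [ib EP] := bP c cp; have [q qP] := integral_basis_jet HS cp ib.
have aP : plane_coord (c : chart St) (split_fibre R) p E (jet_mx (crd c p) q).
  move=> v tv; have [e1 e2] := qP v tv; have [e3 e4] := EP v.
  by split=> [/e3/e2/graph_jet|/graph_jet/e1/e4].
exists q; split; first by split=> //; exists (jet_mx (crd c p) q).
exact: (congr2 pair erefl (plane_coordE HA cp aP)).
Qed.

Definition chart_domain c : set Y := [set y | @codom_chart _ _ St c (base y)].

Lemma open_chart_domain c : open (chart_domain c).
Proof.
apply: open_comp (@open_tilde_codom _ _ HS c) => y _.
exact: (poly_map_continuous (@poly_map_base R)).
Qed.

Lemma chart_domain_unit c y : chart_domain c y -> (base y).1.2 \in unitmx.
Proof. by case/(tilde_codomE HS). Qed.

Lemma open_recover_point (O' : set Y) : open O' ->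
  open [set u : TM * 'M[R]_(3, 15) | u.1.1.2 \in unitmx /\ O' (recover_point u)].
Proof.
move=> oO'; rewrite openE => u [uf Ou]; rewrite /interior.
have cfst : continuous (fun v : TM * 'M[R]_(3, 15) => v.1) by move=> v; exact: cvg_fst.
have pf i j : poly_map (fun v : TM * 'M[R]_(3, 15) => v.1.1.2 i j : R^o).
  have L : linear (fun v : TM * 'M[R]_(3, 15) => v.1.1.2 i j : R^o) by move=> a v v'; rewrite !mxE.
  apply: (poly_map_linear (f := lin_of L)) => v.
  apply: (@continuous_comp _ _ _ (fun v : TM * 'M[R]_(3, 15) => v.1) (fun z : TM => z.1.2 i j : R^o) v (cfst v)).
  exact: (poly_map_continuous (@poly_map_frame_entry R i j)).
have n1 := open_near (open_unitmx pf) uf.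
have n2 : \forall v \near u, O' (recover_point v).
  apply: (differentiable_continuous (differentiable_recover_point uf)).
  exact: (open_near oO' Ou).
by apply: filterS2 n1 n2 => v.
Qed.

Lemma psi_parametrization c : parametrization (@prolongation_space R S) (gchart c)
  (chart_domain c) (@psi R).
Proof.
split.
- exact: open_chart_domain.
- exact: poly_map_analytic (@poly_map_psi R).
- by move=> y u /chart_domain_unit; exact: psi_immersion.
- by move=> y y' /chart_domain_unit uf _; exact: psi_inj.
(* The preimage of [O'] under the left inverse of [psi]: an integral element whose recovered
   parameters lie in [O'] is the image of these parameters. *)
move=> O' oO' O'O; exists [set u | u.1.1.2 \in unitmx /\ O' (recover_point u)].
  exact: open_recover_point.
apply/seteqP; split=> [_ [y O'y <-]|u [[x [xc Nx] xu] [uf Ou]]].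
  have Oy := O'O y O'y; have uf := chart_domain_unit Oy.
  split; last by split=> //; rewrite recover_pointK.
  have [x [Nx xc xE]] := exists_integral_element (params y) Oy.
  by exists x.
have cx : @dom _ _ St c (sval x).1 := xc.1.
have [q [_ xE]] := integral_element_coord Nx cx.
have uE : u = psi (assemble (crd c (sval x).1) q).
  by rewrite -xu xE /psi base_assemble params_assemble.
exists (recover_point u) => //; rewrite uE recover_pointK // base_assemble.
by have := coord_unit HS cx.
Qed.

End Prolongation.

(** * Generators of the canonical system *)

Section Generators.
Variable R : realType.
Local Notation TM := (tilde_model R).
Local Notation Y := 'rV[R]_(3 + (3 * 3 + 6) + 24).
Implicit Types (y u : Y).

Lemma diff_projection y u : 'd (fst \o @psi R) y u = base u.
Proof. exact: diff_base. Qed.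

Lemma poly_map_contact_form (a : 'I_15) v :
  poly_map (fun y => @contact_form R a y v : R^o).
Proof.
apply: (@poly_map_eq _ _ _ (fun y => (flat (base (v ord0)) 0 a : R) -
    flat (jet (base y) (params y) (base (v ord0)).1.1) 0 a : R^o)).
  by move=> y; rewrite /contact_form /vertical flat_sub [RHS]mxE [X in _ = _ + X]mxE.
apply: poly_map_add; first exact: poly_map_cst.
by apply: poly_map_opp; exact: poly_map_flat_jet.
Qed.

Lemma contact_form_multilinear (a : 'I_15) y : multilinear_alt (@contact_form R a y).
Proof.
apply: (@multilinear_alt1 _ _ (fun v => vertical y v 0 a)) => c v v'.
by rewrite vertical_linear; move: (vertical y v) (vertical y v') => t t'; rewrite !mxE.
Qed.

(** A covector annihilating the graph of the jet factors through the projection [vertical], whose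
    components are the contact forms. *)
Lemma contact_forms_generate (O : set Y) :
  generates_canonical (split_fibre R) O (@psi R) (@contact_form R).
Proof.
split=> [a y _|a v|y _ alpha].
- exact: contact_form_multilinear.
- exact/poly_map_analytic/poly_map_contact_form.
split=> [[t tE]|[lam lam0 lamE]].
  pose f (w : TM) : R^o := \sum_a t a * flat (w - jet (base y) (params y) w.1.1) 0 a.
  have fP : linear f.
    move=> c w w'; rewrite /f scaler_sumr -big_split; apply: eq_bigr => a _.
    rewrite -[(c *: w + w').1.1]/(c *: w.1.1 + w'.1.1) jetP opprD addrACA -scalerBr flat_linear.
    move: (flat _) (flat _) => s s'; rewrite !mxE mulrDr /GRing.scale /=; ring.
  exists (lin_of fP) => [w gw|u]; last by rewrite diff_projection tE.
  have e : w = jet (base y) (params y) w.1.1 by apply/graph_jet.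
  by apply: big1 => a _; rewrite -e subrr flat0 mulr0.
(* The coefficients are the values of the covector on the vertical basis. *)
exists (fun a => lam (unflat (delta_mx 0 a))) => u.
rewrite lamE diff_projection {1}(base_vertical y u) linearD.
rewrite lam0; last by apply/graph_jet.
rewrite add0r; have L := @unflat_linear R.
rewrite {1}[vertical y u]row_sum_delta -[unflat _]/(lin_of L _) !linear_sum.
by apply: eq_bigr => a _; rewrite !linearZ mulrC.
Qed.

End Generators.

Theorem theorem4p2 (R : realType) (S : charted ('rV[R]_3)%type)
    (HS : analytic_manifold S) :
  canonical_system_locally (@prolongation_space R S) (fun i _ => @eta R i)
    (fun m s O theta omega =>
       involutive_pfaffian O theta omega /\
       depend_on_functions O theta omega 3 3).
Proof.
move=> x Nx.
have [c cx] : exists c, @dom _ _ (Sigma_tilde S) c (sval x).1.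
  by case: HS => /(_ (pos (sval x).1)).
have [q [xc xE]] := integral_element_coord HS Nx cx.
exists (c, split_fibre R), (3 + (3 * 3 + 6) + 24)%N, 15%N, (@chart_domain R S c),
  (@psi R), (@contact_form R); split.
- exact: psi_parametrization.
- split=> //; exists (assemble (@Defs.coord _ _ (Sigma_tilde S) c (sval x).1) q).
    by rewrite /chart_domain /= base_assemble; exists (sval x).1.
  by rewrite xE /psi base_assemble params_assemble.
- exact: contact_forms_generate.
apply: contact_involutive => [y|y i v]; first exact: (chart_domain_unit HS).
by rewrite /covec /pullback etaE diff_projection.
Qed.
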